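(* Let $m\ge 1$, let $\varphi:[0,\infty)\to(0,\infty)$ be an admissible weight, and let $f:\mathbb{C}^m\to P^1(\mathbb{C})$ be a holomorphic mapping. Suppose that there exists a set $A\subset P^1(\mathbb{C})$ consisting of five distinct points such that $$\sup_{z\in f^{-1}(A),\ \|\xi\|=1}\varphi(\|z\|)\,E_{P^1(\mathbb{C})}(f(z),df(z)(\xi))<\infty.$$ Then $f\in\mathcal{Y}_{\varphi}(\mathbb{C}^m,P^1(\mathbb{C}))$.
   Context: Admissible weight: a positive function $\varphi:[0,\infty)\to(0,\infty)$ such that, with $$\gamma_r:=\sup_{r\le a<b}\left|\frac{\varphi(a)-\varphi(b)}{a-b}\right|,$$ there is a constant $C\in(0,1]$ with $\gamma_r\le C$ for all $r\in(0,\infty)$, and $\lim_{r\to\infty}\gamma_r=0$. Metric: $P^1(\mathbb{C})$ is identified with $\mathbb{C}\cup\{\infty\}$ and carries the Fubini–Study metric, given in homogeneous coordinates $x=[x_0:x_1]$ by $$ds^2=\frac{\langle dx,dx\rangle\langle x,x\rangle-|\langle x,dx\rangle|^2}{\langle x,x\rangle^2}.$$ $E_{P^1(\mathbb{C})}(p,\xi)=(ds^2(\xi,\bar\xi))^{1/2}$ is the length of the tangent vector $\xi$ at $p$; at a point where $f$ is finite, $E_{P^1(\mathbb{C})}(f(z),df(z)(\xi))=|df(z)(\xi)|/(1+|f(z)|^2)$. $\|\cdot\|$ is the Euclidean norm on $\mathbb{C}^m$, and $\xi$ ranges over unit vectors of $\mathbb{C}^m$. Weighted Yosida mappings: a holomorphic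 mapping $f:\mathbb{C}^m\to P^1(\mathbb{C})$ belongs to $\mathcal{Y}_{\varphi}(\mathbb{C}^m,P^1(\mathbb{C}))$ if $$\limsup_{\|z\|\to\infty,\ \|\xi\|=1}\varphi(\|z\|)\,E_{P^1(\mathbb{C})}(f(z),df(z)(\xi))<\infty,$$ where $df(z)$ is the differential of $f$ at $z$. *)

(* Defs.v *)
From HB Require Import structures.
From mathcomp Require Import all_boot all_order all_algebra complex.
From mathcomp Require Import all_classical all_reals all_analysis.
Set Implicit Arguments.
Unset Strict Implicit.
Unset Printing Implicit Defensive.
Import Order.TTheory GRing.Theory Num.Theory.
Import numFieldNormedType.Exports.
Local Open Scope classical_set_scope.
Local Open Scope ring_scope.

Definition weight_slope (R : realType) (phi : R -> R) (r : R) : \bar R :=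
  ereal_sup [set (`|(phi ab.1 - phi ab.2) / (ab.1 - ab.2)|)%:E
            | ab in [set ab : R * R | r <= ab.1 < ab.2]].

(* A weight is a total function [R -> R] of which only the values on
   [0, +oo[ are constrained or used. *)
Definition admissible_weight (R : realType) (phi : R -> R) : Prop :=
  [/\ forall x, 0 <= x -> 0 < phi x,
      exists2 c : R, 0 < c <= 1 &
        forall r, 0 < r -> (weight_slope phi r <= c%:E)%E
    & weight_slope phi r @[r --> +oo] --> 0%E].

(* The norm that the library puts on ['rV[R[i]^o]_m] is the maximum norm, which
   only serves for topology and differentiability; lengths are measured with
   the Euclidean norm below. *)
Definition enorm (R : realType) (m : nat) (z : 'rV[R[i]^o]_m) : R :=
  Num.sqrt (complex.Re (dotmx z z)).

Definition unit_sphere (R : realType) (m : nat) : set 'rV[R[i]^o]_m :=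
  [set xi | enorm xi = 1].

Definition P1 (R : realType) : Type := one_point_compactification R[i]^o.
HB.instance Definition _ (R : realType) := Topological.on (P1 R).

(* [Some w] is the point [1 : w] and [None] is the point [0 : 1].
   [chart p] is an affine coordinate around [p]: [w] if [p] is finite, [1 / w]
   if [p] is infinity.  The value given to the only point outside its domain
   (resp. [None] and [Some 0]) is irrelevant: [chart p] is only used near [p]. *)
Definition chart (R : realType) (p : P1 R) (q : P1 R) : R[i]^o :=
  match p, q with
  | Some _, Some w => w
  | Some _, None => 0
  | None, Some w => w^-1
  | None, None => 0
  end.

(* Homogeneous coordinates as a function of the affine coordinate [chart p]. *)
Definition homog (R : realType) (p : P1 R) (u : R[i]^o) : 'rV[R[i]^o]_2 :=
  match p with
  | Some _ => \row_j (if j == ord0 then 1 else u)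
  | None => \row_j (if j == ord0 then u else 1)
  end.

Definition fubini_study (R : realType) (x v : 'rV[R[i]^o]_2) : R[i] :=
  (dotmx v v * dotmx x x - `|dotmx x v| ^+ 2) / dotmx x x ^+ 2.

(* A tangent vector at [p] is given by its component [t] in [chart p]. *)
Definition tangent_length (R : realType) (p : P1 R) (t : R[i]) : R :=
  let u := chart p p in
  Num.sqrt (complex.Re (fubini_study (homog p u) ('d (homog p) u t))).

Definition holomorphic (R : realType) (m : nat) (f : 'rV[R[i]^o]_m -> P1 R) :=
  continuous f /\
  forall z, \forall w \near z, differentiable (chart (f z) \o f) w.

Definition dP1 (R : realType) (m : nat) (f : 'rV[R[i]^o]_m -> P1 R)
  (z xi : 'rV[R[i]^o]_m) : R[i] := 'd (chart (f z) \o f) z xi.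

Definition weighted_length (R : realType) (m : nat) (phi : R -> R)
    (f : 'rV[R[i]^o]_m -> P1 R) (zxi : 'rV[R[i]^o]_m * 'rV[R[i]^o]_m) : \bar R :=
  (phi (enorm zxi.1) * tangent_length (f zxi.1) (dP1 f zxi.1 zxi.2))%:E.

(* The filter of [||z|| -> +oo, ||xi|| = 1] on pairs [(z, xi)]. *)
Definition infinity_sphere (R : realType) (m : nat) :
    set_system ('rV[R[i]^o]_m * 'rV[R[i]^o]_m)%type :=
  filter_from [set: R]
    (fun r => [set z | r <= enorm z] `*` @unit_sphere R m).

Definition yosida (R : realType) (m : nat) (phi : R -> R)
    (f : 'rV[R[i]^o]_m -> P1 R) : Prop :=
  holomorphic f /\
  (limf_esup (weighted_length phi f) (@infinity_sphere R m) < +oo)%E.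

Lemma dotmx_sum (R : realType) (m : nat) (x y : 'rV[R[i]^o]_m) :
  dotmx x y = \sum_j x 0 j * (y 0 j)^*.
Proof. by rewrite dotmxE mxE; apply: eq_bigr => j _; rewrite !mxE. Qed.

Lemma diff_affine (K : numFieldType) (n : nat) (a b : 'rV[K]_n) (u t : K^o) :
  'd (fun v : K^o => a + v *: b) u t = t *: b.
Proof.
have d1 : is_diff u (cst a) 0 by exact: is_diff_cst.
have d2 : is_diff u ( *:%R ^~ b : K^o -> _) ( *:%R ^~ b).
  exact: is_diff_scalel.
have d3 := is_diffD d1 d2.
have -> : (fun v : K^o => a + v *: b) = cst a + ( *:%R ^~ b : K^o -> _) by [].
have -> := @diff_val _ _ _ _ _ _ _ d3.
exact: add0r.
Qed.

Lemma diff_homog (R : realType) (p : P1 R) (u t : R[i]^o) :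
  'd (homog p) u t = t *: delta_mx 0 (if p is Some _ then 1 else 0).
Proof.
pose a : 'rV[R[i]^o]_2 := delta_mx 0 (if p is Some _ then 0 else 1).
pose b : 'rV[R[i]^o]_2 := delta_mx 0 (if p is Some _ then 1 else 0).
have -> : homog p = (fun v : R[i]^o => a + v *: b).
  apply/funext => v; apply/rowP => j; rewrite /a /b /homog.
  by case: p {a b} => [w|]; rewrite !mxE /=;
    case: j => -[|[|//]] ? /=; rewrite ?mxE/= (mulr1, mulr0) (addr0, add0r).
exact: diff_affine.
Qed.

Lemma fubini_study_chart (R : realType) (x v : 'rV[R[i]]_2) (i : 'I_2) (w t : R[i]) :
  x = \row_j (if j == i then 1 else w) ->
  v = t *: delta_mx 0 (lift i ord0) ->
  Num.sqrt (complex.Re (fubini_study x v)) =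
  complex.Re `|t| / (1 + complex.Re `|w| ^+ 2).
Proof.
move=> -> ->.
have -> : fubini_study (\row_j (if j == i then 1 else w))
    (t *: delta_mx 0 (lift i ord0)) = (`|t| / (1 + `|w| ^+ 2)) ^+ 2.
  rewrite /fubini_study !dotmx_sum.
  have E (F : 'I_2 -> R[i]) : \sum_j F j = F i + F (lift i ord0).
    by rewrite (bigD1_ord i)//= big_ord1.
  rewrite !E !mxE !eqxx !(negbTE (neq_lift _ _)) eq_sym !(negbTE (neq_lift _ _)) /=.
  rewrite !mulr0 !mul0r !mulr1 !rmorph0 !rmorph1 !mulr0 !mulr1 !add0r.
  rewrite -!normCK normrM norm_conjC exprMn expr_div_n; congr (_ / _).
  by rewrite mulrDr mulr1 [_ * `|t| ^+ 2]mulrC addrK.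
have [a a0 ->] : exists2 a : R, 0 <= a & `|t| = a%:C%C.
  by exists (Num.sqrt (complex.Re t ^+ 2 + complex.Im t ^+ 2));
    rewrite ?sqrtr_ge0// normc_def.
have [b b0 ->] : exists2 b : R, 0 <= b & `|w| = b%:C%C.
  by exists (Num.sqrt (complex.Re w ^+ 2 + complex.Im w ^+ 2));
    rewrite ?sqrtr_ge0// normc_def.
have -> : (a%:C / (1 + b%:C ^+ 2) = (a / (1 + b ^+ 2))%:C :> R[i])%C.
  by rewrite fmorph_div rmorphD rmorph1 rmorphXn.
rewrite -rmorphXn /= sqrtr_sqr ger0_norm//.
by rewrite divr_ge0// addr_ge0// sqr_ge0.
Qed.

Lemma tangent_length_Some (R : realType) (w t : R[i]) :
  tangent_length (Some w : P1 R) t =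
  complex.Re `|t| / (1 + complex.Re `|w| ^+ 2).
Proof.
apply: (@fubini_study_chart _ _ _ ord0); first by [].
by rewrite diff_homog; congr (_ *: delta_mx _ _); apply/val_inj.
Qed.

Lemma tangent_length_None (R : realType) (t : R[i]) :
  tangent_length (None : P1 R) t = complex.Re `|t|.
Proof.
rewrite [RHS](_ : _ = complex.Re `|t| / (1 + complex.Re `|0 : R[i]| ^+ 2)).
  apply: (@fubini_study_chart _ _ _ 1).
    by apply/rowP => j; rewrite !mxE; case: j => -[|[|//]].
  by rewrite diff_homog; congr (_ *: delta_mx _ _); apply/val_inj.
by rewrite normr0 /= expr0n /= addr0 divr1.
Qed.

(* Main.v *)
(* By Zalcman's rescaling and a compactness argument along an ultrafilter, a
   failure of the estimate on complex lines produces a nonconstant g : C -> P^1,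
   covered by affine charts on discs of a fixed radius, whose spherical
   derivative vanishes wherever g takes one of the five values.  For four of
   these values a_i, Phi = g'^2 / prod (g - a_i) is entire: at a point where
   g = a_i, total ramification compensates the zero of the denominator.  It is
   moreover bounded: if |g'|^2 were large compared with |g - a_i|, Newton's
   method would find a simple zero of g - a_i nearby.  By Liouville's theorem Phi
   is constant, and comparing two choices of four values among the five gives
   that a nontrivial Moebius function of g is constant, a contradiction.  The
   weight enters only through its Lipschitz bound, which makes it comparable to
   a constant on the disc of radius phi(|z|) / 2 around z.

   The complex analysis rests on the maximum principle on squares: Goursat's
   lemma gives |f(p)|^n <= K max |f|^n on the boundary for all n, with K
   independent of n, hence |f(p)| <= max |f|.  Applied to divided differences,
   with finitely many exceptional points allowed, it yields Cauchy's estimates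
   and Taylor bounds. *)

Require Import Defs.
From mathcomp Require Import all_boot all_order all_algebra complex.
From mathcomp Require Import all_classical all_reals all_analysis.
From mathcomp Require Import ring lra.
Set Implicit Arguments.
Unset Strict Implicit.
Unset Printing Implicit Defensive.
Import Order.TTheory GRing.Theory Num.Theory.
Import numFieldNormedType.Exports.
Local Open Scope classical_set_scope.
Local Open Scope ring_scope.

(** * Complex modulus and complex differentiability *)

Section Modulus.
Context {R : realType}.
Local Notation C := R[i].

(** All estimates carry explicit constants depending only on a radius and a bound, since they must
    be uniform along a sequence of maps. This is what makes an ultrafilter convenient: pointwise
    limits exist at all points simultaneously, and the uniform Taylor bounds pass to these limits
    and show that they are holomorphic, with neither uniform convergence nor extraction of
    subsequences. Ramification of the limit is likewise obtained quantitatively, because the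
    rescaled maps only have a small spherical derivative at the five values. The bound on Phi
    combines four inequalities |g'|^2 <= K |g - a_i|: at each point at most one factor is small, and
    the inequality for that factor is the one to use. Divided differences are at first only known to
    be continuous at their base point, so the maximum principle and its first consequences tolerate
    finitely many points without differentiability. Infinity is treated by the symmetry w -> 1 / w,
    which preserves spherical derivatives and, once coordinates are exchanged in the linear forms,
    Phi. *)

Definition cabs (z : C) : R := Num.sqrt (complex.Re z ^+ 2 + complex.Im z ^+ 2).

Lemma cabsE (z : C) : cabs z = complex.Re `|z|.
Proof. by rewrite normc_def. Qed.

Lemma norm_cabs (z : C) : `|z| = (cabs z)%:C%C.
Proof. exact: normc_def. Qed.

Lemma cabs_ge0 z : 0 <= cabs z. Proof. exact: sqrtr_ge0. Qed.
Hint Resolve cabs_ge0 : core.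

Lemma cabsM x y : cabs (x * y) = cabs x * cabs y.
Proof. by apply: complexI; rewrite -norm_cabs normrM !norm_cabs -rmorphM. Qed.

Lemma cabsD x y : cabs (x + y) <= cabs x + cabs y.
Proof.
by rewrite -lecR rmorphD /= -(norm_cabs x) -(norm_cabs y) -norm_cabs ler_normD.
Qed.

Lemma cabsN x : cabs (- x) = cabs x.
Proof. by apply: complexI; rewrite -!norm_cabs normrN. Qed.

Lemma cabs_dist x y : cabs (x - y) = cabs (y - x).
Proof. by rewrite -cabsN opprB. Qed.

Lemma cabsB x y : cabs (x - y) <= cabs x + cabs y.
Proof. by rewrite -(cabsN y) cabsD. Qed.

Lemma cabsBd x y z : cabs (x - z) <= cabs (x - y) + cabs (y - z).
Proof. by rewrite -[x - z](subrKA y) cabsD. Qed.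

Lemma cabs_lb x y : cabs x - cabs y <= cabs (x + y).
Proof. by have := cabsB (x + y) y; rewrite addrK; lra. Qed.

Lemma cabs_lbB x y : cabs x - cabs y <= cabs (x - y).
Proof. by rewrite -(cabsN y) cabs_lb. Qed.

Lemma cabs_near w z : cabs z - cabs (w - z) <= cabs w.
Proof. by have := cabs_lbB z (z - w); rewrite subKr cabs_dist. Qed.

Lemma cabs0 : cabs 0 = 0.
Proof. by rewrite /cabs /= expr0n /= addr0 sqrtr0. Qed.

Lemma cabs_eq0 x : (cabs x == 0) = (x == 0).
Proof. by rewrite -(inj_eq (@complexI R)) -norm_cabs normr_eq0. Qed.

Lemma cabs_gt0 x : (0 < cabs x) = (x != 0).
Proof. by rewrite lt_def cabs_eq0 cabs_ge0 andbT. Qed.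

Lemma cabsV x : cabs x^-1 = (cabs x)^-1.
Proof. by apply: complexI; rewrite -norm_cabs normfV norm_cabs fmorphV. Qed.

Lemma cabsX x n : cabs (x ^+ n) = cabs x ^+ n.
Proof. by apply: complexI; rewrite -norm_cabs normrX norm_cabs rmorphXn. Qed.

Lemma cabs_real (x : R) : cabs (x%:C)%C = `|x|.
Proof. by rewrite /cabs /= expr0n /= addr0 sqrtr_sqr. Qed.

Lemma cabsi : cabs 'i%C = 1.
Proof. by rewrite /cabs /= expr0n /= add0r expr1n sqrtr1. Qed.

Lemma Re_le_cabs z : `|complex.Re z| <= cabs z.
Proof. by rewrite /cabs -sqrtr_sqr ler_sqrt ?lerDl ?addr_ge0 ?sqr_ge0. Qed.

Lemma Im_le_cabs z : `|complex.Im z| <= cabs z.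
Proof. by rewrite /cabs -sqrtr_sqr ler_sqrt ?lerDr ?addr_ge0 ?sqr_ge0. Qed.

Lemma cabs_le_ReIm z : cabs z <= `|complex.Re z| + `|complex.Im z|.
Proof.
have -> : z = (complex.Re z)%:C%C + 'i%C * (complex.Im z)%:C%C.
  by rewrite -complexE.
apply: le_trans (cabsD _ _) _; rewrite cabsM cabsi mul1r !cabs_real.
by case: z => a b /=; rewrite !mul0r !mulr0 !mul1r !subr0 ?addr0 ?add0r.
Qed.

Definition ccont (f : C -> C) (z : C) :=
  forall e : R, 0 < e -> exists2 d : R, 0 < d &
    forall w, cabs (w - z) < d -> cabs (f w - f z) < e.

Definition cderiv (f : C -> C) (z d : C) :=
  forall e : R, 0 < e -> exists2 r : R, 0 < r &
    forall w, cabs (w - z) < r ->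
      cabs (f w - f z - d * (w - z)) <= e * cabs (w - z).

Lemma cderiv_ccont f z d : cderiv f z d -> ccont f z.
Proof.
move=> fd e e0; have [r r0 H] := fd _ ltr01.
have B0 : 0 < 1 + cabs d by rewrite ltr_pwDl.
exists (Num.min r (e / (1 + cabs d))); first by rewrite lt_min r0 divr_gt0.
move=> w; rewrite lt_min => /andP[wr we].
rewrite ltr_pdivlMr // mulrC in we; apply: le_lt_trans we.
have -> : f w - f z = (f w - f z - d * (w - z)) + d * (w - z) by ring.
by rewrite mulrDl; apply: le_trans (cabsD _ _) _; rewrite lerD ?H ?cabsM.
Qed.

Lemma cderiv_eq f g z d r : 0 < r -> (forall w, cabs (w - z) < r -> f w = g w) ->
  cderiv f z d -> cderiv g z d.
Proof.
move=> r0 fg fd e e0; have [s s0 H] := fd _ e0.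
exists (Num.min r s); first by rewrite lt_min r0.
move=> w; rewrite lt_min => /andP[wr ws]; rewrite -!fg ?H //.
by rewrite subrr cabs0.
Qed.

Lemma ccont_eq f g z r : 0 < r -> (forall w, cabs (w - z) < r -> f w = g w) ->
  ccont f z -> ccont g z.
Proof.
move=> r0 fg fd e e0; have [s s0 H] := fd _ e0.
exists (Num.min r s); first by rewrite lt_min r0.
move=> w; rewrite lt_min => /andP[wr ws]; rewrite -!fg ?H //.
by rewrite subrr cabs0.
Qed.

Lemma ccont_cst a z : ccont (fun _ => a) z.
Proof. by move=> e e0; exists 1 => // w _; rewrite subrr cabs0. Qed.

Lemma ccont_id z : ccont id z.
Proof. by move=> e e0; exists e. Qed.

Lemma ccontD f g z : ccont f z -> ccont g z -> ccont (fun w => f w + g w) z.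
Proof.
move=> cf cg e e0.
have e20 : 0 < e / 2 by rewrite divr_gt0.
have [r r0 Hr] := cf _ e20; have [s s0 Hs] := cg _ e20.
exists (Num.min r s); first by rewrite lt_min r0.
move=> w; rewrite lt_min => /andP[/Hr wr /Hs ws].
have -> : f w + g w - (f z + g z) = (f w - f z) + (g w - g z) by ring.
by have := cabsD (f w - f z) (g w - g z); lra.
Qed.

Lemma ccontM f g z : ccont f z -> ccont g z -> ccont (fun w => f w * g w) z.
Proof.
move=> cf cg e e0; set A := cabs (f z); set B := cabs (g z).
have A0 : 0 <= A := cabs_ge0 _. have B0 : 0 <= B := cabs_ge0 _.
have AB0 : 0 < A + B + 1 by lra.
have d0 : 0 < Num.min 1 (e / (A + B + 1)) by rewrite lt_min ltr01 divr_gt0.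
have [r r0 Hr] := cf _ d0; have [s s0 Hs] := cg _ d0.
exists (Num.min r s); first by rewrite lt_min r0.
move=> w; rewrite lt_min => /andP[/Hr + /Hs]; rewrite !lt_min.
move=> /andP[f1 fe] /andP[g1 ge].
have -> : f w * g w - f z * g z =
  (f w - f z) * g z + f z * (g w - g z) + (f w - f z) * (g w - g z) by ring.
rewrite ltr_pdivlMr // in fe; rewrite ltr_pdivlMr // in ge.
have := cabsD ((f w - f z) * g z + f z * (g w - g z)) ((f w - f z) * (g w - g z)).
have := cabsD ((f w - f z) * g z) (f z * (g w - g z)).
rewrite !cabsM -/A -/B.
have := cabs_ge0 (f w - f z); have := cabs_ge0 (g w - g z).
move: (cabs (f w - f z)) (cabs (g w - g z)) f1 fe g1 ge => x y f1 fe g1 ge x0 y0.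
move=> H1 H2; have [xy|xy] := leP x y.
  have : x * B <= y * B by rewrite ler_wpM2r.
  have : x * y <= 1 * y by rewrite ler_wpM2r // ltW.
  lra.
have : A * y <= A * x by rewrite ler_wpM2l // ltW.
have : x * y <= x * 1 by rewrite ler_wpM2l // ltW.
lra.
Qed.

Lemma ccontX f z n : ccont f z -> ccont (fun w => f w ^+ n) z.
Proof.
move=> cf; elim: n => [|n IH]; first exact: (ccont_cst 1).
apply: (@ccont_eq (fun w => f w * f w ^+ n) _ _ 1) => //; last exact: ccontM.
by move=> w _; rewrite exprS.
Qed.

Lemma ccontV f z : ccont f z -> f z != 0 -> ccont (fun w => (f w)^-1) z.
Proof.
move=> cf fz0 e e0; set A := cabs (f z).
have A0 : 0 < A by rewrite cabs_gt0.
have d0 : 0 < Num.min (A / 2) (e * A ^+ 2 / 2).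
  by rewrite lt_min !divr_gt0 // mulr_gt0 // exprn_gt0.
have [r r0 Hr] := cf _ d0; exists r => // w /Hr; rewrite lt_min => /andP[H1 H2].
have fwA : A / 2 < cabs (f w).
  by have := cabs_near (f w) (f z); rewrite -/A; lra.
have fw0 : f w != 0 by rewrite -cabs_gt0; lra.
have -> : (f w)^-1 - (f z)^-1 = - (f w - f z) / (f w * f z).
  by field; rewrite ?fw0 ?fz0.
rewrite cabsM cabsN cabsV ltr_pdivrMr ?cabs_gt0 ?mulf_neq0 //.
rewrite cabsM -/A; apply: lt_trans H2 _.
by rewrite -mulrA ltr_pM2l //; rewrite expr2 mulrAC ltr_pM2r.
Qed.

Lemma cderiv_cst a z : cderiv (fun _ => a) z 0.
Proof. by move=> e e0; exists 1 => // w _; rewrite mul0r !subrr cabs0 mulr_ge0 // ltW. Qed.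

Lemma cderiv_id z : cderiv id z 1.
Proof. by move=> e e0; exists 1 => // w _; rewrite mul1r !subrr cabs0 mulr_ge0 // ltW. Qed.

Lemma cderivD f g z d d' : cderiv f z d -> cderiv g z d' ->
  cderiv (fun w => f w + g w) z (d + d').
Proof.
move=> cf cg e e0.
have e20 : 0 < e / 2 by rewrite divr_gt0.
have [r r0 Hr] := cf _ e20; have [s s0 Hs] := cg _ e20.
exists (Num.min r s); first by rewrite lt_min r0.
move=> w; rewrite lt_min => /andP[/Hr wr /Hs ws].
set a := f w - f z - d * (w - z) in wr; set b := g w - g z - d' * (w - z) in ws.
have -> : f w + g w - (f z + g z) - (d + d') * (w - z) = a + b by rewrite /a /b; ring.
by have := cabsD a b; lra.
Qed.

Lemma cderivM f g z d d' : cderiv f z d -> cderiv g z d' ->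
  cderiv (fun w => f w * g w) z (d * g z + f z * d').
Proof.
move=> cf cg e e0; set A := cabs (f z); set B := cabs (g z).
have A0 : 0 <= A := cabs_ge0 _. have B0 : 0 <= B := cabs_ge0 _.
set D := cabs d. have D0 : 0 <= D := cabs_ge0 _.
have S0 : 0 < A + B + D + 1 by lra.
pose k := e / (A + B + D + 1).
have k0 : 0 < k by rewrite divr_gt0.
have m0 : 0 < Num.min 1 k by rewrite lt_min ltr01.
have [r r0 Hr] := cf _ k0; have [s s0 Hs] := cg _ k0.
have [t t0 Ht] := cderiv_ccont cg m0.
exists (Num.min r (Num.min s t)); first by rewrite !lt_min r0 s0.
move=> w; rewrite !lt_min => /and3P[/Hr wr /Hs ws /Ht].
rewrite lt_min => /andP[w1 wk].
set a := f w - f z - d * (w - z) in wr; set b := g w - g z - d' * (w - z) in ws.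
set h := cabs (w - z) in wr ws.
have h0 : 0 <= h := cabs_ge0 _.
have -> : f w * g w - f z * g z - (d * g z + f z * d') * (w - z) =
  a * g z + f z * b + d * (w - z) * (g w - g z) + a * (g w - g z).
  by rewrite /a /b; ring.
have := cabsD (a * g z + f z * b + d * (w - z) * (g w - g z)) (a * (g w - g z)).
have := cabsD (a * g z + f z * b) (d * (w - z) * (g w - g z)).
have := cabsD (a * g z) (f z * b).
rewrite !cabsM -/A -/B -/D -/h => H1 H2 H3.
have P1 : cabs a * B <= k * h * B by rewrite ler_wpM2r.
have P2 : A * cabs b <= A * (k * h) by rewrite ler_wpM2l.
have P3 : D * h * cabs (g w - g z) <= D * h * k by rewrite ler_wpM2l ?mulr_ge0 // ltW.
have P4 : cabs a * cabs (g w - g z) <= cabs a * 1 by rewrite ler_wpM2l // ltW.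
have : e * h = k * h * B + A * (k * h) + D * h * k + k * h.
  by rewrite /k; field; rewrite gt_eqF.
lra.
Qed.

Lemma cderiv_comp f g z d d' : cderiv g z d -> cderiv f (g z) d' ->
  cderiv (fun w => f (g w)) z (d' * d).
Proof.
move=> cg cf e e0.
have S0 : 0 < cabs d + cabs d' + 2 by have := cabs_ge0 d; have := cabs_ge0 d'; lra.
pose k := Num.min 1 (e / (cabs d + cabs d' + 2)).
have k0 : 0 < k by rewrite lt_min ltr01 divr_gt0.
have [r r0 Hr] := cf _ k0; have [s s0 Hs] := cg _ k0.
have [t t0 Ht] := cderiv_ccont cg r0.
exists (Num.min s t); first by rewrite lt_min s0.
move=> w; rewrite lt_min => /andP[/Hs ws /Ht/Hr wr].
set a := g w - g z - d * (w - z) in ws.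
set b := f (g w) - f (g z) - d' * (g w - g z) in wr.
set h := cabs (w - z) in ws *.
have h0 : 0 <= h := cabs_ge0 _.
have -> : f (g w) - f (g z) - d' * d * (w - z) = b + d' * a by rewrite /a /b; ring.
have H1 := cabsD b (d' * a); rewrite cabsM in H1.
have H2 : cabs (g w - g z) <= cabs a + cabs d * h.
  have -> : g w - g z = a + d * (w - z) by rewrite /a; ring.
  by rewrite -cabsM cabsD.
have k1 : k <= 1 by rewrite ge_min lexx.
have ke : k * (cabs d + cabs d' + 2) <= e.
  by rewrite -ler_pdivlMr // ge_min lexx orbT.
have P0 : k * cabs (g w - g z) <= k * (1 * h + cabs d * h).
  apply: ler_wpM2l; first exact: ltW.
  by apply: le_trans H2 _; rewrite lerD2r (le_trans ws) // ler_wpM2r.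
have P1 : cabs d' * cabs a <= cabs d' * (k * h) by rewrite ler_wpM2l.
have P2 : k * (cabs d + cabs d' + 2) * h <= e * h by rewrite ler_wpM2r.
have : 0 <= k * h by rewrite mulr_ge0 // ltW.
lra.
Qed.

Lemma cderiv_inv z : z != 0 -> cderiv (fun w => w^-1) z (- (z ^- 2)).
Proof.
move=> z0 e e0.
have A0 : 0 < cabs z by rewrite cabs_gt0.
pose A := cabs z; pose r := Num.min (A / 2) (e * A ^+ 3 / 2).
exists r; first by rewrite lt_min !divr_gt0 // mulr_gt0 // exprn_gt0.
move=> w; rewrite lt_min => /andP[w1 w2].
have wA : A / 2 < cabs w.
  by have := cabs_near w z; rewrite -/A; lra.
have w0 : w != 0 by rewrite -cabs_gt0; move: A0; rewrite -/A; lra.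
have -> : w^-1 - z^-1 - - z ^- 2 * (w - z) = (w - z) ^+ 2 / (w * z ^+ 2).
  by field; rewrite ?w0 ?z0.
rewrite cabsM cabsV !cabsX cabsM cabsX -/A.
rewrite ler_pdivrMr ?mulr_gt0 ?exprn_gt0 ?cabs_gt0 //.
set h := cabs (w - z) in w1 w2 *.
have h0 : 0 <= h := cabs_ge0 _.
have P1 : h * h <= (e * A ^+ 3 / 2) * h by rewrite ler_wpM2r // ltW.
have P2 : e * h * A ^+ 2 * (A / 2) <= e * h * A ^+ 2 * cabs w.
  by rewrite ler_wpM2l ?mulr_ge0 ?exprn_ge0 // ltW.
rewrite expr2; apply: le_trans P1 _.
have -> : e * h * (cabs w * A ^+ 2) = e * h * A ^+ 2 * cabs w by ring.
by apply: le_trans P2; have -> : e * A ^+ 3 / 2 * h = e * h * A ^+ 2 * (A / 2) by field.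
Qed.

Lemma cderivV f z d : cderiv f z d -> f z != 0 ->
  cderiv (fun w => (f w)^-1) z (- d / f z ^+ 2).
Proof.
move=> fd f0; have := cderiv_comp fd (cderiv_inv f0).
by have -> : - f z ^- 2 * d = - d / f z ^+ 2 by rewrite mulrC mulrN mulNr.
Qed.

Lemma cderivX f z d n : cderiv f z d -> exists d', cderiv (fun w => f w ^+ n) z d'.
Proof.
move=> cf; elim: n => [|n [d' IH]]; first by exists 0; exact: (cderiv_cst 1).
exists (d * f z ^+ n + f z * d'); apply: cderiv_eq (cderivM cf IH); first exact: ltr01.
by move=> w _; rewrite exprS.
Qed.

Lemma cderiv_affine a b z : cderiv (fun w => a + b * w) z b.
Proof.
move=> e e0; exists 1 => // w _.
have -> : a + b * w - (a + b * z) - b * (w - z) = 0 by ring.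
by rewrite cabs0 mulr_ge0 // ltW.
Qed.

Lemma cderiv_unique f z d d' : cderiv f z d -> cderiv f z d' -> d = d'.
Proof.
move=> fd fd'; apply/eqP; rewrite -subr_eq0 -cabs_eq0; apply/negPn/negP => n0.
have e0 : 0 < cabs (d - d') / 4 by rewrite divr_gt0 // lt_def n0 /=.
have [r r0 Hr] := fd _ e0; have [s s0 Hs] := fd' _ e0.
pose t := Num.min r s / 2.
have t0 : 0 < t by rewrite divr_gt0 // lt_min r0.
have tc : cabs ((z + t%:C%C) - z) = t.
  by rewrite addrC addKr cabs_real gtr0_norm.
have mr : Num.min r s <= r by rewrite ge_min lexx.
have ms : Num.min r s <= s by rewrite ge_min lexx orbT.
have tr : t < r by rewrite /t; lra.
have ts : t < s by rewrite /t; lra.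
have := Hr (z + t%:C%C); have := Hs (z + t%:C%C); rewrite tc => /(_ ts) A /(_ tr) B.
move: A B; set a := _ - _ - _; set b := _ - _ - d * _ => A B.
have E : (d - d') * (z + t%:C%C - z) = a - b by rewrite /a /b; ring.
have := congr1 cabs E; rewrite cabsM tc => E'.
have := cabsB a b; rewrite -E'.
have : 0 < cabs (d - d') * t by apply: mulr_gt0 => //; lra.
lra.
Qed.

(** With [d] the derivative at [p], continuity at [p] is immediate; differentiability there waits
    for [removable_singularity]. *)
Definition divdiff (f : C -> C) (p d w : C) : C :=
  if w == p then d else (f w - f p) / (w - p).

Lemma divdiffE f p d w : w != p -> divdiff f p d w = (f w - f p) / (w - p).
Proof. by rewrite /divdiff => /negbTE ->. Qed.

Lemma divdiff_near f p d z : z != p -> forall w, cabs (w - z) < cabs (z - p) ->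
  (f w - f p) / (w - p) = divdiff f p d w.
Proof.
move=> zp w wz; rewrite divdiffE //; apply/eqP => wp.
by move: wz; rewrite wp cabs_dist ltxx.
Qed.

Lemma ccont_sub_cst f a z : ccont f z -> ccont (fun w => f w - a) z.
Proof. by move=> cf; apply: ccontD => //; exact: ccont_cst. Qed.

Lemma cderiv_sub_cst f a z d : cderiv f z d -> cderiv (fun w => f w - a) z d.
Proof. by move=> cf; have := cderivD cf (cderiv_cst (- a) z); rewrite addr0. Qed.

Lemma divdiff_ccont f p d z : cderiv f p d -> ccont f z -> ccont (divdiff f p d) z.
Proof.
move=> fd cf; have [->|zp] := eqVneq z p.
  move=> e e0; have [r r0 Hr] := fd _ (divr_gt0 e0 (ltr0Sn R 1)).
  exists r => // w /Hr; rewrite /divdiff eqxx.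
  case: eqP => [->|/eqP wp]; first by rewrite (subrr d) cabs0.
  have wp0 : w - p != 0 by rewrite subr_eq0.
  have -> : (f w - f p) / (w - p) - d = (f w - f p - d * (w - p)) / (w - p) by field.
  rewrite cabsM cabsV => H; apply: (@le_lt_trans _ _ (e / 2)); last lra.
  by rewrite ler_pdivrMr ?cabs_gt0.
apply: (ccont_eq (r := cabs (z - p))) (divdiff_near f d zp) _; first by rewrite cabs_gt0 subr_eq0.
apply: ccontM; first exact: ccont_sub_cst.
by apply: ccontV; [exact/ccont_sub_cst/ccont_id|rewrite subr_eq0].
Qed.

Lemma divdiff_cderiv f p d z : z != p -> (exists d', cderiv f z d') ->
  exists d', cderiv (divdiff f p d) z d'.
Proof.
move=> zp [d' fd]; have zp0 : z - p != 0 by rewrite subr_eq0.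
eexists; apply: (cderiv_eq (r := cabs (z - p))) (divdiff_near f d zp) _; first by rewrite cabs_gt0.
apply: cderivM; first by apply: cderiv_sub_cst; exact: fd.
by apply: cderivV => //; apply: cderiv_sub_cst; exact: cderiv_id.
Qed.

Lemma punctured_avoid (E : seq C) (p : C) : exists2 r : R, 0 < r &
  forall w, w != p -> cabs (w - p) < r -> w \notin E.
Proof.
elim: E => [|s E [r r0 Hr]]; first by exists 1.
have [->|sp] := eqVneq s p.
  by exists r => // w wp wr; rewrite in_cons negb_or wp Hr.
exists (Num.min r (cabs (s - p))); first by rewrite lt_min r0 cabs_gt0 subr_eq0.
move=> w wp; rewrite lt_min => /andP[wr ws]; rewrite in_cons negb_or Hr // andbT.
by apply/eqP => wE; move: ws; rewrite wE ltxx.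
Qed.

Lemma ex_near_neq (p : C) (r : R) : 0 < r -> exists2 w, w != p & cabs (w - p) < r.
Proof.
move=> r0; exists (p + (r / 2)%:C%C).
  rewrite -subr_eq0 addrC addKr -cabs_eq0 cabs_real normr_eq0 gt_eqF //; lra.
rewrite addrC addKr cabs_real gtr0_norm; lra.
Qed.

End Modulus.
#[global] Hint Extern 0 (is_true (0 <= cabs _)) => (exact: cabs_ge0) : core.

(** * Primitives of functions of a real variable *)

Section Bisection.
Context {R : realType}.
Implicit Types a b c l x y : R.

(** Compactness as a bisection argument: a failure of [P] propagates to nested quarters, whose
    common point contradicts the local hypothesis. It serves Goursat's lemma as well as bounds on
    compact sets. *)
Lemma bisection2 (P : R -> R -> R -> Prop) a0 c0 l0 : 0 < l0 ->
  (forall a c l, 0 < l -> P a c (l / 2) -> P (a + l / 2) c (l / 2) ->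
    P a (c + l / 2) (l / 2) -> P (a + l / 2) (c + l / 2) (l / 2) -> P a c l) ->
  (forall x y, a0 <= x <= a0 + l0 -> c0 <= y <= c0 + l0 ->
    exists2 d, 0 < d & forall a c l, 0 < l -> l < d ->
      a <= x <= a + l -> c <= y <= c + l ->
      a0 <= a -> a + l <= a0 + l0 -> c0 <= c -> c + l <= c0 + l0 -> P a c l) ->
  P a0 c0 l0.
Proof.
move=> l00 Pdiv Ploc; apply: contrapT => nP.
(* Putting the hypotheses on [t] under the existential makes the choice of a bad quarter a total
   function, which can be iterated. *)
have stepP (t : R * R * R) : exists t' : R * R * R,
    0 < t.2 -> ~ P t.1.1 t.1.2 t.2 ->
    [/\ ~ P t'.1.1 t'.1.2 t'.2, t'.2 = t.2 / 2,
      t.1.1 <= t'.1.1, t'.1.1 + t'.2 <= t.1.1 + t.2 &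
      t.1.2 <= t'.1.2 /\ t'.1.2 + t'.2 <= t.1.2 + t.2].
  case: t => -[a c] l /=.
  have [nQ|Q1] := pselect (~ P a c (l / 2)).
    by exists (a, c, l / 2) => l0' _; split=> //=; [lra|split; lra].
  have [nQ|Q2] := pselect (~ P (a + l / 2) c (l / 2)).
    by exists (a + l / 2, c, l / 2) => l0' _; split=> //=; [lra|lra|split; lra].
  have [nQ|Q3] := pselect (~ P a (c + l / 2) (l / 2)).
    by exists (a, c + l / 2, l / 2) => l0' _; split=> //=; [lra|split; lra].
  exists (a + l / 2, c + l / 2, l / 2) => l0' nPt; split=> //=; [|lra|lra|split; lra].
  by move=> Q4; apply: nPt; apply: Pdiv => //; apply: contrapT.
pose step t := projT1 (cid (stepP t)).
pose u n := iter n step (a0, c0, l0).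
have uS n : u n.+1 = step (u n) by [].
have u0 n : 0 < (u n).2 /\ ~ P (u n).1.1 (u n).1.2 (u n).2.
  elim: n => [//|n [IH1 IH2]]; rewrite uS /step; case: cid => t' /= /(_ IH1 IH2).
  by case=> H E _ _ _; split=> //; rewrite E divr_gt0.
have us n : [/\ (u n.+1).2 = (u n).2 / 2, (u n).1.1 <= (u n.+1).1.1,
    (u n.+1).1.1 + (u n.+1).2 <= (u n).1.1 + (u n).2 &
    (u n).1.2 <= (u n.+1).1.2 /\ (u n.+1).1.2 + (u n.+1).2 <= (u n).1.2 + (u n).2].
  have [IH1 IH2] := u0 n.
  by rewrite uS /step; case: cid => t' /= /(_ IH1 IH2) [_ ? ? ? ?]; split.
have un n : (u n).2 = l0 / 2 ^+ n.
  elim: n => [|n IH]; first by rewrite expr0 divr1.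
  by have [-> _ _ _] := us n; rewrite IH exprS; field; rewrite expf_neq0.
have mono n k : [/\ (u n).1.1 <= (u (n + k)%N).1.1,
    (u (n + k)%N).1.1 + (u (n + k)%N).2 <= (u n).1.1 + (u n).2,
    (u n).1.2 <= (u (n + k)%N).1.2 &
    (u (n + k)%N).1.2 + (u (n + k)%N).2 <= (u n).1.2 + (u n).2].
  elim: k => [|k [h1 h2 h3 h4]]; first by rewrite addn0.
  rewrite addnS; have [_ ? ? [? ?]] := us (n + k)%N.
  by split; [apply: le_trans h1 _|apply: le_trans h2|apply: le_trans h3 _|apply: le_trans h4].
have cross n m : (u m).1.1 <= (u n).1.1 + (u n).2 /\ (u m).1.2 <= (u n).1.2 + (u n).2.
  have [mn|/ltnW nm] := leqP m n.
    have := mono m (n - m)%N; rewrite subnKC // => -[h1 _ h3 _].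
    have [p _] := u0 n; lra.
  have := mono n (m - n)%N; rewrite subnKC // => -[_ h2 _ h4].
  have [p _] := u0 m; lra.
have hs (f : nat -> R) (g : nat -> R) : (forall n m, f m <= g n) ->
    exists x, forall n, f n <= x <= g n.
  move=> fg; exists (sup (range f)) => n; apply/andP; split.
    by apply: ub_le_sup; [exists (g 0%N) => _ [m _ <-]|exists n].
  by apply: ge_sup; [exists (f 0%N), 0%N|move=> _ [m _ <-]].
have [x Hx] := hs (fun n => (u n).1.1) (fun n => (u n).1.1 + (u n).2) (fun n m => (cross n m).1).
have [y Hy] := hs (fun n => (u n).1.2) (fun n => (u n).1.2 + (u n).2) (fun n m => (cross n m).2).
have [d d0 Hd] := Ploc x y (Hx 0%N) (Hy 0%N).
have ld : 0 <= l0 / d by rewrite divr_ge0 ?ltW.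
(* Since [l0 / d < n <= 2 ^ n], the side [l0 / 2 ^ n] is less than [d]. *)
pose n := Num.bound (l0 / d).
have [p nPn] := u0 n; apply: nPn.
have [h1 h2 h3 h4] := mono 0%N n; rewrite add0n in h1 h2 h3 h4.
apply: Hd => //; rewrite un ltr_pdivrMr ?exprn_gt0 // -ltr_pdivrMl // mulrC.
apply: lt_le_trans (archi_boundP ld) _.
by rewrite -natrX ler_nat ltnW // ltn_expl.
Qed.

Lemma bisection1 (P : R -> R -> Prop) a0 b0 : a0 < b0 ->
  (forall a b, a < b -> P a ((a + b) / 2) -> P ((a + b) / 2) b -> P a b) ->
  (forall x, a0 <= x <= b0 -> exists2 d, 0 < d & forall a b, a < b -> b - a < d ->
    a <= x <= b -> a0 <= a -> b <= b0 -> P a b) -> P a0 b0.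
Proof.
move=> ab Pdiv Ploc.
have -> : b0 = a0 + (b0 - a0) by ring.
pose Q a (_ : R) l := P a (a + l).
apply: (@bisection2 Q a0 0); rewrite /Q ?subr_gt0 //.
  move=> a _ l l0 H1 H2 _ _.
  have E : (a + (a + l)) / 2 = a + l / 2 by field.
  have E' : a + l / 2 + l / 2 = a + l by field.
  by apply: Pdiv; rewrite ?E -?E' //; lra.
move=> x y xab _; have [|d d0 Hd] := Ploc x; first by move: xab; rewrite subrKC.
exists d => // a c l l0 ld axl _ h1 h2 _ _; apply: Hd => //; lra.
Qed.

End Bisection.

(** * Complex-valued functions of a real variable: mean value inequalities, primitives, integrals *)

Section RealVariable.
Context {R : realType}.
Local Notation C := R[i].

Definition rcont (g : R -> C) (t : R) :=
  forall e : R, 0 < e -> exists2 d : R, 0 < d &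
    forall s, `|s - t| < d -> cabs (g s - g t) < e.

Definition rderiv (G : R -> C) (t : R) (d : C) :=
  forall e : R, 0 < e -> exists2 r : R, 0 < r &
    forall s, `|s - t| < r ->
      cabs (G s - G t - d * (s - t)%:C%C) <= e * `|s - t|.

(** The mean value theorem fails for complex values, but the inequality with [B] increased by [k] is
    additive under bisection and holds near each point by differentiability. *)
Lemma mean_value_bound (G g : R -> C) a b (B : R) : a <= b ->
  (forall t, a <= t <= b -> rderiv G t (g t)) ->
  (forall t, a <= t <= b -> cabs (g t) <= B) ->
  cabs (G b - G a) <= B * (b - a).
Proof.
rewrite le_eqVlt => /predU1P[-> _ _|ab Gg gB]; first by rewrite !subrr cabs0 mulr0.
apply/ler_addgt0Pl => e e0; pose k := e / (b - a).
have k0 : 0 < k by rewrite divr_gt0 // subr_gt0.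
suff : cabs (G b - G a) <= (B + k) * (b - a).
  by rewrite mulrDl /k divfK ?subr_eq0 ?gt_eqF //; lra.
pose P x y := cabs (G y - G x) <= (B + k) * (y - x).
apply: (@bisection1 R P a b ab).
  move=> x y xy; rewrite /P => H1 H2.
  have := cabsBd (G y) (G ((x + y) / 2)) (G x); lra.
move=> t tab; have [d d0 Hd] := Gg _ tab _ k0.
exists d => // x y xy xyd /andP[xt ty] _ _; rewrite /P.
have one s : `|s - t| < d -> cabs (G s - G t) <= (B + k) * `|s - t|.
  move=> /Hd H; have -> : G s - G t = (G s - G t - g t * (s - t)%:C%C) + g t * (s - t)%:C%C.
    by rewrite subrK.
  apply: le_trans (cabsD _ _) _; rewrite cabsM cabs_real mulrDl addrC lerD //.
  by rewrite ler_wpM2r ?gB.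
have := cabsBd (G y) (G t) (G x); have := one y; have := one x.
rewrite (cabs_dist (G t)) (@ger0_norm _ (y - t)) ?subr_ge0 // (@ler0_norm _ (x - t)) ?subr_le0 //.
move=> H1 H2 H3; have {}H1 := H1 ltac:(lra); have {}H2 := H2 ltac:(lra); lra.
Qed.

(** This lower bound is what shows that the integral of the Cauchy kernel does not vanish. *)
Lemma Im_mean_value_lb (G g : R -> C) a b (m : R) : a < b ->
  (forall t, a <= t <= b -> rderiv G t (g t)) ->
  (forall t, a <= t <= b -> m <= complex.Im (g t)) ->
  m * (b - a) <= complex.Im (G b - G a).
Proof.
move=> ab Gg gB.
apply/ler_addgt0Pl => e e0; pose k := e / (b - a).
have k0 : 0 < k by rewrite divr_gt0 // subr_gt0.
suff : (m - k) * (b - a) <= complex.Im (G b - G a).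
  by rewrite mulrBl /k divfK ?subr_eq0 ?gt_eqF //; lra.
have ImB (z w : C) : complex.Im (z - w) = complex.Im z - complex.Im w.
  by case: z => ? ?; case: w => ? ?.
pose P x y := (m - k) * (y - x) <= complex.Im (G y - G x).
apply: (@bisection1 R P a b ab).
  by move=> x y xy; rewrite /P !ImB => H1 H2; lra.
move=> t tab; have [d d0 Hd] := Gg _ tab _ k0; have gm := gB _ tab.
exists d => // x y xy xyd /andP[xt ty] _ _; rewrite /P.
have ImMr (z : C) (s : R) : complex.Im (z * s%:C%C) = complex.Im z * s.
  by case: z => p q /=; rewrite mulr0 add0r.
have := Hd y; have := Hd x.
rewrite (@ger0_norm _ (y - t)) ?subr_ge0 // (@ler0_norm _ (x - t)) ?subr_le0 //.
move=> H1 H2; have {}H1 := H1 ltac:(lra); have {}H2 := H2 ltac:(lra).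
have := le_trans (Im_le_cabs _) H1; have := le_trans (Im_le_cabs _) H2.
rewrite !ImB !ImMr !ler_norml => /andP[h1 h2] /andP[h3 h4].
have : m * (y - t) <= complex.Im (g t) * (y - t) by rewrite ler_wpM2r ?subr_ge0.
have : m * (t - x) <= complex.Im (g t) * (t - x) by rewrite ler_wpM2r ?subr_ge0.
lra.
Qed.

Lemma rderivD (F G : R -> C) t d d' : rderiv F t d -> rderiv G t d' ->
  rderiv (fun s => F s + G s) t (d + d').
Proof.
move=> cf cg e e0.
have e20 : 0 < e / 2 by rewrite divr_gt0.
have [r r0 Hr] := cf _ e20; have [s s0 Hs] := cg _ e20.
exists (Num.min r s); first by rewrite lt_min r0.
move=> w; rewrite lt_min => /andP[/Hr wr /Hs ws].
have -> : F w + G w - (F t + G t) - (d + d') * (w - t)%:C%C =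
  (F w - F t - d * (w - t)%:C%C) + (G w - G t - d' * (w - t)%:C%C) by ring.
apply: le_trans (cabsD _ _) _; lra.
Qed.

Lemma rderivZ (F : R -> C) t d k : rderiv F t d ->
  rderiv (fun s => k * F s) t (k * d).
Proof.
move=> cf e e0; have k0 : 0 < cabs k + 1 by rewrite ltr_wpDl.
have [r r0 Hr] := cf _ (divr_gt0 e0 k0); exists r => // w /Hr H.
have -> : k * F w - k * F t - k * d * (w - t)%:C%C = k * (F w - F t - d * (w - t)%:C%C) by ring.
rewrite cabsM; have : cabs k * cabs (F w - F t - d * (w - t)%:C%C) <=
  (cabs k + 1) * (e / (cabs k + 1) * `|w - t|) by rewrite ler_pM // lerDl.
by rewrite mulrA [_ * (e / _)]mulrC divfK // gt_eqF.
Qed.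

Lemma FTC1_real (h : R -> R) (a b : R) : continuous h ->
  exists H : R -> R, forall t, a <= t <= b -> is_derive t (1 : R) H (h t).
Proof.
(* Integrating from [a - 1] inside an interval ending at [b + 1] keeps every point of [[a, b]] in
   the interior, so the derivative is two-sided. *)
move=> ch; exists (fun y => \int[lebesgue_measure]_(t in [set` `[a - 1, y]]) h t)%R.
move=> t /andP[at1 tb].
have [] := @continuous_FTC1_closed R h (a - 1) t (b + 1).
- lra.
- apply: continuous_compact_integrable; first exact: segment_compact.
  by apply: continuous_subspaceT.
- lra.
- exact: ch.
by move=> D E; split; [exact: D|rewrite -derive1E; exact: E].
Qed.

(** Projection onto [[a, b]]: composing with it turns a function continuous at the points of
    [[a, b]] into one continuous everywhere, as [FTC1_real] requires. *)
Definition clamp (a b s : R) := Num.max a (Num.min b s).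

Lemma clamp_id a b s : a <= s <= b -> clamp a b s = s.
Proof. by move=> /andP[h1 h2]; rewrite /clamp (min_idPr h2) (max_idPr h1). Qed.

Lemma clamp_in a b s : a <= b -> a <= clamp a b s <= b.
Proof. by move=> ab; rewrite /clamp le_max lexx ge_max ab ge_min lexx. Qed.

Lemma clamp_lip a b s t : `|clamp a b s - clamp a b t| <= `|s - t|.
Proof.
have Hmin u v : u <= v -> 0 <= Num.min b v - Num.min b u <= v - u.
  by move=> uv; case: (leP b u) => bu; case: (leP b v) => bv; lra.
have Hmax u v : u <= v -> 0 <= Num.max a v - Num.max a u <= v - u.
  by move=> uv; case: (leP a u) => au; case: (leP a v) => av; lra.
have mono u v : u <= v -> 0 <= clamp a b v - clamp a b u <= v - u.
  move=> uv; have /andP[h1 h2] := Hmin _ _ uv.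
  have m12 : Num.min b u <= Num.min b v by lra.
  by have := Hmax _ _ m12; rewrite /clamp; lra.
have [/mono H|/ltW/mono H] := lerP s t.
  by rewrite distrC ger0_norm; lra.
by rewrite ger0_norm; lra.
Qed.

Lemma is_derive_eps (H : R -> R) (t d : R) : is_derive t (1 : R) H d ->
  forall e : R, 0 < e -> exists2 r : R, 0 < r & forall s, `|s - t| < r ->
  `|H s - H t - d * (s - t)| <= e * `|s - t|.
Proof.
move=> [dH dE] e e0.
have : h^-1 *: (H (h *: (1 : R) + t) - H t) @[h --> 0^'] --> d by rewrite -dE; exact: dH.
move=> /cvgrPdist_le /(_ e e0) [r /= r0 Hr]; exists r => // s sr.
have [->|st] := eqVneq s t; first by rewrite !subrr mulr0 subrr normr0 mulr0.
have st0 : s - t != 0 by rewrite subr_eq0.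
have := Hr (s - t); rewrite /= sub0r normrN => /(_ sr st0).
rewrite /GRing.scale /= mulr1 subrK => K.
have -> : H s - H t - d * (s - t) = - ((d - (s - t)^-1 * (H s - H t)) * (s - t)).
  by field.
by rewrite normrN normrM ler_wpM2r.
Qed.

Lemma primitive_exists (g : R -> C) a b : a <= b ->
  (forall t, a <= t <= b -> rcont g t) ->
  exists G, forall t, a <= t <= b -> rderiv G t (g t).
Proof.
move=> ab cg; pose gc t := g (clamp a b t).
have cgc t : rcont gc t.
  move=> e e0; have [d d0 Hd] := cg _ (clamp_in t ab) e e0.
  by exists d => // s sd; apply: Hd; exact: le_lt_trans (clamp_lip _ _ _ _) sd.
have ReB (z w : C) : complex.Re (z - w) = complex.Re z - complex.Re w.
  by case: z => ? ?; case: w => ? ?.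
have ImB (z w : C) : complex.Im (z - w) = complex.Im z - complex.Im w.
  by case: z => ? ?; case: w => ? ?.
have cRe : continuous (fun t => complex.Re (gc t)).
  move=> t; apply/cvgrPdist_lt => e e0; have [d d0 Hd] := cgc t e e0.
  exists d => //= s sd; rewrite distrC -ReB.
  by apply: le_lt_trans (Re_le_cabs _) (Hd _ _); rewrite distrC.
have cIm : continuous (fun t => complex.Im (gc t)).
  move=> t; apply/cvgrPdist_lt => e e0; have [d d0 Hd] := cgc t e e0.
  exists d => //= s sd; rewrite distrC -ImB.
  by apply: le_lt_trans (Im_le_cabs _) (Hd _ _); rewrite distrC.
have [A HA] := FTC1_real a b cRe; have [B HB] := FTC1_real a b cIm.
exists (fun t => (A t +i* B t)%C) => t tab e e0.
have e20 : 0 < e / 2 by rewrite divr_gt0.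
have [r r0 Hr] := is_derive_eps (HA _ tab) e20.
have [s s0 Hs] := is_derive_eps (HB _ tab) e20.
exists (Num.min r s); first by rewrite lt_min r0.
move=> w; rewrite lt_min => /andP[/Hr wr /Hs ws].
apply: le_trans (cabs_le_ReIm _) _; move: wr ws.
rewrite /gc clamp_id //; case: (g t) => p q /=.
rewrite !mulr0 subr0 add0r; lra.
Qed.

(* The value does not depend on the primitive, and is junk if there is none. *)
Definition cint (a b : R) (g : R -> C) : C :=
  xget 0 [set v | exists2 G : R -> C,
    (forall t, a <= t <= b -> rderiv G t (g t)) & v = G b - G a].

(** The difference of two primitives has derivative [0], so [mean_value_bound] with bound [0] makes
    it constant. *)
Lemma cintE a b (g G : R -> C) : a <= b ->
  (forall t, a <= t <= b -> rderiv G t (g t)) -> cint a b g = G b - G a.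
Proof.
move=> ab Gg; rewrite /cint; case: xgetP => [v _ [H Hg ->]|/(_ (G b - G a)) []]; last by exists G.
have : cabs ((H b + -1 * G b) - (H a + -1 * G a)) <= 0 * (b - a).
  apply: (@mean_value_bound (fun t => H t + -1 * G t) (fun=> 0)) => //.
    move=> t tab; have -> : 0 = g t + -1 * g t :> C by ring.
    by apply: rderivD; [exact: Hg|apply: rderivZ; exact: Gg].
  by move=> t _; rewrite cabs0.
rewrite mul0r => h; have /eqP : cabs ((H b + -1 * G b) - (H a + -1 * G a)) == 0.
  by rewrite eq_le h cabs_ge0.
move=> /eqP; rewrite cabs_eq0 => /eqP E; apply/eqP; rewrite -subr_eq0 -E.
by apply/eqP; ring.
Qed.

Lemma cint_bound a b (g : R -> C) B : a <= b ->
  (forall t, a <= t <= b -> rcont g t) ->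
  (forall t, a <= t <= b -> cabs (g t) <= B) ->
  cabs (cint a b g) <= B * (b - a).
Proof.
move=> ab cg gB; have [G HG] := primitive_exists ab cg.
by rewrite (cintE ab HG); exact: mean_value_bound HG gB.
Qed.

Lemma Im_cint_gt0 a b (g : R -> C) m : a < b -> 0 < m ->
  (forall t, a <= t <= b -> rcont g t) ->
  (forall t, a <= t <= b -> m <= complex.Im (g t)) ->
  0 < complex.Im (cint a b g).
Proof.
move=> ab m0 cg gB; have [G HG] := primitive_exists (ltW ab) cg.
rewrite (cintE (ltW ab) HG); apply: lt_le_trans (Im_mean_value_lb ab HG gB).
by rewrite mulr_gt0 // subr_gt0.
Qed.

Lemma cint_chasles a b c (g : R -> C) : a <= b <= c ->
  (forall t, a <= t <= c -> rcont g t) ->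
  cint a c g = cint a b g + cint b c g.
Proof.
move=> /andP[ab bc] cg; have ac := le_trans ab bc.
have [G HG] := primitive_exists ac cg.
rewrite (cintE ac HG) (@cintE a b _ G) ?(@cintE b c _ G) //; first by ring.
  by move=> t /andP[h1 h2]; apply: HG; rewrite h2 (le_trans ab).
by move=> t /andP[h1 h2]; apply: HG; rewrite h1 (le_trans h2).
Qed.

Lemma cintZD a b (f g : R -> C) k : a <= b ->
  (forall t, a <= t <= b -> rcont f t) -> (forall t, a <= t <= b -> rcont g t) ->
  cint a b (fun t => f t + k * g t) = cint a b f + k * cint a b g.
Proof.
move=> ab cf cg; have [F HF] := primitive_exists ab cf.
have [G HG] := primitive_exists ab cg.
rewrite (cintE ab HF) (cintE ab HG) (@cintE _ _ _ (fun t => F t + k * G t)) //.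
  by ring.
by move=> t tab; apply: rderivD; [exact: HF|apply: rderivZ; exact: HG].
Qed.

Lemma rcontZ (g : R -> C) t k : rcont g t -> rcont (fun s => k * g s) t.
Proof.
move=> cg e e0; have k0 : 0 < cabs k + 1 by rewrite ltr_wpDl.
have [d d0 Hd] := cg _ (divr_gt0 e0 k0); exists d => // s /Hd H.
rewrite -mulrBr cabsM; rewrite ltr_pdivlMr // mulrC in H.
by apply: le_lt_trans H; rewrite ler_wpM2r // lerDl.
Qed.

Lemma cintZ a b (g : R -> C) k : a <= b -> (forall t, a <= t <= b -> rcont g t) ->
  cint a b (fun t => k * g t) = k * cint a b g.
Proof.
move=> ab cg; have [G HG] := primitive_exists ab cg.
rewrite (cintE ab HG) (@cintE _ _ _ (fun t => k * G t)) // -?mulrBr //.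
by move=> t tab; apply: rderivZ; exact: HG.
Qed.

Lemma eq_cint a b (f g : R -> C) : a <= b -> (forall t, a <= t <= b -> f t = g t) ->
  cint a b f = cint a b g.
Proof.
move=> ab fg; rewrite /cint; congr (xget 0 _); apply/seteqP; split=> v [G HG ->];
  exists G => // t tab; [rewrite -fg|rewrite fg] => //; exact: HG.
Qed.

End RealVariable.

(** * Integrals along squares *)

Section Contour.
Context {R : realType}.
Local Notation C := R[i].
Implicit Types (f g : C -> C) (a c l : R).

Definition in_square a c l (z : C) :=
  [&& a <= complex.Re z, complex.Re z <= a + l, c <= complex.Im z & complex.Im z <= c + l].

Definition on_border a c l (z : C) := in_square a c l z &&
  [|| complex.Re z == a, complex.Re z == a + l, complex.Im z == c | complex.Im z == c + l].

Definition contour f a c l : C :=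
  cint a (a + l) (fun x => f (x +i* c)%C) + 'i%C * cint c (c + l) (fun y => f ((a + l) +i* y)%C)
  - cint a (a + l) (fun x => f (x +i* (c + l))%C) - 'i%C * cint c (c + l) (fun y => f (a +i* y)%C).

Lemma complex_split (x y : R) : (x +i* y)%C = x%:C%C + 'i%C * y%:C%C.
Proof. by apply/eqP; rewrite eq_complex /= !(mul0r, mulr0, mul1r, subr0, addr0, add0r) !eqxx. Qed.

Lemma ccont_horizontal f (x y : R) : ccont f (x +i* y)%C -> rcont (fun t => f (t +i* y)%C) x.
Proof.
move=> cf e e0; have [d d0 Hd] := cf e e0; exists d => // s sd; apply: Hd.
have -> : (s +i* y)%C - (x +i* y)%C = (s - x)%:C%C by apply/eqP; rewrite eq_complex /= subrr !eqxx.
by rewrite cabs_real.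
Qed.

Lemma ccont_vertical f (x y : R) : ccont f (x +i* y)%C -> rcont (fun t => f (x +i* t)%C) y.
Proof.
move=> cf e e0; have [d d0 Hd] := cf e e0; exists d => // s sd; apply: Hd.
have -> : (x +i* s)%C - (x +i* y)%C = 'i%C * (s - y)%:C%C.
  by rewrite (complex_split x s) (complex_split x y) rmorphB; ring.
by rewrite cabsM cabsi mul1r cabs_real.
Qed.

Lemma border_edges a c l (P : C -> Prop) : 0 < l -> (forall z, on_border a c l z -> P z) ->
  [/\ forall t, a <= t <= a + l -> P (t +i* c)%C,
   forall t, c <= t <= c + l -> P ((a + l) +i* t)%C,
   forall t, a <= t <= a + l -> P (t +i* (c + l))%C &
   forall t, c <= t <= c + l -> P (a +i* t)%C].
Proof.
move=> l0 H; split=> t /andP[t1 t2]; apply: H; rewrite /on_border /in_square /= t1 t2 ?lexx ?eqxx ?orbT //=;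
  rewrite ?andbT ?lerDl ?ltW //.
Qed.

Lemma contour_bound f a c l B : 0 < l ->
  (forall z, on_border a c l z -> ccont f z) ->
  (forall z, on_border a c l z -> cabs (f z) <= B) ->
  cabs (contour f a c l) <= 4 * B * l.
Proof.
move=> l0 /(border_edges l0)[c1 c2 c3 c4] /(border_edges l0)[b1 b2 b3 b4].
have al : a <= a + l by rewrite lerDl ltW.
have cl : c <= c + l by rewrite lerDl ltW.
have {b1} := cint_bound al (fun t h => ccont_horizontal (c1 t h)) b1.
have {b3} := cint_bound al (fun t h => ccont_horizontal (c3 t h)) b3.
have {b2} := cint_bound cl (fun t h => ccont_vertical (c2 t h)) b2.
have {b4} := cint_bound cl (fun t h => ccont_vertical (c4 t h)) b4.
rewrite /contour !(addrC _ l) !addrK.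
set u1 := cint _ _ _; set u2 := cint _ _ _; set u3 := cint _ _ _; set u4 := cint _ _ _.
move=> h1 h2 h3 h4.
have := cabsB (u4 + 'i%C * u2 - u3) ('i%C * u1); have := cabsB (u4 + 'i%C * u2) u3.
have := cabsD u4 ('i%C * u2); rewrite !cabsM cabsi !mul1r; lra.
Qed.

Lemma contourDZ f g k a c l : 0 < l ->
  (forall z, on_border a c l z -> ccont f z) ->
  (forall z, on_border a c l z -> ccont g z) ->
  contour (fun z => f z + k * g z) a c l = contour f a c l + k * contour g a c l.
Proof.
move=> l0 /(border_edges l0)[f1 f2 f3 f4] /(border_edges l0)[g1 g2 g3 g4].
have al : a <= a + l by rewrite lerDl ltW.
have cl : c <= c + l by rewrite lerDl ltW.
rewrite /contour.
rewrite (cintZD k al (fun t h => ccont_horizontal (f1 t h)) (fun t h => ccont_horizontal (g1 t h))).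
rewrite (cintZD k al (fun t h => ccont_horizontal (f3 t h)) (fun t h => ccont_horizontal (g3 t h))).
rewrite (cintZD k cl (fun t h => ccont_vertical (f2 t h)) (fun t h => ccont_vertical (g2 t h))).
rewrite (cintZD k cl (fun t h => ccont_vertical (f4 t h)) (fun t h => ccont_vertical (g4 t h))).
ring.
Qed.

Lemma eq_contour f g a c l : 0 < l -> (forall z, on_border a c l z -> f z = g z) ->
  contour f a c l = contour g a c l.
Proof.
move=> l0 /(border_edges l0)[f1 f2 f3 f4].
have al : a <= a + l by rewrite lerDl ltW.
have cl : c <= c + l by rewrite lerDl ltW.
by rewrite /contour (eq_cint al f1) (eq_cint al f3) (eq_cint cl f2) (eq_cint cl f4).
Qed.

Lemma in_squareE a c l (x y : R) : in_square a c l (x +i* y)%C =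
  (a <= x <= a + l) && (c <= y <= c + l).
Proof. by rewrite /in_square /= !andbA. Qed.

(** Each outer side splits in two, and the inner sides are traversed twice in opposite
    directions. *)
Lemma contour_quarters f a c l : 0 < l -> (forall z, in_square a c l z -> ccont f z) ->
  contour f a c l = contour f a c (l / 2) + contour f (a + l / 2) c (l / 2)
   + contour f a (c + l / 2) (l / 2) + contour f (a + l / 2) (c + l / 2) (l / 2).
Proof.
move=> l0 cf.
have E b : b + l / 2 + l / 2 = b + l :> R by field.
have hl : 0 < l / 2 by rewrite divr_gt0.
have ch x1 x2 x3 y : a <= x1 -> x1 <= x2 <= x3 -> x3 <= a + l -> c <= y <= c + l ->
    cint x1 x3 (fun x => f (x +i* y)%C) =
    cint x1 x2 (fun x => f (x +i* y)%C) + cint x2 x3 (fun x => f (x +i* y)%C).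
  move=> h1 h2 h3 h4; apply: cint_chasles => // t ht; apply: ccont_horizontal.
  by apply: cf; rewrite in_squareE h4 andbT; lra.
have cv y1 y2 y3 x : c <= y1 -> y1 <= y2 <= y3 -> y3 <= c + l -> a <= x <= a + l ->
    cint y1 y3 (fun y => f (x +i* y)%C) =
    cint y1 y2 (fun y => f (x +i* y)%C) + cint y2 y3 (fun y => f (x +i* y)%C).
  move=> h1 h2 h3 h4; apply: cint_chasles => // t ht; apply: ccont_vertical.
  by apply: cf; rewrite in_squareE h4 /=; lra.
rewrite /contour !E.
rewrite (ch a (a + l / 2) (a + l) c ltac:(lra) ltac:(lra) ltac:(lra) ltac:(lra)).
rewrite (ch a (a + l / 2) (a + l) (c + l) ltac:(lra) ltac:(lra) ltac:(lra) ltac:(lra)).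
rewrite (cv c (c + l / 2) (c + l) a ltac:(lra) ltac:(lra) ltac:(lra) ltac:(lra)).
rewrite (cv c (c + l / 2) (c + l) (a + l) ltac:(lra) ltac:(lra) ltac:(lra) ltac:(lra)).
ring.
Qed.

Lemma rderiv_quadratic (A B : C) (t : R) :
  rderiv (fun s => A * s%:C%C + B * s%:C%C ^+ 2) t (A + 2 * B * t%:C%C).
Proof.
move=> e e0; have B0 : 0 < cabs B + 1 by rewrite ltr_wpDl.
exists (e / (cabs B + 1)); first by rewrite divr_gt0.
move=> s; rewrite ltr_pdivlMr // => st.
have -> : A * s%:C%C + B * s%:C%C ^+ 2 - (A * t%:C%C + B * t%:C%C ^+ 2) -
  (A + 2 * B * t%:C%C) * (s - t)%:C%C = B * (s - t)%:C%C * (s - t)%:C%C.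
  by rewrite rmorphB; ring.
rewrite !cabsM !cabs_real; apply: ler_wpM2r => //; apply: le_trans (ltW st).
by rewrite mulrC ler_wpM2l // lerDl.
Qed.

Lemma contour_affine (al be : C) a c l : 0 < l -> contour (fun z => al + be * z) a c l = 0.
Proof.
move=> l0.
have al0 : a <= a + l by rewrite lerDl ltW.
have cl0 : c <= c + l by rewrite lerDl ltW.
have h (y : R) : cint a (a + l) (fun x => al + be * (x +i* y)%C) =
   (al + be * 'i%C * y%:C%C) * l%:C%C + be / 2 * ((a + l)%:C%C ^+ 2 - a%:C%C ^+ 2).
  rewrite (@cintE _ _ _ _ (fun s => (al + be * 'i%C * y%:C%C) * s%:C%C + be / 2 * s%:C%C ^+ 2)) //.
    by rewrite rmorphD; ring.
  move=> t _; have -> : al + be * (t +i* y)%C = (al + be * 'i%C * y%:C%C) + 2 * (be / 2) * t%:C%C.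
    by rewrite (complex_split t y); field.
  exact: rderiv_quadratic.
have v (x : R) : cint c (c + l) (fun y => al + be * (x +i* y)%C) =
   (al + be * x%:C%C) * l%:C%C + be * 'i%C / 2 * ((c + l)%:C%C ^+ 2 - c%:C%C ^+ 2).
  rewrite (@cintE _ _ _ _ (fun s => (al + be * x%:C%C) * s%:C%C + be * 'i%C / 2 * s%:C%C ^+ 2)) //.
    by rewrite rmorphD; ring.
  move=> t _; have -> : al + be * (x +i* t)%C = (al + be * x%:C%C) + 2 * (be * 'i%C / 2) * t%:C%C.
    by rewrite (complex_split x t); field.
  exact: rderiv_quadratic.
by rewrite /contour !h !v !rmorphD; ring.
Qed.

(** Along the border, traversed counterclockwise, the argument of [z - p] increases, so each of the
    four sides contributes a positive imaginary part. Nonvanishing is all that [maximum_principle]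
    asks of the kernel. *)
Lemma contour_kernel a c l (p : C) : a < complex.Re p < a + l -> c < complex.Im p < c + l ->
  contour (fun z => (z - p)^-1) a c l != 0.
Proof.
case: p => p q /= /andP[ap pa] /andP[cq qc].
have l0 : 0 < l by lra.
pose P z := ccont (fun z => (z - (p +i* q)%C)^-1) z.
have B z : on_border a c l z -> z - (p +i* q)%C != 0.
  case: z => x y; rewrite /on_border subr_eq0 eq_complex /= => /andP[_ xy].
  by apply/negP => /andP[/eqP xp /eqP yq]; move: xy; rewrite xp yq => /or4P[]/eqP; lra.
have bc z : on_border a c l z -> P z.
  move=> /B z0; apply: ccontV => //.
  by apply: ccontD; [exact: ccont_id|exact: ccont_cst].
have [c1 c2 c3 c4] := border_edges l0 bc.
(* [D] bounds the squared distance from [p] to points of the square, so on each side the integrand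
   has imaginary part at least the distance from [p] to that side divided by [D], up to
   orientation. *)
pose D := (2 * l ^+ 2).
have D0 : 0 < D by rewrite mulr_gt0 // exprn_gt0.
have al0 : a < a + l by rewrite ltrDl.
have cl0 : c < c + l by rewrite ltrDl.
have ImV (x y : R) : ((x +i* y)%C - (p +i* q)%C)^-1 =
   ((x - p) / ((x - p) ^+ 2 + (y - q) ^+ 2) +i* ((q - y) / ((x - p) ^+ 2 + (y - q) ^+ 2)))%C.
  by apply/eqP; rewrite eq_complex /= -mulNr opprB !eqxx.
have Dle (x y : R) : a <= x <= a + l -> c <= y <= c + l ->
   (x - p) ^+ 2 + (y - q) ^+ 2 <= D.
  move=> xa yc; rewrite /D.
  have sq u : - l <= u <= l -> u ^+ 2 <= l ^+ 2.
    by move=> ul; rewrite -subr_ge0 subr_sqr mulr_ge0; lra.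
  have := sq (x - p); have := sq (y - q); lra.
have lbd (x y u m : R) : a <= x <= a + l -> c <= y <= c + l -> (x != p) || (y != q) ->
    0 < m <= u -> m / D <= u / ((x - p) ^+ 2 + (y - q) ^+ 2).
  move=> xa yc xy /andP[m0 mu]; have vD := Dle _ _ xa yc.
  have v0 : 0 < (x - p) ^+ 2 + (y - q) ^+ 2.
    case/orP: xy => h; [rewrite ltr_pwDl ?sqr_ge0 //|rewrite ltr_wpDl ?sqr_ge0 //];
      by rewrite exprn_even_gt0 //= subr_eq0.
  apply: ler_pM => //; rewrite ?invr_ge0 ?(ltW m0) ?(ltW D0) //.
  by rewrite lef_pV2.
have cc0 : c <= c <= c + l by lra.
have cc1 : c <= c + l <= c + l by lra.
have aa0 : a <= a <= a + l by lra.
have aa1 : a <= a + l <= a + l by lra.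
have nq0 : c != q by rewrite lt_eqF.
have nq1 : c + l != q by rewrite gt_eqF.
have np0 : a != p by rewrite lt_eqF.
have np1 : a + l != p by rewrite gt_eqF.
have e1 : 0 < complex.Im (cint a (a + l) (fun x => ((x +i* c)%C - (p +i* q)%C)^-1)).
  apply: (@Im_cint_gt0 _ _ _ _ ((q - c) / D)) => //; first by rewrite divr_gt0 // subr_gt0.
    by move=> t ht; apply: (ccont_horizontal (c1 t ht)).
  move=> t ht; rewrite ImV /=; by apply: lbd => //; rewrite ?nq0 ?nq1 ?np0 ?np1 ?orbT //; lra.
have ImN (z : C) : complex.Im (- z) = - complex.Im z by case: z.
have e3 : complex.Im (cint a (a + l) (fun x => ((x +i* (c + l))%C - (p +i* q)%C)^-1)) < 0.
  rewrite -oppr_gt0 -ImN -mulN1r -cintZ ?(ltW al0) //; last first.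
    by move=> t ht; apply: (ccont_horizontal (c3 t ht)).
  apply: (@Im_cint_gt0 _ _ _ _ ((c + l - q) / D)) => //; first by rewrite divr_gt0 // subr_gt0.
    by move=> t ht; apply: rcontZ; apply: (ccont_horizontal (c3 t ht)).
  move=> t ht; rewrite mulN1r ImN ImV /= -mulNr opprB.
  by apply: lbd => //; rewrite ?nq0 ?nq1 ?np0 ?np1 ?orbT //; lra.
have ImiV (x y : R) : complex.Im ('i%C * ((x +i* y)%C - (p +i* q)%C)^-1) =
   (x - p) / ((x - p) ^+ 2 + (y - q) ^+ 2).
  have ei (z : C) : complex.Im ('i%C * z) = complex.Re z.
    by case: z => ? ? /=; rewrite mul0r mul1r add0r.
  by rewrite ei ImV.
have e2 : 0 < complex.Im ('i%C * cint c (c + l) (fun y => (((a + l) +i* y)%C - (p +i* q)%C)^-1)).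
  rewrite -cintZ ?(ltW cl0) //; last by move=> t ht; apply: (ccont_vertical (c2 t ht)).
  apply: (@Im_cint_gt0 _ _ _ _ ((a + l - p) / D)) => //; first by rewrite divr_gt0 // subr_gt0.
    by move=> t ht; apply: rcontZ; apply: (ccont_vertical (c2 t ht)).
  move=> t ht; rewrite ImiV.
  by apply: lbd => //; rewrite ?nq0 ?nq1 ?np0 ?np1 ?orbT //; lra.
have e4 : complex.Im ('i%C * cint c (c + l) (fun y => ((a +i* y)%C - (p +i* q)%C)^-1)) < 0.
  rewrite -oppr_gt0 -ImN -mulNr -cintZ ?(ltW cl0) //; last first.
    by move=> t ht; apply: (ccont_vertical (c4 t ht)).
  apply: (@Im_cint_gt0 _ _ _ _ ((p - a) / D)) => //; first by rewrite divr_gt0 // subr_gt0.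
    by move=> t ht; apply: rcontZ; apply: (ccont_vertical (c4 t ht)).
  move=> t ht; rewrite mulNr ImN ImiV -mulNr opprB.
  by apply: lbd => //; rewrite ?nq0 ?nq1 ?np0 ?np1 ?orbT //; lra.
have ImD (z w : C) : complex.Im (z + w) = complex.Im z + complex.Im w by case: z; case: w.
have ImB (z w : C) : complex.Im (z - w) = complex.Im z - complex.Im w by case: z; case: w.
apply/eqP => /(congr1 (@complex.Im R)); rewrite /contour !ImB ImD /=; lra.
Qed.

End Contour.

(** * Goursat's lemma and the maximum principle *)

Section Goursat.
Context {R : realType}.
Local Notation C := R[i].
Implicit Types (f g : C -> C) (a c l : R).

Lemma in_square_dist a c l z w : in_square a c l z -> in_square a c l w ->
  cabs (z - w) <= 2 * l.
Proof.
case: z => x y; case: w => u v; rewrite !in_squareE => /andP[xa yc] /andP[ua vc].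
apply: le_trans (cabs_le_ReIm _) _; rewrite /=.
have : `|x - u| <= l by rewrite ler_norml; lra.
have : `|y - v| <= l by rewrite ler_norml; lra.
lra.
Qed.

(** The odd increasing square root. Over an interval of length [l] containing [0] it grows by at
    least [Num.sqrt l], so the product of the growths in two directions is at least [l]. *)
Definition signed_sqrt (t : R) := Num.sqrt t - Num.sqrt (- t).

Lemma signed_sqrt_le (s t : R) : s <= t -> signed_sqrt s <= signed_sqrt t.
Proof. by move=> st; rewrite lerB // ler_wsqrtr // lerN2. Qed.

(* An additive set function on squares which is at least the side length on the
   squares containing [s]; it absorbs the contribution of the squares that
   contain an exceptional point. *)
Definition corner_mass (s : C) a c l : R :=
  (signed_sqrt (a + l - complex.Re s) - signed_sqrt (a - complex.Re s)) *
  (signed_sqrt (c + l - complex.Im s) - signed_sqrt (c - complex.Im s)).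

Lemma corner_mass_ge0 s a c l : 0 < l -> 0 <= corner_mass s a c l.
Proof.
by move=> l0; rewrite mulr_ge0 // subr_ge0 signed_sqrt_le // lerD2r lerDl ltW.
Qed.

Lemma corner_mass_quarters s a c l : corner_mass s a c l =
  corner_mass s a c (l / 2) + corner_mass s (a + l / 2) c (l / 2)
   + corner_mass s a (c + l / 2) (l / 2) + corner_mass s (a + l / 2) (c + l / 2) (l / 2).
Proof.
have E b : b + l / 2 + l / 2 = b + l :> R by field.
by rewrite /corner_mass !E; ring.
Qed.

Lemma corner_mass_lb s a c l : 0 < l -> in_square a c l s -> l <= corner_mass s a c l.
Proof.
move=> l0; case: s => x y; rewrite in_squareE => /andP[xa yc].
have H (b u : R) : b <= u <= b + l ->
    Num.sqrt l <= signed_sqrt (b + l - u) - signed_sqrt (b - u).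
  move=> bu; rewrite /signed_sqrt.
  rewrite [Num.sqrt (- (b + l - u))]ler0_sqrtr; last lra.
  have -> : - (b - u) = u - b by rewrite opprB.
  rewrite [Num.sqrt (b - u)]ler0_sqrtr; last lra.
  set p := Num.sqrt (b + l - u); set q := Num.sqrt (u - b).
  have p0 : 0 <= p by exact: sqrtr_ge0.
  have q0 : 0 <= q by exact: sqrtr_ge0.
  have p2 : p ^+ 2 = b + l - u by rewrite sqr_sqrtr //; lra.
  have q2 : q ^+ 2 = u - b by rewrite sqr_sqrtr //; lra.
  have -> : p - 0 - (0 - q) = p + q by ring.
  rewrite -(ger0_norm (addr_ge0 p0 q0)) -sqrtr_sqr ler_wsqrtr //.
  have : 0 <= p * q by rewrite mulr_ge0.
  have -> : (p + q) ^+ 2 = p ^+ 2 + q ^+ 2 + 2 * (p * q) by ring.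
  lra.
rewrite /corner_mass /= -{1}(sqr_sqrtr (ltW l0)) expr2.
by apply: ler_pM; rewrite ?sqrtr_ge0 // H.
Qed.

(** The quantity [mu] is additive on quarters, so a bound of the integral by [k * mu] need only be
    checked on small squares. Around a point of differentiability the error is o(l ^ 2), controlled
    by the area term; at a point of [E] continuity gives only o(l), which the corner mass
    dominates. *)
Theorem goursat f (E : seq C) a0 c0 l0 : 0 < l0 ->
  (forall z, in_square a0 c0 l0 z -> ccont f z) ->
  (forall z, in_square a0 c0 l0 z -> z \notin E -> exists d, cderiv f z d) ->
  contour f a0 c0 l0 = 0.
Proof.
move=> l00 cf df; apply/eqP; rewrite -cabs_eq0 eq_le cabs_ge0 andbT.
pose mu a c l := l ^+ 2 + \sum_(s <- E) corner_mass s a c l.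
have mass0 a c l : 0 < l -> 0 <= \sum_(s <- E) corner_mass s a c l.
  by move=> l1; apply: sumr_ge0 => s _; exact: corner_mass_ge0.
have mu0 : 0 < mu a0 c0 l0 by rewrite ltr_pwDl ?exprn_gt0 // mass0.
apply/ler_addgt0Pl => e e0; rewrite addr0.
pose k := e / mu a0 c0 l0.
have k0 : 0 < k by rewrite divr_gt0.
suff : cabs (contour f a0 c0 l0) <= k * mu a0 c0 l0 by rewrite /k divfK // gt_eqF.
pose sub a c l := [&& a0 <= a, a + l <= a0 + l0, c0 <= c & c + l <= c0 + l0].
have subS a c l z : sub a c l -> in_square a c l z -> in_square a0 c0 l0 z.
  by case: z => x y; rewrite !in_squareE /sub; lra.
pose P a c l := sub a c l -> cabs (contour f a c l) <= k * mu a c l.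
suff : P a0 c0 l0 by apply; rewrite /sub !lexx.
apply: (@bisection2 R P a0 c0 l0 l00).
  move=> a c l l1 P1 P2 P3 P4 sb.
  rewrite contour_quarters //; last by move=> z zs; exact: cf (subS _ _ _ _ sb zs).
  have {}P1 := P1 ltac:(rewrite /sub in sb *; lra).
  have {}P2 := P2 ltac:(rewrite /sub in sb *; lra).
  have {}P3 := P3 ltac:(rewrite /sub in sb *; lra).
  have {}P4 := P4 ltac:(rewrite /sub in sb *; lra).
  have -> : mu a c l = mu a c (l / 2) + mu (a + l / 2) c (l / 2)
     + mu a (c + l / 2) (l / 2) + mu (a + l / 2) (c + l / 2) (l / 2).
    rewrite /mu (eq_bigr _ (fun s _ => corner_mass_quarters s a c l)) !big_split /=.
    by field.
  move: P1 P2 P3 P4; clear.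
  move: (mu _ _ _) (mu _ _ _) (mu _ _ _) (mu _ _ _) => m1 m2 m3 m4 P1 P2 P3 P4.
  rewrite !mulrDr; apply: le_trans (cabsD _ _) (lerD _ P4).
  by apply: le_trans (cabsD _ _) (lerD _ P3); apply: le_trans (cabsD _ _) (lerD P1 P2).
move=> x y xa yc; pose z := (x +i* y)%C.
have zin : in_square a0 c0 l0 z by rewrite in_squareE xa yc.
(* Subtracting an affine function does not change the integral, so only the deviation from it
   counts. *)
have key a c l al be B : 0 < l -> sub a c l -> in_square a c l z ->
    (forall w, in_square a c l w -> cabs (f w - (al + be * w)) <= B) ->
    cabs (contour f a c l) <= 4 * B * l.
  move=> l1 sb zs H.
  have ca w : ccont (fun w => al + be * w) w by exact: cderiv_ccont (cderiv_affine _ _ _).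
  have cfs w : on_border a c l w -> ccont f w by case/andP => /(subS _ _ _ _ sb)/cf.
  have E' : contour f a c l = contour (fun w => f w + -1 * (al + be * w)) a c l.
    by rewrite contourDZ // contour_affine // mulr0 addr0.
  rewrite E'; apply: contour_bound => // w wb.
    by apply: ccontD (cfs w wb) _; apply: ccontM (ccont_cst _ _) (ca w).
  by rewrite mulN1r; apply: H; case/andP: wb.
have [zE|zE] := boolP (z \in E); last first.
  (* The tolerance is [k / 8]: a deviation of at most [k / 8 * (2 * l)] on a perimeter [4 * l] gives
     [k * l ^ 2]. *)
  have [d fd] := df z zin zE; have [r r0 Hr] := fd _ (divr_gt0 k0 (ltr0Sn R 7)).
  exists (r / 3); first by rewrite divr_gt0.
  move=> a c l l1 lr axl cyl a0a al0 c0c cl0 _.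
  have sb : sub a c l by rewrite /sub a0a al0 c0c cl0.
  have zs : in_square a c l z by rewrite in_squareE axl cyl.
  have := @key a c l (f z - d * z) d (k / 8 * (2 * l)) l1 sb zs.
  have H w : in_square a c l w -> cabs (f w - (f z - d * z + d * w)) <= k / 8 * (2 * l).
    move=> ws; have wz := in_square_dist ws zs.
    have -> : f w - (f z - d * z + d * w) = f w - f z - d * (w - z) by ring.
    apply: le_trans (Hr w _) _; first lra.
    by rewrite ler_wpM2l // divr_ge0 // ltW.
  move=> /(_ H) K; apply: le_trans K _; rewrite /mu mulrDr.
  have : 0 <= k * \sum_(s <- E) corner_mass s a c l by rewrite mulr_ge0 ?mass0 // ltW.
  have -> : 4 * (k / 8 * (2 * l)) * l = k * l ^+ 2 by field.
  lra.
have [r r0 Hr] := cf z zin _ (divr_gt0 k0 (ltr0Sn R 3)).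
exists (r / 3); first by rewrite divr_gt0.
move=> a c l l1 lr axl cyl a0a al0 c0c cl0 _.
have sb : sub a c l by rewrite /sub a0a al0 c0c cl0.
have zs : in_square a c l z by rewrite in_squareE axl cyl.
have H w : in_square a c l w -> cabs (f w - (f z + 0 * w)) <= k / 4.
  move=> ws; have wz := in_square_dist ws zs.
  by rewrite mul0r addr0; apply: ltW; apply: Hr; lra.
apply: le_trans (key a c l (f z) 0 _ l1 sb zs H) _.
have -> : 4 * (k / 4) * l = k * l by field.
rewrite ler_wpM2l ?(ltW k0) // /mu (big_rem z zE) /=.
have h1 := corner_mass_lb l1 zs.
have h2 : 0 <= \sum_(s <- rem z E) corner_mass s a c l.
  by apply: sumr_ge0 => s _; exact: corner_mass_ge0.
have : 0 <= l ^+ 2 by rewrite sqr_ge0.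
lra.
Qed.

(** By Bernoulli's inequality the powers of [x / y] would be unbounded if [x / y > 1]. *)
Lemma ler_of_exp_bound (x y K : R) : 0 <= x -> 0 <= y ->
  (forall n, x ^+ n <= K * y ^+ n) -> x <= y.
Proof.
move=> x0 y0 H; have [->|xn0] := eqVneq x 0; first by [].
have xp : 0 < x by rewrite lt_def xn0.
have yp : 0 < y.
  rewrite lt_def y0 andbT; apply/eqP => y00; have := H 1%N.
  by rewrite y00 !expr1 mulr0 leNgt xp.
rewrite leNgt; apply/negP => yx.
pose q := x / y - 1.
have q0 : 0 < q by rewrite subr_gt0 ltr_pdivlMr // mul1r.
have bern n : 1 + n%:R * q <= (x / y) ^+ n.
  have -> : x / y = 1 + q by rewrite /q subrKC.
  elim: n => [|n IH]; first by rewrite mul0r addr0 expr0.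
  rewrite exprS; have : (1 + q) * (1 + n%:R * q) <= (1 + q) * (1 + q) ^+ n.
    by rewrite ler_wpM2l // addr_ge0 // ltW.
  apply: le_trans; rewrite -natr1; have : 0 <= n%:R * (q * q) by rewrite !mulr_ge0 // ltW.
  lra.
have K1 n : (x / y) ^+ n <= K by rewrite expr_div_n ler_pdivrMr ?exprn_gt0.
have K0 : 0 <= K / q by rewrite divr_ge0 ?(ltW q0) // (le_trans _ (K1 0%N)) // expr0.
have := archi_boundP K0; set n := Num.bound _; rewrite ltr_pdivrMr // => Kn.
have := bern n; have := K1 n; lra.
Qed.

(** The value of the kernel integral enters a constant independent of [n], which disappears on
    comparing n-th powers. The point [p] joins [E] as an exceptional point of the divided difference
    of [f ^ n]. *)
Theorem maximum_principle f (E : seq C) a c l (p : C) B : 0 < l -> 0 <= B ->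
  (forall z, in_square a c l z -> ccont f z) ->
  (forall z, in_square a c l z -> z \notin E -> exists d, cderiv f z d) ->
  a < complex.Re p < a + l -> c < complex.Im p < c + l -> p \notin E ->
  (forall z, on_border a c l z -> cabs (f z) <= B) -> cabs (f p) <= B.
Proof.
move=> l0 B0 cf df pa pc pE fB.
have pin : in_square a c l p by rewrite /in_square; lra.
have [dp fdp] := df p pin pE.
have pnb z : on_border a c l z -> z - p != 0.
  rewrite subr_eq0 => zb; apply/negP => /eqP zp; move: zb; rewrite zp.
  by case/andP=> _ /or4P[]/eqP; lra.
pose K := contour (fun z => (z - p)^-1) a c l.
have K0 : 0 < cabs K by rewrite cabs_gt0 contour_kernel.
pose d := Num.min (Num.min (complex.Re p - a) (a + l - complex.Re p))
                  (Num.min (complex.Im p - c) (c + l - complex.Im p)).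
have d0 : 0 < d by rewrite !lt_min; lra.
have [/andP[d1 d2] /andP[d3 d4]] : (d <= complex.Re p - a) && (d <= a + l - complex.Re p) /\
    (d <= complex.Im p - c) && (d <= c + l - complex.Im p).
  by have := lexx d; rewrite {2}/d !le_min => /andP[].
have dist z : on_border a c l z -> d <= cabs (z - p).
  have RB (u v : C) : complex.Re (u - v) = complex.Re u - complex.Re v by case: u; case: v.
  have IB (u v : C) : complex.Im (u - v) = complex.Im u - complex.Im v by case: u; case: v.
  case/andP=> _ /or4P[]/eqP h.
  - apply: le_trans (Re_le_cabs _); rewrite RB h ler0_norm; lra.
  - apply: le_trans (Re_le_cabs _); rewrite RB h ger0_norm; lra.
  - apply: le_trans (Im_le_cabs _); rewrite IB h ler0_norm; lra.
  - apply: le_trans (Im_le_cabs _); rewrite IB h ger0_norm; lra.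
apply: (@ler_of_exp_bound _ _ (4 * l / (d * cabs K))) => // n.
have [dn gdn] := cderivX n fdp.
pose g := divdiff (fun z => f z ^+ n) p dn.
have gc z : in_square a c l z -> ccont g z.
  by move=> zin; apply: divdiff_ccont => //; apply: ccontX; exact: cf.
have gd z : in_square a c l z -> z \notin p :: E -> exists d, cderiv g z d.
  rewrite in_cons negb_or => zin /andP[zp zE]; apply: divdiff_cderiv => //.
  by have [d1' fd1] := df z zin zE; exact: cderivX fd1.
have G0 := goursat l0 gc gd.
have kc z : on_border a c l z -> ccont (fun w => (w - p)^-1) z.
  by move=> /pnb zp; apply: ccontV => //; exact/ccont_sub_cst/ccont_id.
have fnc z : on_border a c l z -> ccont (fun w => f w ^+ n * (w - p)^-1) z.
  by move=> zb; apply: ccontM (kc z zb); apply: ccontX; apply: cf; case/andP: zb.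
have E1 : contour (fun z => f z ^+ n * (z - p)^-1) a c l = f p ^+ n * K.
  apply/eqP; rewrite -subr_eq0 -G0 -mulNr -contourDZ //; apply/eqP/eq_contour => // z zb.
  have zp := pnb z zb; have zp' : z != p by rewrite -subr_eq0.
  by rewrite /g divdiffE //; field.
have := congr1 cabs E1; rewrite cabsM cabsX => E2.
have : cabs (f p) ^+ n * cabs K <= 4 * (B ^+ n / d) * l.
  rewrite -E2; apply: contour_bound => // z zb.
  rewrite cabsM cabsX cabsV; apply: ler_pM => //; rewrite ?exprn_ge0 ?invr_ge0 //.
    by rewrite lerXn2r ?nnegrE // fB.
  by rewrite lef_pV2 ?posrE ?dist // cabs_gt0 pnb.
rewrite -ler_pdivlMr // => H; apply: le_trans H _.
by rewrite le_eqVlt; apply/orP; left; apply/eqP; field; rewrite ?gt_eqF.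
Qed.

End Goursat.

(** * Local theory of holomorphic functions *)

Section Holomorphic.
Context {R : realType}.
Local Notation C := R[i].
Implicit Types (f g : C -> C) (z w p q : C) (r h M : R).

Definition cdiff f z := exists d, cderiv f z d.

Definition holo_ball f z r := forall w, cabs (w - z) < r -> cdiff f w.

Definition der f z : C := xget 0 [set d | cderiv f z d].

Lemma der_unique f z d : cderiv f z d -> der f z = d.
Proof.
move=> fd; rewrite /der; case: xgetP => [d' _ fd'|/(_ d)//].
exact: cderiv_unique fd' fd.
Qed.

Lemma derP f z : cdiff f z -> cderiv f z (der f z).
Proof. by move=> [d fd]; rewrite (der_unique fd). Qed.

Lemma cdiff_ccont f z : cdiff f z -> ccont f z.
Proof. by case=> d /cderiv_ccont. Qed.

Lemma sub_Re z w : complex.Re (z - w) = complex.Re z - complex.Re w.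
Proof. by case: z; case: w. Qed.

Lemma sub_Im z w : complex.Im (z - w) = complex.Im z - complex.Im w.
Proof. by case: z; case: w. Qed.

(** The square of half-side [h] around [z0] lies in the ball because [2 * h < r], and its border
    stays at distance at least [h] from the centre, where the bound is assumed. Points of [E] inside
    are reached by continuity. *)
Lemma ball_maximum_principle f (E : seq C) z0 h r B : 0 < h -> 2 * h < r -> 0 <= B ->
  (forall w, cabs (w - z0) < r -> ccont f w) ->
  (forall w, cabs (w - z0) < r -> w \notin E -> cdiff f w) ->
  (forall w, h <= cabs (w - z0) < r -> cabs (f w) <= B) ->
  forall w, cabs (w - z0) < r -> cabs (f w) <= B.
Proof.
move=> h0 hr B0 cf df fB w wr.
have [hw|wh] := leP h (cabs (w - z0)); first by apply: fB; rewrite hw.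
have gen p : cabs (p - z0) < h -> p \notin E -> cabs (f p) <= B.
  move=> ph pE.
  have sq z : in_square (complex.Re z0 - h) (complex.Im z0 - h) (2 * h) z -> cabs (z - z0) < r.
    move=> /and4P[h1 h2 h3 h4]; apply: le_lt_trans (cabs_le_ReIm _) _.
    have : `|complex.Re (z - z0)| <= h by rewrite sub_Re ler_norml; lra.
    have : `|complex.Im (z - z0)| <= h by rewrite sub_Im ler_norml; lra.
    lra.
  have := le_lt_trans (Re_le_cabs _) ph; have := le_lt_trans (Im_le_cabs _) ph.
  rewrite sub_Re sub_Im !ltr_norml => pI pR.
  apply: (@maximum_principle _ _ E (complex.Re z0 - h) (complex.Im z0 - h) (2 * h)) => //; try lra.
  - by move=> z /sq; exact: cf.
  - by move=> z /sq; exact: df.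
  - move=> z zb; apply: fB; rewrite sq ?andbT; last by case/andP: zb.
    case/andP: zb => _ /or4P[]/eqP e.
    + by apply: le_trans (Re_le_cabs _); rewrite sub_Re e ler0_norm; lra.
    + by apply: le_trans (Re_le_cabs _); rewrite sub_Re e ger0_norm; lra.
    + by apply: le_trans (Im_le_cabs _); rewrite sub_Im e ler0_norm; lra.
    + by apply: le_trans (Im_le_cabs _); rewrite sub_Im e ger0_norm; lra.
apply/ler_addgt0Pl => e e0.
have [d d0 Hd] := cf w wr e e0; have [s s0 Hs] := punctured_avoid E w.
have m0 : 0 < Num.min (Num.min d s) (h - cabs (w - z0)).
  by rewrite !lt_min d0 s0 subr_gt0.
have [p pw] := ex_near_neq w m0; rewrite !lt_min => /andP[/andP[pd ps] ph].
have := gen p _ (Hs p pw ps); have := cabsBd p w z0 => H1 /(_ ltac:(lra)) H2.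
have := Hd p pd; have := cabs_near (f p) (f w); lra.
Qed.

(** At distance at least [r / 4] from [z0] the denominator is at least [r / 8], whence
    [2 * M / (r / 8)]; the maximum principle carries the bound inside. Only [p] is added to the
    exceptional points, so the lemma can be iterated. *)
Lemma divdiff_bound f (E : seq C) z0 r M p d : 0 < r ->
  (forall w, cabs (w - z0) < r -> ccont f w) ->
  (forall w, cabs (w - z0) < r -> w \notin E -> cdiff f w) ->
  (forall w, cabs (w - z0) < r -> cabs (f w) <= M) ->
  cabs (p - z0) < r / 8 -> cderiv f p d ->
  [/\ forall w, cabs (w - z0) < r -> ccont (divdiff f p d) w,
      forall w, cabs (w - z0) < r -> w \notin p :: E -> cdiff (divdiff f p d) w &
      forall w, cabs (w - z0) < r -> cabs (divdiff f p d w) <= 16 / r * M].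
Proof.
move=> r0 cf df fM pr fd.
have M0 : 0 <= M by apply: le_trans (cabs_ge0 _) (fM z0 _); rewrite subrr cabs0.
have c w : cabs (w - z0) < r -> ccont (divdiff f p d) w.
  by move=> wr; apply: divdiff_ccont => //; exact: cf.
have dd w : cabs (w - z0) < r -> w \notin p :: E -> cdiff (divdiff f p d) w.
  by rewrite in_cons negb_or => wr /andP[wp wE]; apply: divdiff_cderiv => //; exact: df.
split=> //; apply: (@ball_maximum_principle _ (p :: E) z0 (r / 4)) => //; try lra.
  by rewrite mulr_ge0 // divr_ge0 // ltW.
move=> w /andP[w1 w2].
have wp : r / 8 <= cabs (w - p).
  by have := cabsBd w p z0; lra.
have wp0 : w != p by rewrite -subr_eq0 -cabs_gt0; lra.
rewrite divdiffE // cabsM cabsV ler_pdivrMr ?cabs_gt0 ?subr_eq0 //.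
have H : cabs (f w - f p) <= 2 * M.
  have := cabsB (f w) (f p); have := fM w w2; have := fM p ltac:(lra); lra.
apply: le_trans H _.
have -> : 2 * M = 16 / r * M * (r / 8) by field; rewrite gt_eqF.
by rewrite ler_wpM2l // mulr_ge0 // divr_ge0 // ltW.
Qed.

Lemma cauchy_estimate f z0 r M p : 0 < r -> holo_ball f z0 r ->
  (forall w, cabs (w - z0) < r -> cabs (f w) <= M) ->
  cabs (p - z0) < r / 8 -> cabs (der f p) <= 16 / r * M.
Proof.
move=> r0 hf fM pr; have pr' : cabs (p - z0) < r by lra.
have := @divdiff_bound f [::] z0 r M p (der f p) r0 (fun w k => cdiff_ccont (hf w k))
  (fun w k _ => hf w k) fM pr (derP (hf p pr')).
by case=> _ _ /(_ p pr'); rewrite /divdiff eqxx.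
Qed.

(** The remainder is [(w - p) ^ 2] times the second divided difference with nodes [p], [w],
    evaluated at [p]. *)
Lemma taylor_bound f z0 r M p w : 0 < r -> holo_ball f z0 r ->
  (forall w, cabs (w - z0) < r -> cabs (f w) <= M) ->
  cabs (p - z0) < r / 8 -> cabs (w - z0) < r / 8 ->
  cabs (f w - f p - der f p * (w - p)) <= (16 / r) ^+ 2 * M * cabs (w - p) ^+ 2.
Proof.
move=> r0 hf fM pr wr; have [->|wp] := eqVneq w p.
  by rewrite !subrr mulr0 subrr cabs0 expr0n mulr0.
have pr' : cabs (p - z0) < r by lra.
have wr' : cabs (w - z0) < r by lra.
have [c d b] := @divdiff_bound f [::] z0 r M p (der f p) r0 (fun w k => cdiff_ccont (hf w k))
  (fun w k _ => hf w k) fM pr (derP (hf p pr')).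
have [d' Dd] := d w wr' ltac:(by rewrite !inE).
have [_ _ /(_ p pr')] := @divdiff_bound _ [:: p] z0 r _ w d' r0 c d b wr Dd.
rewrite divdiffE 1?eq_sym // /divdiff eqxx (negbTE wp) cabsM cabsV.
have wp0 : w - p != 0 by rewrite subr_eq0.
rewrite ler_pdivrMr ?cabs_gt0 ?subr_eq0 1?eq_sym // => H.
have -> : f w - f p - der f p * (w - p) = - (der f p - (f w - f p) / (w - p)) * (w - p).
  by field.
rewrite cabsM cabsN.
have -> : (16 / r) ^+ 2 * M * cabs (w - p) ^+ 2 =
  16 / r * (16 / r * M) * cabs (w - p) * cabs (w - p) by ring.
by apply: ler_wpM2r => //; rewrite (cabs_dist w).
Qed.

(** Adding the Taylor remainders at [p] and at [w] cancels the values of [f] and leaves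
    [(der f w - der f p) * (w - p)]. *)
Lemma der_lipschitz f z0 r M p w : 0 < r -> holo_ball f z0 r ->
  (forall w, cabs (w - z0) < r -> cabs (f w) <= M) ->
  cabs (p - z0) < r / 8 -> cabs (w - z0) < r / 8 ->
  cabs (der f w - der f p) <= 2 * ((16 / r) ^+ 2 * M) * cabs (w - p).
Proof.
move=> r0 hf fM pr wr; have [->|wp] := eqVneq w p.
  by rewrite !subrr cabs0 mulr0.
have H1 := taylor_bound r0 hf fM pr wr; have H2 := taylor_bound r0 hf fM wr pr.
have wp0 : 0 < cabs (w - p) by rewrite cabs_gt0 subr_eq0.
rewrite -(ler_pM2r wp0) -cabsM.
have -> : (der f w - der f p) * (w - p) =
  (f w - f p - der f p * (w - p)) + (f p - f w - der f w * (p - w)) by ring.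
rewrite (cabs_dist p w) in H2.
have := cabsD (f w - f p - der f p * (w - p)) (f p - f w - der f w * (p - w)).
lra.
Qed.

Lemma squeeze_witness (T : Type) (D : set T) (f g : T -> R) : D !=set0 ->
  (forall x y, D x -> D y -> f x <= g y) -> exists l, forall x, D x -> f x <= l <= g x.
Proof.
move=> [x0 Dx0] fg; exists (sup (f @` D)) => x Dx; apply/andP; split.
  by apply: ub_le_sup; [exists (g x0) => _ [y Dy <-]; exact: fg|exists x].
by apply: ge_sup; [exists (f x0), x0|move=> _ [y Dy <-]; exact: fg].
Qed.

(* The divided differences [f[z0, p]] satisfy a Cauchy condition as [p] tends to
   [z0], by the bound on second divided differences. *)
Lemma removable_singularity f z0 r : 0 < r -> ccont f z0 ->
  (forall w, w != z0 -> cabs (w - z0) < r -> cdiff f w) -> cdiff f z0.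
Proof.
move=> r'0 cf df'; have [t t0 Ht] := cf 1 ltr01.
pose s := Num.min r t; have s0 : 0 < s by rewrite lt_min r'0.
pose M := cabs (f z0) + 1.
have fM w : cabs (w - z0) < s -> cabs (f w) <= M.
  rewrite lt_min => /andP[_ /Ht]; have := cabsD (f w - f z0) (f z0).
  by rewrite subrK /M; lra.
have df w : cabs (w - z0) < s -> w \notin [:: z0] -> cdiff f w.
  by rewrite lt_min !inE => /andP[wr _] wz; exact: df'.
have cf' w : cabs (w - z0) < s -> ccont f w.
  move=> ws; have [->//|wz] := eqVneq w z0.
  by apply: cdiff_ccont; apply: df; rewrite ?inE.
pose D := [set w | w != z0 /\ cabs (w - z0) < s / 8].
pose S w := (f z0 - f w) / (z0 - w).
pose K := 16 / s * (16 / s * M).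
have M0 : 0 <= M by rewrite addr_ge0.
have K0 : 0 <= K by rewrite !mulr_ge0 // invr_ge0 ltW.
(* This is the second divided difference with nodes [p], [q], evaluated at the possibly singular
   point [z0], which is carried along as an exceptional point. *)
have half p q : D p -> D q -> p != q ->
    cabs (S p - (f q - f p) / (q - p)) <= K * cabs (q - z0).
  move=> [pz ps] [qz qs] pq.
  have ps' : cabs (p - z0) < s by lra.
  have qs' : cabs (q - z0) < s by lra.
  have zs' : cabs (z0 - z0) < s by rewrite subrr cabs0.
  have [dp Dp] := df p ps' ltac:(by rewrite inE).
  have [c d b] := divdiff_bound s0 cf' df fM ps Dp.
  have [dq Dq] := d q qs' ltac:(by rewrite !inE negb_or eq_sym pq).
  have [_ _ /(_ z0 zs')] := divdiff_bound s0 c d b qs Dq.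
  rewrite divdiffE 1?eq_sym // !divdiffE 1?eq_sym // -/(S p) cabsM cabsV.
  rewrite ler_pdivrMr ?cabs_gt0 ?subr_eq0 1?eq_sym // -/K.
  by rewrite (cabs_dist z0).
have tri p q : D p -> D q -> cabs (S p - S q) <= K * cabs (p - z0) + K * cabs (q - z0).
  move=> Dp Dq; have [->|pq] := eqVneq p q.
    by rewrite subrr cabs0 addr_ge0 // mulr_ge0.
  have h1 := half p q Dp Dq pq; rewrite eq_sym in pq; have h2 := half q p Dq Dp pq.
  have E : (f p - f q) / (p - q) = (f q - f p) / (q - p).
    by rewrite -(opprB q p) invrN mulrN -mulNr opprB.
  rewrite E in h2.
  have := cabsBd (S p) ((f q - f p) / (q - p)) (S q).
  rewrite (cabs_dist ((f q - f p) / (q - p)) (S q)); lra.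
have Dn : D !=set0.
  by have [w wz ws] := ex_near_neq z0 (divr_gt0 s0 (ltr0Sn R 7)); exists w.
(* By [tri] the intervals of radius [K * cabs (p - z0)] around the real parts of [S p] meet
   pairwise, so they have a common point: the real part of the derivative. *)
have [lr Hr] : exists l, forall p, D p -> complex.Re (S p) - K * cabs (p - z0) <= l <=
    complex.Re (S p) + K * cabs (p - z0).
  apply: squeeze_witness => // p q Dp Dq.
  by have := le_trans (Re_le_cabs _) (tri p q Dp Dq); rewrite sub_Re ler_norml; lra.
have [li Hi] : exists l, forall p, D p -> complex.Im (S p) - K * cabs (p - z0) <= l <=
    complex.Im (S p) + K * cabs (p - z0).
  apply: squeeze_witness => // p q Dp Dq.
  by have := le_trans (Im_le_cabs _) (tri p q Dp Dq); rewrite sub_Im ler_norml; lra.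
exists (lr +i* li)%C => e e0.
have B0 : 0 < 2 * K + 1 by lra.
exists (Num.min (s / 8) (e / (2 * K + 1))); first by rewrite lt_min !divr_gt0.
move=> w; rewrite lt_min => /andP[ws]; rewrite ltr_pdivlMr // => we.
have [->|wz] := eqVneq w z0; first by rewrite !subrr mulr0 subrr cabs0 mulr0.
have Dw : D w by split.
have wz0 : w - z0 != 0 by rewrite subr_eq0.
have -> : f w - f z0 - (lr +i* li)%C * (w - z0) = (S w - (lr +i* li)%C) * (w - z0).
  have wz1 : z0 - w != 0 by rewrite -opprB oppr_eq0.
  by rewrite /S; field.
rewrite cabsM; apply: ler_wpM2r => //.
apply: le_trans (cabs_le_ReIm _) _; rewrite sub_Re sub_Im /=.
have := Hr w Dw; have := Hi w Dw => h1 h2.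
have : `|complex.Re (S w) - lr| <= K * cabs (w - z0) by rewrite ler_norml; lra.
have : `|complex.Im (S w) - li| <= K * cabs (w - z0) by rewrite ler_norml; lra.
have : 0 <= cabs (w - z0) by [].
lra.
Qed.

Lemma divdiff_holo f z0 r : 0 < r -> holo_ball f z0 r ->
  holo_ball (divdiff f z0 (der f z0)) z0 r.
Proof.
move=> r0 hf.
have z0r : cabs (z0 - z0) < r by rewrite subrr cabs0.
have off w : w != z0 -> cabs (w - z0) < r -> cdiff (divdiff f z0 (der f z0)) w.
  by move=> wz wr; apply: divdiff_cderiv => //; exact: hf.
move=> w wr; have [->|wz] := eqVneq w z0; last exact: off.
apply: removable_singularity r0 _ off.
by apply: divdiff_ccont; [apply: derP; exact: hf|apply: cdiff_ccont; exact: hf].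
Qed.

Lemma locally_bounded f z : ccont f z -> exists2 r : R, 0 < r &
  forall w, cabs (w - z) < r -> cabs (f w) <= cabs (f z) + 1.
Proof.
move=> cf; have [t t0 Ht] := cf 1 ltr01; exists t => // w /Ht.
by have := cabsD (f w - f z) (f z); rewrite subrK; lra.
Qed.

Lemma holo_ball_sub f z r z' r' : holo_ball f z r -> cabs (z' - z) + r' <= r ->
  holo_ball f z' r'.
Proof. by move=> hf h w wr; apply: hf; have := cabsBd w z' z; lra. Qed.

(** Writing [f w = f z0 + (w - z0) * F w] with [F] holomorphic gives [f' = F + (w - z0) * F']; the
    Taylor and Lipschitz bounds for [F] then identify the derivative of [f'] at [z0] as
    [2 * der F z0]. *)
Lemma der_cdiff f z0 r : 0 < r -> holo_ball f z0 r -> cdiff (der f) z0.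
Proof.
move=> r0 hf; have z0r : cabs (z0 - z0) < r by rewrite subrr cabs0.
set F := divdiff f z0 (der f z0).
have hF : holo_ball F z0 r := divdiff_holo r0 hf.
have [t t0 Ht] := locally_bounded (cdiff_ccont (hF z0 z0r)).
pose s := Num.min r t; have s0 : 0 < s by rewrite lt_min r0.
have sr : s <= r by rewrite ge_min lexx.
have st : s <= t by rewrite ge_min lexx orbT.
have hFs : holo_ball F z0 s by apply: holo_ball_sub hF _; rewrite subrr cabs0 add0r.
have FM w : cabs (w - z0) < s -> cabs (F w) <= cabs (F z0) + 1 by move=> ws; apply: Ht; lra.
pose K := (16 / s) ^+ 2 * (cabs (F z0) + 1).
have K0 : 0 <= K by rewrite mulr_ge0 ?sqr_ge0 // addr_ge0.
have fE w : f w = f z0 + (w - z0) * F w.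
  rewrite /F; have [->|wz] := eqVneq w z0; first by rewrite subrr mul0r addr0.
  by rewrite divdiffE // mulrC divfK ?subr_eq0 // subrKC.
have dfE w : cabs (w - z0) < r -> der f w = F w + (w - z0) * der F w.
  move=> wr; apply: der_unique.
  have := cderivD (cderiv_cst (f z0) w)
     (cderivM (cderiv_sub_cst z0 (cderiv_id w)) (derP (hF w wr))).
  rewrite add0r mul1r; apply: cderiv_eq ltr01 _ => v _.
  by rewrite [RHS]fE.
exists (2 * der F z0) => e e0.
have B0 : 0 < 3 * K + 1 by lra.
exists (Num.min (s / 8) (e / (3 * K + 1))); first by rewrite lt_min !divr_gt0.
move=> w; rewrite lt_min => /andP[ws]; rewrite ltr_pdivlMr // => we.
have z8 : cabs (z0 - z0) < s / 8 by rewrite subrr cabs0 divr_gt0.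
have T := taylor_bound s0 hFs FM z8 ws; have L := der_lipschitz s0 hFs FM z8 ws.
rewrite -/K in T L.
rewrite !dfE ?subrr ?cabs0 //; last lra.
have -> : F w + (w - z0) * der F w - (F z0 + 0 * der F z0) - 2 * der F z0 * (w - z0) =
  (F w - F z0 - der F z0 * (w - z0)) + (w - z0) * (der F w - der F z0) by ring.
apply: le_trans (cabsD _ _) _; rewrite cabsM.
have : cabs (w - z0) * cabs (der F w - der F z0) <= cabs (w - z0) * (2 * K * cabs (w - z0)).
  by rewrite ler_wpM2l.
have : cabs (w - z0) * (3 * K + 1) * cabs (w - z0) <= e * cabs (w - z0).
  by rewrite ler_wpM2r // mulrC ltW // mulrC.
have : 0 <= cabs (w - z0) ^+ 2 by rewrite sqr_ge0.
rewrite expr2 in T *; lra.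
Qed.

(** The divided difference at [0] is at most [16 * M / r] on the ball of radius [r], and [r] is
    arbitrary. *)
Lemma liouville f M : (forall z, cdiff f z) -> (forall z, cabs (f z) <= M) ->
  forall z w, f z = f w.
Proof.
move=> df fM; suff H z : f z = f 0 by move=> z w; rewrite (H z) (H w).
have [->//|z0] := eqVneq z 0.
have M0 : 0 <= M by apply: le_trans (cabs_ge0 _) (fM 0).
have S r : cabs z < r -> cabs (f z - f 0) * r <= 16 * M * cabs z.
  move=> zr; have r0 : 0 < r by apply: le_lt_trans zr.
  have [||_ _ /(_ z)] := @divdiff_bound f [::] 0 r M 0 (der f 0) r0
     (fun w _ => cdiff_ccont (df w)) (fun w _ _ => df w) (fun w _ => fM w).
  - by rewrite subrr cabs0 divr_gt0.
  - exact: derP.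
  rewrite divdiffE // !subr0 => /(_ zr); rewrite cabsM cabsV ler_pdivrMr ?cabs_gt0 //.
  rewrite -(ler_pM2r r0); have -> : 16 / r * M * cabs z * r = 16 * M * cabs z.
    by field; rewrite gt_eqF.
  by [].
apply/eqP; rewrite -subr_eq0 -cabs_eq0 eq_le cabs_ge0 andbT leNgt; apply/negP => d0.
pose r := cabs z + 1 + 16 * M * cabs z / cabs (f z - f 0).
have q0 : 0 <= 16 * M * cabs z / cabs (f z - f 0) by rewrite !mulr_ge0 ?invr_ge0.
have := S r ltac:(rewrite /r; lra); rewrite /r mulrDr [_ * (_ / _)]mulrC divfK ?gt_eqF //.
have : 0 < cabs (f z - f 0) * (cabs z + 1) by rewrite mulr_gt0 // ltr_wpDl.
lra.
Qed.

(** The iterated divided differences [F k] at [z0] divide out one factor [w - z0] at a time. If all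
    [F k z0] vanish, [f w] is at most [(16 / s * cabs (w - z0)) ^ k * M] for every [k]; otherwise
    the first nonzero one gives the order of the zero. *)
Lemma isolated_zeros f z0 r : 0 < r -> holo_ball f z0 r ->
  (exists2 s : R, 0 < s & forall w, cabs (w - z0) < s -> f w = 0) \/
  (exists2 s : R, 0 < s & forall w, w != z0 -> cabs (w - z0) < s -> f w != 0).
Proof.
move=> r1 hf1; have [t t0 Ht] := locally_bounded (cdiff_ccont (hf1 z0 ltac:(by rewrite subrr cabs0))).
pose s := Num.min r t; have s0 : 0 < s by rewrite lt_min r1.
have sr : s <= r by rewrite ge_min lexx.
have st : s <= t by rewrite ge_min lexx orbT.
have hf : holo_ball f z0 s by apply: holo_ball_sub hf1 _; rewrite subrr cabs0 add0r.
set M := cabs (f z0) + 1 in Ht.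
have fM w : cabs (w - z0) < s -> cabs (f w) <= M by move=> ws; apply: Ht; lra.
pose F k := iter k (fun g => divdiff g z0 (der g z0)) f.
have z0s : cabs (z0 - z0) < s by rewrite subrr cabs0.
have z08 : cabs (z0 - z0) < s / 8 by rewrite subrr cabs0 divr_gt0.
have FP k : holo_ball (F k) z0 s /\
    forall w, cabs (w - z0) < s -> cabs (F k w) <= (16 / s) ^+ k * M.
  elim: k => [|k [IH1 IH2]]; first by split=> // w /fM; rewrite expr0 mul1r.
  split; first exact: divdiff_holo.
  have [_ _ H] := @divdiff_bound (F k) [::] z0 s _ z0 (der (F k) z0) s0
     (fun w k => cdiff_ccont (IH1 w k)) (fun w k _ => IH1 w k) IH2 z08 (derP (IH1 z0 z0s)).
  by move=> w ws; rewrite exprS -mulrA; exact: H.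
have step k w : F k z0 = 0 -> F k w = (w - z0) * F k.+1 w.
  move=> Fk; have -> : F k.+1 w = divdiff (F k) z0 (der (F k) z0) w by [].
  have [->|wz] := eqVneq w z0; first by rewrite subrr mul0r.
  by rewrite divdiffE // Fk subr0 mulrC divfK ?subr_eq0.
have fac k : (forall j, (j < k)%N -> F j z0 = 0) -> forall w, f w = (w - z0) ^+ k * F k w.
  elim: k => [_ w|k IH H w]; first by rewrite expr0 mul1r.
  rewrite IH; last by move=> j jk; apply: H; exact: leqW.
  by rewrite (step k w) ?H // mulrA exprSr.
have [allz|/existsNP nz] := pselect (forall k, F k z0 = 0); [left|right].
  exists (s / 32); first by rewrite divr_gt0.
  move=> w ws; apply/eqP; rewrite -cabs_eq0 eq_le cabs_ge0 andbT.
  have H k : cabs (f w) <= (1 / 2) ^+ k * M.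
    rewrite (fac k) => [|j _]; last exact: allz.
    rewrite cabsM cabsX.
    have ws' : cabs (w - z0) < s by lra.
    have := (FP k).2 w ws' => H.
    apply: le_trans (ler_wpM2l _ H) _; first by rewrite exprn_ge0.
    rewrite mulrA -exprMn; apply: ler_wpM2r; first by rewrite /M addr_ge0.
    have h2 : cabs (w - z0) * (16 / s) <= 1 / 2 by rewrite mulrA ler_pdivrMr //; lra.
    have s16 : 0 <= 16 / s by rewrite divr_ge0 // ltW.
    by apply: lerXn2r h2; rewrite nnegrE; [exact: mulr_ge0|lra].
  rewrite leNgt; apply/negP => f0.
  have M0 : 0 < M by rewrite /M ltr_wpDl.
  have := archi_boundP (divr_ge0 (ltW M0) (ltW f0)); set n := Num.bound _.
  rewrite ltr_pdivrMr // => Hn; have := H n.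
  rewrite expr_div_n expr1n mulrAC ler_pdivlMr ?exprn_gt0 // mul1r => H'.
  have : n%:R * cabs (f w) <= 2 ^+ n * cabs (f w).
    by rewrite ler_wpM2r // -natrX ler_nat ltnW // ltn_expl.
  lra.
have nz' : exists k, F k z0 != 0 by case: nz => k /eqP; exists k.
have [k Fk kmin] := ex_minnP nz'.
have {}fac := fac k ltac:(by move=> j; apply: contraTeq => /kmin; rewrite -leqNgt).
have [d d0 Hd] := (cdiff_ccont ((FP k).1 z0 z0s)) (cabs (F k z0)) ltac:(by rewrite cabs_gt0).
exists d => // w wz wd; rewrite fac mulf_neq0 ?expf_neq0 ?subr_eq0 //.
have := Hd w wd; have := cabs_near (F k w) (F k z0); rewrite -cabs_gt0; lra.
Qed.

(** If [f] had no zero, the maximum principle would apply to [1 / f] on the square of half-side [s].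
    On its border the linear term dominates, so [f] has modulus at least
    [s * cabs p / 2 - cabs (f z)], which exceeds [cabs (f z)]. *)
Lemma zero_near f z rho K p s : 0 < s -> 2 * s < rho -> 4 * K * s <= cabs p ->
  0 <= K -> 4 * cabs (f z) < s * cabs p -> holo_ball f z rho ->
  (forall w, cabs (w - z) < rho -> cabs (f w - f z - p * (w - z)) <= K * cabs (w - z) ^+ 2) ->
  exists2 w, cabs (w - z) <= 2 * s & f w = 0.
Proof.
move=> s0 srho Ks K0 fz hf T; apply: contrapT => nz.
have f0 w : cabs (w - z) <= 2 * s -> f w != 0.
  by move=> ws; apply/eqP => fw; apply: nz; exists w.
have z2 : cabs (z - z) <= 2 * s by rewrite subrr cabs0; lra.
have fz0 : 0 < cabs (f z) by rewrite cabs_gt0 f0.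
pose b := s * cabs p / 2 - cabs (f z).
have b0 : 0 < b by rewrite /b; lra.
have sq w : in_square (complex.Re z - s) (complex.Im z - s) (2 * s) w -> cabs (w - z) <= 2 * s.
  move=> /and4P[h1 h2 h3 h4]; apply: le_trans (cabs_le_ReIm _) _.
  have : `|complex.Re (w - z)| <= s by rewrite sub_Re ler_norml; lra.
  have : `|complex.Im (w - z)| <= s by rewrite sub_Im ler_norml; lra.
  lra.
have df w : in_square (complex.Re z - s) (complex.Im z - s) (2 * s) w -> cdiff (fun w => (f w)^-1) w.
  move=> /sq ws; have [d fd] := hf w ltac:(lra).
  by eexists; apply: cderivV fd _; exact: f0.
have := @maximum_principle R (fun w => (f w)^-1) [::] (complex.Re z - s) (complex.Im z - s)
  (2 * s) z b^-1 ltac:(lra) ltac:(by rewrite invr_ge0 ltW) (fun w k => cdiff_ccont (df w k))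
  (fun w k _ => df w k) ltac:(lra) ltac:(lra) ltac:(by []).
move=> /(_ _) H; have : cabs (f z)^-1 <= b^-1.
  apply: H => w wb; have ws : cabs (w - z) <= 2 * s by apply: sq; case/andP: wb.
  have sw : s <= cabs (w - z).
    case/andP: wb => _ /or4P[]/eqP e.
    - by apply: le_trans (Re_le_cabs _); rewrite sub_Re e ler0_norm; lra.
    - by apply: le_trans (Re_le_cabs _); rewrite sub_Re e ger0_norm; lra.
    - by apply: le_trans (Im_le_cabs _); rewrite sub_Im e ler0_norm; lra.
    - by apply: le_trans (Im_le_cabs _); rewrite sub_Im e ger0_norm; lra.
  rewrite cabsV lef_pV2 ?posrE ?cabs_gt0 ?f0 //.
  have H1 := T w ltac:(lra).
  have H2 : cabs (p * (w - z)) - cabs (f w - f z - p * (w - z)) - cabs (f z) <= cabs (f w).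
    have := cabs_near (f w - f z) (p * (w - z)); have := cabsB (f w) (f z); lra.
  rewrite cabsM in H2.
  set t := cabs (w - z) in ws sw H1 H2.
  have : K * t ^+ 2 <= (cabs p / 2) * t.
    rewrite expr2 mulrA ler_wpM2r //; first lra.
    have : K * t <= K * (2 * s) by rewrite ler_wpM2l.
    lra.
  have : s * cabs p <= t * cabs p by rewrite ler_wpM2r.
  rewrite /b; lra.
rewrite cabsV lef_pV2 ?posrE //; rewrite /b; lra.
Qed.

(* Newton's method would find a simple zero of [f] near [z] if [der f z] were
   large compared with the square root of [f z]. *)
Lemma ramified_bound f z r M : 0 < r -> 0 < M -> holo_ball f z r ->
  (forall w, cabs (w - z) < r -> cabs (f w) <= M) ->
  (forall w, cabs (w - z) < r -> f w = 0 -> der f w = 0) ->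
  cabs (der f z) ^+ 2 <= 32 * ((16 / r) ^+ 2 * M) * cabs (f z).
Proof.
move=> r0 M0 hf fM ram; set K := (16 / r) ^+ 2 * M.
have K0 : 0 < K by rewrite mulr_gt0 // exprn_gt0 // divr_gt0.
rewrite leNgt; apply/negP => H.
have p0 : 0 < cabs (der f z).
  rewrite cabs_gt0; apply/eqP => p0; move: H; rewrite p0 cabs0 expr0n /= ltNge.
  by have := mulr_ge0 (ltW K0) (cabs_ge0 (f z)); lra.
set P := cabs (der f z) in H p0.
(* The zero found within [2 * s] of [z] is simple, since there [der f] differs from its value at [z]
   by at most [2 * K * (2 * s) = P / 2]. The negated inequality [H] is exactly
   [4 * cabs (f z) < s * P]. *)
pose s := P / (8 * K).
have s0 : 0 < s by rewrite divr_gt0 // mulr_gt0.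
have sK : s * (8 * K) = P by rewrite /s divfK // gt_eqF // mulr_gt0.
have z8 : cabs (z - z) < r / 8 by rewrite subrr cabs0 divr_gt0.
have PM : P <= 16 / r * M by exact: cauchy_estimate r0 hf fM z8.
have sr : s <= r / 128.
  have K8 : 0 < 8 * K by lra.
  rewrite /s ler_pdivrMr //; apply: le_trans PM _.
  by rewrite le_eqVlt; apply/orP; left; apply/eqP; rewrite /K; field; rewrite gt_eqF.
have hf8 : holo_ball f z (r / 8).
  by apply: holo_ball_sub hf _; rewrite subrr cabs0; lra.
have [||||w wz fw] := @zero_near f z (r / 8) K (der f z) s s0 _ _ (ltW K0) _ hf8.
- lra.
- rewrite -/P -sK; have : 0 < s * K by rewrite mulr_gt0.
  lra.
- have e : s * P * (8 * K) = P ^+ 2 by rewrite mulrAC sK expr2.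
  have K8 : 0 < 8 * K by lra.
  by rewrite -/P -(ltr_pM2r K8) e; apply: le_lt_trans H; lra.
- by move=> w wr; exact: taylor_bound r0 hf fM z8 wr.
have w8 : cabs (w - z) < r / 8 by lra.
have := der_lipschitz r0 hf fM z8 w8; rewrite (ram w) ?sub0r ?cabsN //; last lra.
rewrite -/P -/K; have : K * cabs (w - z) <= K * (2 * s) by rewrite ler_wpM2l // ltW.
have : 0 < s * K by rewrite mulr_gt0.
lra.
Qed.

End Holomorphic.

(** * Functions with values in the projective line *)

Section SphereValued.
Context {R : realType}.
Local Notation C := R[i].
Local Notation S2 := (P1 R).
Implicit Types (g h : C -> S2) (z w : C) (c : C * C) (r : R).

Definition fin (q : S2) : C := if q is Some w then w else 0.

Definition inversion (q : S2) : S2 :=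
  match q with
  | Some w => if w == 0 then None else Some w^-1
  | None => Some 0
  end.

Lemma inversionK : involutive inversion.
Proof.
case=> [w|] /=; last by rewrite eqxx.
by case: eqP => [->//|/eqP w0] /=; rewrite invr_eq0 (negbTE w0) invrK.
Qed.

Definition finite_ball h z r := forall w, cabs (w - z) < r ->
  h w = Some (fin (h w)) /\ cdiff (fin \o h) w.

(** Holomorphy as a map to the sphere, the constant [None] included. *)
Definition meromorphic h := forall z,
  (exists2 r, 0 < r & finite_ball h z r) \/
  (exists2 r, 0 < r & finite_ball (inversion \o h) z r).

Lemma inversion_compK h : inversion \o (inversion \o h) = h.
Proof. by apply/funext => z /=; rewrite inversionK. Qed.

Lemma meromorphic_inversion h : meromorphic h -> meromorphic (inversion \o h).
Proof.
by move=> mh z; rewrite inversion_compK; case: (mh z) => H; [right|left].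
Qed.

Lemma finite_inversion h z r : finite_ball h z r -> fin (h z) != 0 -> 0 < r ->
  exists2 s, 0 < s & [/\ finite_ball (inversion \o h) z s, s <= r &
   forall w, cabs (w - z) < s ->
     fin (h w) != 0 /\ fin (inversion (h w)) = (fin (h w))^-1].
Proof.
move=> hf hz r0.
have [d d0 Hd] := (cdiff_ccont (hf z ltac:(by rewrite subrr cabs0)).2) (cabs (fin (h z))) ltac:(by rewrite cabs_gt0).
have nz w : cabs (w - z) < d -> fin (h w) != 0.
  by move=> /Hd /= H; rewrite -cabs_gt0; have := cabs_near (fin (h w)) (fin (h z)); lra.
have s0 : 0 < Num.min r d by rewrite lt_min r0.
have E w : cabs (w - z) < Num.min r d ->
    inversion (h w) = Some (fin (h w))^-1.
  rewrite lt_min => /andP[/hf [hw _] /nz]; rewrite hw /=.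
  by case: eqP.
exists (Num.min r d) => //; split; last 2 first.
- by rewrite ge_min lexx.
- by move=> w ws; rewrite (E w ws); split=> //; apply: nz; move: ws; rewrite lt_min => /andP[].
move=> w ws /=; rewrite (E w ws); split => //.
move: (ws); rewrite lt_min => /andP[wr wd].
have [dd Dd] := (hf w wr).2; eexists.
apply: (cderiv_eq (f := fun v => (fin (h v))^-1) (r := Num.min r d - cabs (w - z))).
- by rewrite subr_gt0.
- move=> v vw; rewrite /= E //; have := cabsBd v w z; lra.
- by apply: cderivV; [exact: Dd|exact: nz].
Qed.

Lemma meromorphic_finite h z : meromorphic h -> h z <> None ->
  exists2 r, 0 < r & finite_ball h z r.
Proof.
move=> mh hz; case: (mh z) => // -[r r0 hr].
have [|s s0 [H _ _]] := finite_inversion hr _ r0; last first.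
  by exists s; rewrite // -(inversion_compK h).
have [+ _] := hr z ltac:(by rewrite subrr cabs0); rewrite /=.
case: (h z) hz => // w _ /=; case: eqP => //= /eqP w0 _.
by rewrite invr_eq0.
Qed.

Definition sph h z : R :=
  if h z is Some w then cabs (der (fin \o h) z) / (1 + cabs w ^+ 2)
  else cabs (der (fin \o (inversion \o h)) z).

Lemma der_inv_near f1 f2 z r d : 0 < r -> cderiv f1 z d -> f1 z != 0 ->
  (forall w, cabs (w - z) < r -> f2 w = (f1 w)^-1) -> der f2 z = - d / f1 z ^+ 2 :> C.
Proof.
move=> r0 fd f0 E; apply: der_unique.
by apply: cderiv_eq r0 _ (cderivV fd f0) => w /E.
Qed.

(** The inversion is an isometry of the sphere. Together with [Phi_inversion] and
    [vanish_inversion], this lets later proofs assume a finite value. *)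
Lemma sph_inversion h z : meromorphic h -> sph (inversion \o h) z = sph h z.
Proof.
move=> mh; rewrite /sph inversion_compK /=.
case E : (h z) => [w|] /=; last by rewrite cabs0 expr0n addr0 divr1.
case: eqP => [->|/eqP w0]; first by rewrite cabs0 expr0n addr0 divr1.
have [r r0 hr] := meromorphic_finite mh (ltac:(by rewrite E) : h z <> None).
have fz : fin (h z) != 0 by rewrite E.
have [s s0 [_ _ Hs]] := finite_inversion hr fz r0.
have D := derP (hr z ltac:(by rewrite subrr cabs0)).2.
rewrite (@der_inv_near (fin \o h) _ z s _ s0 D fz); last by move=> v /Hs [].
rewrite /= E /= cabsM cabsN !cabsV cabsX.
have w1 : cabs w != 0 by rewrite cabs_eq0.
have := sqr_ge0 (cabs w) => w2.
by field; rewrite w1 gt_eqF // ltr_pwDl.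
Qed.

Lemma sph_finite_eq0 h z w : h z = Some w -> sph h z = 0 -> der (fin \o h) z = 0.
Proof.
rewrite /sph => -> /eqP; rewrite mulf_eq0 cabs_eq0 invr_eq0 => /orP[/eqP//|].
by rewrite gt_eqF // ltr_pwDl // sqr_ge0.
Qed.

Definition linear_form c (u : C) := c.1 + c.2 * u.

Definition swapc c : C * C := (c.2, c.1).

(* The linear form [c.1 * x0 + c.2 * x1] on homogeneous coordinates, evaluated at
   the lift [(1, w)] of [Some w] and at the lift [(0, 1)] of [None]. *)
Definition vanish c (q : S2) := linear_form (if q is Some w then c else swapc c) (fin q) == 0.

(** Linear independence of the two forms, that is, distinctness of their zeros on the sphere. *)
Definition nondeg c c' := c.1 * c'.2 - c.2 * c'.1 != 0.

Lemma vanish_inversion c q : vanish (swapc c) (inversion q) = vanish c q.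
Proof.
rewrite /vanish; case: c => a b; case: q => [w|] /=; rewrite /linear_form /swapc //=.
case: (eqVneq w 0) => [->|w0] //=.
have -> : b + a / w = (a + b * w) / w by field.
by rewrite mulf_eq0 invr_eq0 (negbTE w0) orbF.
Qed.

Lemma nondeg_swapc c c' : nondeg (swapc c) (swapc c') = nondeg c c'.
Proof. by rewrite /nondeg /= -oppr_eq0 opprB; congr (_ - _ != 0); rewrite mulrC. Qed.

(* In homogeneous coordinates [x0 : x1], this is the square of the Wronskian of
   (x0, x1) divided by the product of four linear forms, which does not depend
   on the lift. *)
Definition Phi h (c1 c2 c3 c4 : C * C) z : C :=
  let form c := linear_form (if h z is Some w then c else swapc c) (fin (h z)) in
  der (fin \o (if h z is Some w then h else inversion \o h)) z ^+ 2 /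
  (form c1 * form c2 * form c3 * form c4).

Lemma Phi_finite h c1 c2 c3 c4 z w : h z = Some w ->
  Phi h c1 c2 c3 c4 z = der (fin \o h) z ^+ 2 /
  (linear_form c1 w * linear_form c2 w * linear_form c3 w * linear_form c4 w).
Proof. by rewrite /Phi => ->. Qed.

Lemma linear_form_inv c w : w != 0 -> linear_form (swapc c) w^-1 = linear_form c w / w.
Proof. by move=> w0; rewrite /linear_form /=; field. Qed.

(** The squared derivative of [1 / w] brings a factor [w ^ -4], and each linear form a factor
    [1 / w]: this balance is why four forms appear. *)
Lemma Phi_inversion h c1 c2 c3 c4 z : meromorphic h ->
  Phi (inversion \o h) (swapc c1) (swapc c2) (swapc c3) (swapc c4) z = Phi h c1 c2 c3 c4 z.
Proof.
move=> mh; rewrite /Phi inversion_compK /=.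
have sK c : swapc (swapc c) = c by case: c.
case E : (h z) => [w|] //=; case: eqP => [->|/eqP w0] /=; first by rewrite !sK.
have [r r0 hr] := meromorphic_finite mh (ltac:(by rewrite E) : h z <> None).
have fz : fin (h z) != 0 by rewrite E.
have [s s0 [_ _ Hs]] := finite_inversion hr fz r0.
have D := derP (hr z ltac:(by rewrite subrr cabs0)).2.
rewrite (@der_inv_near (fin \o h) _ z s _ s0 D fz); last by move=> v /Hs [].
rewrite /= E /= !linear_form_inv //.
set d := der _ _; set p := linear_form c1 w; set q := linear_form c2 w.
set p' := linear_form c3 w; set q' := linear_form c4 w.
have -> : p / w * (q / w) * (p' / w) * (q' / w) = (p * q * p' * q') / w ^+ 4 by field.
(* If a form vanishes, both sides are [0] by the convention on inverses. *)
move: (p * q * p' * q') => X; have [->|X0] := eqVneq X 0.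
  by rewrite mul0r !invr0 !mulr0.
by field; rewrite w0 X0.
Qed.


(** For [c.2 = 0] the form is a nonzero constant and Cauchy's estimate suffices; otherwise
    [ramified_bound] applies to the form composed with [u]. The constant is chosen before [u] and
    [z]. *)
Lemma affine_ramified_bound r c : 0 < r -> (c.1 != 0) || (c.2 != 0) ->
  exists2 K : R, 0 < K & forall u z, holo_ball u z r ->
    (forall w, cabs (w - z) < r -> cabs (u w) <= 2) ->
    (forall w, cabs (w - z) < r -> linear_form c (u w) = 0 -> der u w = 0) ->
    cabs (der u z) ^+ 2 <= K * cabs (linear_form c (u z)).
Proof.
case: c => a b r0 /=; have [->|b0] := eqVneq b 0; rewrite ?orbF ?orbT.
  move=> a0; pose D := (32 / r) ^+ 2.
  have D0 : 0 < D by rewrite exprn_gt0 // divr_gt0.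
  have a00 : 0 < cabs a by rewrite cabs_gt0.
  exists (D / cabs a); first by rewrite divr_gt0.
  move=> u z hu u2 _; rewrite /linear_form /= mul0r addr0 divfK ?gt_eqF // /D.
  have z8 : cabs (z - z) < r / 8 by rewrite subrr cabs0 divr_gt0.
  have := cauchy_estimate r0 hu u2 z8 => H.
  rewrite lerXn2r ?nnegrE //; first by rewrite divr_ge0 // ltW.
  by apply: le_trans H _; rewrite mulrAC -natrM.
move=> _; have b00 : 0 < cabs b by rewrite cabs_gt0.
pose M := cabs a + 2 * cabs b.
have M0 : 0 < M by rewrite ltr_wpDl // mulr_gt0.
pose K := 32 * ((16 / r) ^+ 2 * M).
have q0 : 0 < (16 / r) ^+ 2 by rewrite exprn_gt0 // divr_gt0.
have K0 : 0 < K by have := mulr_gt0 q0 M0; rewrite /K; lra.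
exists (K / cabs b ^+ 2); first by rewrite divr_gt0 // exprn_gt0.
move=> u z hu u2 ram; pose f w := a + b * u w.
have fd w : cabs (w - z) < r -> cderiv f w (b * der u w).
  move=> wr; have := cderivD (cderiv_cst a w) (cderivM (cderiv_cst b w) (derP (hu w wr))).
  by rewrite add0r mul0r add0r.
have hf : holo_ball f z r by move=> w /fd; exists (b * der u w).
have fM w : cabs (w - z) < r -> cabs (f w) <= M.
  move=> wr; apply: le_trans (cabsD _ _) _; rewrite lerD2l cabsM mulrC.
  by rewrite ler_wpM2r // u2.
have fr w : cabs (w - z) < r -> f w = 0 -> der f w = 0.
  by move=> wr fw; rewrite (der_unique (fd w wr)) (ram w wr fw) mulr0.
have := ramified_bound r0 M0 hf fM fr.
rewrite (der_unique (fd z _)) ?subrr ?cabs0 // cabsM exprMn -/K => H.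
rewrite mulrAC ler_pdivlMr ?exprn_gt0 // mulrC; exact: H.
Qed.

(** At most one factor is below [k / 2]; it cancels against the corresponding bound on [D], and the
    other three are at least [k / 2]. *)
Lemma four_factor_bound (D K k x1 x2 x3 x4 : R) : 0 < k -> 0 < K ->
  0 <= x1 -> 0 <= x2 -> 0 <= x3 -> 0 <= x4 ->
  k <= x1 + x2 -> k <= x1 + x3 -> k <= x1 + x4 -> k <= x2 + x3 -> k <= x2 + x4 -> k <= x3 + x4 ->
  D <= K * x1 -> D <= K * x2 -> D <= K * x3 -> D <= K * x4 ->
  D / (x1 * x2 * x3 * x4) <= K * (2 / k) ^+ 3.
Proof.
move=> k0 K0.
have key (y1 y2 y3 y4 : R) : 0 <= y1 -> k / 2 <= y2 -> k / 2 <= y3 -> k / 2 <= y4 ->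
    D <= K * y1 -> D / (y1 * y2 * y3 * y4) <= K * (2 / k) ^+ 3.
  move=> p1 p2 p3 p4 DK.
  have B0 : 0 <= K * (2 / k) ^+ 3.
    by rewrite mulr_ge0 ?(ltW K0) // exprn_ge0 // divr_ge0 // ltW.
  have kk : 0 < k / 2 by rewrite divr_gt0.
  have [->|y1n] := eqVneq y1 0; first by rewrite !mul0r invr0 mulr0.
  have y1p : 0 < y1 by rewrite lt_def y1n.
  have P : (k / 2) ^+ 3 <= y2 * y3 * y4.
    have k2 := ltW kk.
    have A : k / 2 * (k / 2) <= y2 * y3 := ler_pM k2 k2 p2 p3.
    by rewrite exprSr expr2; exact: ler_pM (mulr_ge0 k2 k2) k2 A p4.
  have P0 : 0 < y2 * y3 * y4 by apply: lt_le_trans P; rewrite exprn_gt0.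
  have -> : y1 * y2 * y3 * y4 = y1 * (y2 * y3 * y4) by ring.
  rewrite ler_pdivrMr; last exact: mulr_gt0.
  apply: le_trans DK _.
  have -> : K * (2 / k) ^+ 3 * (y1 * (y2 * y3 * y4)) = K * y1 * ((2 / k) ^+ 3 * (y2 * y3 * y4)).
    by ring.
  rewrite ler_peMr ?mulr_ge0 ?(ltW K0) //.
  have E : (2 / k) ^+ 3 * (k / 2) ^+ 3 = 1 by field; rewrite gt_eqF.
  apply: (@le_trans _ _ ((2 / k) ^+ 3 * (k / 2) ^+ 3)); first by rewrite E.
  by rewrite ler_wpM2l // exprn_ge0 // divr_ge0 // ltW.
move=> h1 h2 h3 h4 h12 h13 h14 h23 h24 h34 d1 d2 d3 d4.
have [g4|l4] := ltP x4 (k / 2).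
  have -> : x1 * x2 * x3 * x4 = x4 * x1 * x2 * x3 by ring.
  by apply: key => //; lra.
have [g3|l3] := ltP x3 (k / 2).
  have -> : x1 * x2 * x3 * x4 = x3 * x1 * x2 * x4 by ring.
  by apply: key => //; lra.
have [g2|l2] := ltP x2 (k / 2).
  have -> : x1 * x2 * x3 * x4 = x2 * x1 * x3 * x4 by ring.
  by apply: key => //; lra.
exact: key.
Qed.

(** Eliminating [u] expresses the determinant as a combination of the two values, with coefficients
    [b'] and [- b]. *)
Lemma nondeg_separation c c' : nondeg c c' -> exists2 k : R, 0 < k &
  forall u, k <= cabs (linear_form c u) + cabs (linear_form c' u).
Proof.
case: c => a b; case: c' => a' b'; rewrite /nondeg /= => nd.
have m0 : 0 < cabs b + cabs b' + 1 by rewrite ltr_wpDl // addr_ge0.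
exists (cabs (a * b' - b * a') / (cabs b + cabs b' + 1)).
  by rewrite divr_gt0 // cabs_gt0.
move=> u; rewrite ler_pdivrMr // /linear_form /=.
have -> : a * b' - b * a' = (a + b * u) * b' - (a' + b' * u) * b by ring.
apply: le_trans (cabsB _ _) _; rewrite !cabsM.
have := cabs_ge0 (a + b * u); have := cabs_ge0 (a' + b' * u).
have := cabs_ge0 b; have := cabs_ge0 b'.
move: (cabs (a + b * u)) (cabs (a' + b' * u)) (cabs b) (cabs b') => x y p q q0 p0 y0 x0.
have := mulr_ge0 x0 p0; have := mulr_ge0 y0 q0; lra.
Qed.

Lemma nondeg_neq0 c c' : nondeg c c' -> (c.1 != 0) || (c.2 != 0).
Proof.
rewrite /nondeg; have [->|] := eqVneq c.1 0; have [->|] := eqVneq c.2 0; rewrite ?orbT //.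
by rewrite !mul0r subrr eqxx.
Qed.

Definition pairwise4 (c1 c2 c3 c4 : C * C) :=
  [/\ nondeg c1 c2, nondeg c1 c3 & nondeg c1 c4] /\ [/\ nondeg c2 c3, nondeg c2 c4 & nondeg c3 c4].

Definition ramified h c := forall z, vanish c (h z) -> sph h z = 0.

(** A bound above [1] makes this chart and its inversion overlap; modulus [2] corresponds to
    [height] equal to [4 / 5]. *)
Definition bounded_ball h z r := finite_ball h z r /\
  forall w, cabs (w - z) < r -> cabs (fin (h w)) <= 2.

Lemma nondegC c c' : nondeg c c' -> nondeg c' c.
Proof. by rewrite /nondeg -oppr_eq0 opprB (mulrC c'.2) (mulrC c'.1). Qed.

Lemma ramified_finite h c z r : finite_ball h z r -> ramified h c ->
  forall w, cabs (w - z) < r -> linear_form c (fin (h w)) = 0 -> der (fin \o h) w = 0.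
Proof.
move=> hf rc w /hf [hw _] cw; apply: (sph_finite_eq0 hw (rc _ _)).
by rewrite /vanish; move: hw cw; case: (h w) => //= v _ ->.
Qed.

Lemma Phi_bounded_finite r c1 c2 c3 c4 : 0 < r -> pairwise4 c1 c2 c3 c4 ->
  exists B : R, forall h z, bounded_ball h z r ->
    ramified h c1 -> ramified h c2 -> ramified h c3 -> ramified h c4 ->
    cabs (Phi h c1 c2 c3 c4 z) <= B.
Proof.
move=> r0 [[n12 n13 n14] [n23 n24 n34]].
have [K1 K10 H1] := affine_ramified_bound r0 (nondeg_neq0 n12).
have [K2 K20 H2] := affine_ramified_bound r0 (nondeg_neq0 n23).
have [K3 K30 H3] := affine_ramified_bound r0 (nondeg_neq0 n34).
have [K4 K40 H4] := affine_ramified_bound r0 (nondeg_neq0 (nondegC n34)).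
have [k12 k120 S12] := nondeg_separation n12; have [k13 k130 S13] := nondeg_separation n13.
have [k14 k140 S14] := nondeg_separation n14; have [k23 k230 S23] := nondeg_separation n23.
have [k24 k240 S24] := nondeg_separation n24; have [k34 k340 S34] := nondeg_separation n34.
pose K := K1 + K2 + K3 + K4.
pose k := Num.min (Num.min (Num.min k12 k13) (Num.min k14 k23)) (Num.min k24 k34).
have k0 : 0 < k by rewrite !lt_min k120 k130 k140 k230 k240.
have K0 : 0 < K by rewrite !addr_gt0.
have := lexx k; rewrite {2}/k !le_min => /andP[/andP[/andP[l12 l13] /andP[l14 l23]] /andP[l24 l34]].
exists (K * (2 / k) ^+ 3) => h z [hf h2] r1 r2 r3 r4.
have hh : holo_ball (fin \o h) z r by move=> w /hf [].
have z0 : cabs (z - z) < r by rewrite subrr cabs0.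
have [hz _] := hf z z0; rewrite (Phi_finite _ _ _ _ hz).
have up c K' x : K' <= K -> x <= K' * cabs (linear_form c (fin (h z))) ->
    x <= K * cabs (linear_form c (fin (h z))).
  by move=> KK Hx; apply: le_trans Hx _; rewrite ler_wpM2r.
rewrite cabsM cabsV cabsX !cabsM; apply: four_factor_bound => //.
- exact: le_trans l12 (S12 _).
- exact: le_trans l13 (S13 _).
- exact: le_trans l14 (S14 _).
- exact: le_trans l23 (S23 _).
- exact: le_trans l24 (S24 _).
- exact: le_trans l34 (S34 _).
- apply: (up _ K1); first by rewrite /K; lra.
  exact: H1 hh h2 (ramified_finite hf r1).
- apply: (up _ K2); first by rewrite /K; lra.
  exact: H2 hh h2 (ramified_finite hf r2).
- apply: (up _ K3); first by rewrite /K; lra.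
  exact: H3 hh h2 (ramified_finite hf r3).
- apply: (up _ K4); first by rewrite /K; lra.
  exact: H4 hh h2 (ramified_finite hf r4).
Qed.

Lemma linear_form_cdiff (u : C -> C) c z : cdiff u z -> cdiff (fun w => linear_form c (u w)) z.
Proof.
case=> d ud; exists (0 + (0 * u z + c.2 * d)).
by apply: cderivD; [exact: cderiv_cst|apply: cderivM => //; exact: cderiv_cst].
Qed.

Lemma cdiffM (f k : C -> C) z : cdiff f z -> cdiff k z -> cdiff (fun w => f w * k w) z.
Proof. by case=> d fd [d' kd]; eexists; apply: cderivM; [exact: fd|exact: kd]. Qed.

Lemma cdiffV (f : C -> C) z : cdiff f z -> f z != 0 -> cdiff (fun w => (f w)^-1) z.
Proof. by case=> d fd f0; eexists; apply: cderivV fd f0. Qed.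

Lemma cdiff_eq (f k : C -> C) z r : 0 < r -> (forall w, cabs (w - z) < r -> f w = k w) ->
  cdiff f z -> cdiff k z.
Proof. by move=> r0 E [d fd]; exists d; apply: cderiv_eq r0 E fd. Qed.

Definition form_product (u : C -> C) (c1 c2 c3 c4 : C * C) w :=
  linear_form c1 (u w) * linear_form c2 (u w) * linear_form c3 (u w) * linear_form c4 (u w).

Lemma form_product_cdiff u c1 c2 c3 c4 z : cdiff u z -> cdiff (form_product u c1 c2 c3 c4) z.
Proof. by move=> du; exact: (cdiffM (cdiffM (cdiffM (linear_form_cdiff _ du) (linear_form_cdiff _ du))
  (linear_form_cdiff _ du)) (linear_form_cdiff _ du)). Qed.

Lemma Phi_cdiff h c1 c2 c3 c4 z r : 0 < r -> finite_ball h z r ->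
  form_product (fin \o h) c1 c2 c3 c4 z != 0 -> cdiff (Phi h c1 c2 c3 c4) z.
Proof.
move=> r0 hf nz.
have hh : holo_ball (fin \o h) z r by move=> w /hf [].
have z0 : cabs (z - z) < r by rewrite subrr cabs0.
have dd := der_cdiff r0 hh.
apply: (cdiff_eq (f := fun w => der (fin \o h) w * der (fin \o h) w *
   (form_product (fin \o h) c1 c2 c3 c4 w)^-1) r0).
  by move=> w /hf [hw _]; rewrite (Phi_finite _ _ _ _ hw) expr2.
apply: cdiffM; first exact: cdiffM.
by apply: cdiffV => //; apply: form_product_cdiff; exact: hh.
Qed.

(** Either the product of the forms vanishes identically near [z], and then [Phi] is [0] there by
    the convention on inverses, or its zeros are isolated. *)
Lemma Phi_isolated h c1 c2 c3 c4 z : meromorphic h ->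
  exists2 r, 0 < r & forall w, w != z -> cabs (w - z) < r -> cdiff (Phi h c1 c2 c3 c4) w.
Proof.
move=> mh; wlog [r r0 hf] : h c1 c2 c3 c4 mh / exists2 r, 0 < r & finite_ball h z r.
  move=> H; case: (mh z) => h0; first exact: H.
  have [r r0 Hr] := H _ (swapc c1) (swapc c2) (swapc c3) (swapc c4) (meromorphic_inversion mh) h0.
  exists r => // w wz /(Hr w wz); apply: cdiff_eq ltr01 _ => v _.
  exact: Phi_inversion.
have hh : holo_ball (fin \o h) z r by move=> w /hf [].
have hp : holo_ball (form_product (fin \o h) c1 c2 c3 c4) z r.
  by move=> w /hh; exact: form_product_cdiff.
have [[s s0 Hs]|[s s0 Hs]] := isolated_zeros r0 hp.
  have m0 : 0 < Num.min r s by rewrite lt_min r0.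
  exists (Num.min r s) => // w wz wm.
  have t0 : 0 < Num.min r s - cabs (w - z) by rewrite subr_gt0.
  apply: (cdiff_eq (f := fun _ => 0) t0); last by exists 0; exact: cderiv_cst.
  move=> v vw; have := cabsBd v w z => tri.
  have : cabs (v - z) < Num.min r s by lra.
  rewrite lt_min => /andP[/hf [hv _] /Hs]; rewrite /form_product (Phi_finite _ _ _ _ hv) /= => ->.
  by rewrite invr0 mulr0.
exists (Num.min r s); first by rewrite lt_min r0.
move=> w wz; rewrite lt_min => /andP[wr ws].
apply: (@Phi_cdiff _ _ _ _ _ _ (r - cabs (w - z))); [by rewrite subr_gt0| |exact: Hs].
by move=> v vw; apply: hf; have := cabsBd v w z; lra.
Qed.

End SphereValued.

(** * Five totally ramified values *)

Section Ramification.
Context {R : realType}.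
Local Notation C := R[i].
Local Notation S2 := (P1 R).
Implicit Types (g h : C -> S2) (z w : C) (c : C * C) (r B : R).

Lemma eq_ccont_punctured (f k : C -> C) z r : 0 < r -> ccont f z -> ccont k z ->
  (forall w, w != z -> cabs (w - z) < r -> f w = k w) -> f z = k z.
Proof.
move=> r0 cf ck E; apply/eqP; rewrite -subr_eq0 -cabs_eq0 eq_le cabs_ge0 andbT.
apply/ler_addgt0Pl => e e0; rewrite addr0.
have e2 : 0 < e / 2 by rewrite divr_gt0.
have [s s0 Hs] := cf _ e2; have [t t0 Ht] := ck _ e2.
have m0 : 0 < Num.min r (Num.min s t) by rewrite !lt_min r0 s0.
have [w wz] := ex_near_neq z m0; rewrite !lt_min => /and3P[wr ws wt].
have := Hs w ws; have := Ht w wt; rewrite (E w wz wr).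
have := cabsBd (f z) (k w) (k z); rewrite (cabs_dist (f z) (k w)); lra.
Qed.

(** Boundedness makes [(w - z) * f w] continuous at [z] with value [0], hence holomorphic; its
    divided difference at [z] is the extension. *)
Lemma removable_patch (f : C -> C) z r B : 0 < r -> (forall w, cabs (f w) <= B) ->
  (forall w, w != z -> cabs (w - z) < r -> cdiff f w) ->
  exists F : C -> C, cdiff F z /\ forall w, w != z -> F w = f w.
Proof.
move=> r0 fB df; pose q w := (w - z) * f w.
have B0 : 0 <= B := le_trans (cabs_ge0 _) (fB z).
have dq w : w != z -> cabs (w - z) < r -> cdiff q w.
  move=> wz wr; apply: cdiffM; last exact: df.
  by exists 1; exact/cderiv_sub_cst/cderiv_id.
have cq : ccont q z.
  move=> e e0; have B1 : 0 < B + 1 by lra.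
  exists (e / (B + 1)); first by rewrite divr_gt0.
  move=> w; rewrite ltr_pdivlMr // => H; rewrite /q subrr mul0r subr0 cabsM.
  apply: le_lt_trans H; apply: ler_wpM2l => //; have := fB w; lra.
have hq : holo_ball q z r.
  move=> w wr; have [->|wz] := eqVneq w z; last exact: dq.
  exact: removable_singularity r0 cq dq.
exists (divdiff q z (der q z)); split.
  by apply: (divdiff_holo r0 hq); rewrite subrr cabs0.
move=> w wz; rewrite divdiffE // /q subrr mul0r subr0 mulrC mulKf //.
by rewrite subr_eq0.
Qed.

(* [f] may take junk values at the points where it is not differentiable. *)
Lemma liouville_isolated (f : C -> C) B : (forall z, cabs (f z) <= B) ->
  (forall z, exists2 r, 0 < r & forall w, w != z -> cabs (w - z) < r -> cdiff f w) ->
  exists k, forall z, cdiff f z -> f z = k.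
Proof.
move=> fB fi.
have pP z : exists F : C -> C, cdiff F z /\ forall w, w != z -> F w = f w.
  by have [r r0 Hr] := fi z; exact: removable_patch r0 fB Hr.
pose F z := projT1 (cid (pP z)).
have FP z : cdiff (F z) z /\ forall w, w != z -> F z w = f w by rewrite /F; case: cid.
(* Near [z], [G] agrees with the single patch [F z], because [f] is differentiable at the
   neighbouring points and [G] equals [f] there. *)
pose G z := F z z.
have Gf z : cdiff f z -> G z = f z.
  move=> df; have [dF E] := FP z.
  by apply: (eq_ccont_punctured ltr01 (cdiff_ccont dF) (cdiff_ccont df)) => w wz _; exact: E.
have GB z : cabs (G z) <= B.
  have [dF E] := FP z; apply/ler_addgt0Pl => e e0.
  have [d d0 Hd] := (cdiff_ccont dF) e e0; have [w wz wd] := ex_near_neq z d0.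
  have := Hd w wd; rewrite (E w wz) cabs_dist; have := fB w.
  have := cabsD (G z - f w) (f w); rewrite subrK -/(G z); lra.
have dG z : cdiff G z.
  have [dF E] := FP z; have [r r0 Hr] := fi z.
  apply: (cdiff_eq r0 _ dF) => w wr; have [->//|wz] := eqVneq w z.
  by rewrite (E w wz) Gf //; exact: Hr.
by exists (G 0) => z df; rewrite -(Gf z df); exact: liouville dG GB z 0.
Qed.

Definition uniform_charts g r := forall z,
  bounded_ball g z r \/ bounded_ball (inversion \o g) z r.

Lemma uniform_charts_meromorphic g r : 0 < r -> uniform_charts g r -> meromorphic g.
Proof. by move=> r0 H z; case: (H z) => -[hz _]; [left|right]; exists r. Qed.

Lemma uniform_charts_inversion g r : uniform_charts g r -> uniform_charts (inversion \o g) r.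
Proof. by move=> H z; rewrite inversion_compK; case: (H z) => ?; [right|left]. Qed.

Lemma ramified_inversion g c : meromorphic g -> ramified g c ->
  ramified (inversion \o g) (swapc c).
Proof. by move=> mg rc z /=; rewrite vanish_inversion sph_inversion //; exact: rc. Qed.

Lemma Phi_constant g r c1 c2 c3 c4 : 0 < r -> uniform_charts g r ->
  pairwise4 c1 c2 c3 c4 ->
  ramified g c1 -> ramified g c2 -> ramified g c3 -> ramified g c4 ->
  exists k, forall z, cdiff (Phi g c1 c2 c3 c4) z -> Phi g c1 c2 c3 c4 z = k.
Proof.
move=> r0 ug p r1 r2 r3 r4; have mg := uniform_charts_meromorphic r0 ug.
have [B1 H1] := Phi_bounded_finite r0 p.
have p' : pairwise4 (swapc c1) (swapc c2) (swapc c3) (swapc c4).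
  by case: p => [[? ? ?] [? ? ?]]; split; split; rewrite nondeg_swapc.
have [B2 H2] := Phi_bounded_finite r0 p'.
apply: (@liouville_isolated _ (Num.max B1 B2)) => z; last exact: Phi_isolated.
rewrite le_max; case: (ug z) => [b|b]; first by rewrite H1.
rewrite -(Phi_inversion _ _ _ _ _ mg).
by rewrite H2 ?orbT //; apply: ramified_inversion.
Qed.

Lemma ccont_near_neq0 (f : C -> C) z : ccont f z -> f z != 0 ->
  exists2 r, 0 < r & forall w, cabs (w - z) < r -> f w != 0.
Proof.
move=> cf f0; have [d d0 Hd] := cf (cabs (f z)) ltac:(by rewrite cabs_gt0).
by exists d => // w /Hd; have := cabs_near (f w) (f z); rewrite -cabs_gt0; lra.
Qed.

(** Where the spherical derivative is nonzero none of the five values is taken, so both functions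
    [Phi] are differentiable nearby, with constant values [k4] and [k5]. Dividing out the three
    common forms equates [k4] times the fourth form with [k5] times the fifth; as [u] has nonzero
    derivative, these forms are proportional. *)
Theorem five_ramified_values g r c1 c2 c3 c4 c5 : 0 < r -> uniform_charts g r ->
  pairwise4 c1 c2 c3 c4 -> pairwise4 c1 c2 c3 c5 -> nondeg c4 c5 ->
  ramified g c1 -> ramified g c2 -> ramified g c3 -> ramified g c4 -> ramified g c5 ->
  forall z, sph g z = 0.
Proof.
move=> r0 ug p4 p5 n45 r1 r2 r3 r4 r5 z; apply: contrapT => sz.
wlog gz : g c1 c2 c3 c4 c5 ug p4 p5 n45 r1 r2 r3 r4 r5 sz / g z <> None.
  move=> H; have mg := uniform_charts_meromorphic r0 ug.
  have [E|gz] := pselect (g z = None); last exact: (H g c1 c2 c3 c4 c5).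
  have ps d1 d2 d3 d4 : pairwise4 d1 d2 d3 d4 ->
      pairwise4 (swapc d1) (swapc d2) (swapc d3) (swapc d4).
    by case=> [[? ? ?] [? ? ?]]; split; split; rewrite nondeg_swapc.
  apply: (H (inversion \o g) (swapc c1) (swapc c2) (swapc c3) (swapc c4) (swapc c5)).
  - exact: uniform_charts_inversion.
  - exact: ps.
  - exact: ps.
  - by rewrite nondeg_swapc.
  - exact: ramified_inversion r1.
  - exact: ramified_inversion r2.
  - exact: ramified_inversion r3.
  - exact: ramified_inversion r4.
  - exact: ramified_inversion r5.
  - by rewrite sph_inversion.
  - by rewrite /= E.
have mg := uniform_charts_meromorphic r0 ug.
have [s s0 hs] := meromorphic_finite mg gz.
have [k4 K4] := Phi_constant r0 ug p4 r1 r2 r3 r4.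
have [k5 K5] := Phi_constant r0 ug p5 r1 r2 r3 r5.
pose u := fin \o g.
have hu : holo_ball u z s by move=> w /hs [].
have zs : cabs (z - z) < s by rewrite subrr cabs0.
have [gzE _] := hs z zs.
have du0 : der u z != 0.
  apply/eqP => d0; apply: sz; rewrite /sph gzE -/u d0 cabs0 mul0r //.
have fz c : ramified g c -> linear_form c (u z) != 0.
  move=> rc; apply/eqP => cz; move/eqP: du0; apply.
  exact: (ramified_finite hs rc zs cz).
have fprod c1' c2' c3' c4' : ramified g c1' -> ramified g c2' -> ramified g c3' ->
    ramified g c4' -> form_product u c1' c2' c3' c4' z != 0.
  by move=> *; rewrite !mulf_neq0 ?fz.
have near c1' c2' c3' c4' k : ramified g c1' -> ramified g c2' -> ramified g c3' ->
    ramified g c4' ->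
    (forall w, cdiff (Phi g c1' c2' c3' c4') w -> Phi g c1' c2' c3' c4' w = k) ->
    exists2 t, 0 < t & forall w, cabs (w - z) < t -> form_product u c1' c2' c3' c4' w != 0 /\
      der u w ^+ 2 = k * form_product u c1' c2' c3' c4' w.
  move=> h1 h2 h3 h4 K.
  have [t t0 Ht] := ccont_near_neq0
    (cdiff_ccont (form_product_cdiff c1' c2' c3' c4' (hu z zs))) (fprod _ _ _ _ h1 h2 h3 h4).
  exists (Num.min s t); first by rewrite lt_min s0.
  move=> w; rewrite lt_min => /andP[ws /Ht nz]; split=> //.
  have hw : finite_ball g w (s - cabs (w - z)).
    by move=> v vw; apply: hs; have := cabsBd v w z; lra.
  have dP := @Phi_cdiff R g c1' c2' c3' c4' w (s - cabs (w - z)) ltac:(by rewrite subr_gt0) hw nz.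
  rewrite -(K w dP) (Phi_finite _ _ _ _ (hs w ws).1) -/u.
  by rewrite divfK.
have [t4 t40 N4] := near _ _ _ _ k4 r1 r2 r3 r4 K4.
have [t5 t50 N5] := near _ _ _ _ k5 r1 r2 r3 r5 K5.
have E w : cabs (w - z) < Num.min t4 t5 ->
    k4 * linear_form c4 (u w) = k5 * linear_form c5 (u w).
  rewrite lt_min => /andP[/N4 [n4 e4] /N5 [n5 e5]].
  have e := e4; rewrite e5 /form_product in e.
  have p0 : linear_form c1 (u w) * linear_form c2 (u w) * linear_form c3 (u w) != 0.
    by move: n4; rewrite /form_product mulf_eq0 negb_or => /andP[].
  by apply: (mulfI p0); rewrite mulrCA [RHS]mulrCA -e.
have t0 : 0 < Num.min t4 t5 by rewrite lt_min t40.
have zt : cabs (z - z) < Num.min t4 t5 by rewrite subrr cabs0.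
have Du := derP (hu z zs).
have D (k : C) c : cderiv (fun w => k * linear_form c (u w)) z (k * (c.2 * der u z)).
  have := cderivM (cderiv_cst k z)
    (cderivD (cderiv_cst c.1 z) (cderivM (cderiv_cst c.2 z) Du)).
  by rewrite !mul0r !add0r.
have E2 : k4 * (c4.2 * der u z) = k5 * (c5.2 * der u z).
  by apply: cderiv_unique (D k5 c5); apply: cderiv_eq t0 E (D k4 c4).
have {}E2 : k4 * c4.2 = k5 * c5.2 by apply: (mulIf du0); rewrite -!mulrA.
have E1 : k4 * c4.1 = k5 * c5.1.
  have := E z zt; rewrite /linear_form !mulrDr !mulrA E2.
  by move/addIr.
have k40 : k4 != 0.
  have [_ e] := N4 z ltac:(by rewrite subrr cabs0).
  by apply/eqP => k0; move/eqP: e; rewrite k0 mul0r expf_eq0 (negbTE du0).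
have : k4 * (c4.1 * c5.2 - c4.2 * c5.1) = 0.
  have -> : k4 * (c4.1 * c5.2 - c4.2 * c5.1) = (k4 * c4.1) * c5.2 - (k4 * c4.2) * c5.1 by ring.
  by rewrite E1 E2; ring.
by move/eqP; rewrite mulf_eq0 (negbTE k40) (negbTE n45).
Qed.

End Ramification.

(** * Zalcman's rescaling *)

Section Rescaling.
Context {R : realType}.
Local Notation C := R[i].
Local Notation S2 := (P1 R).
Implicit Types (g h : C -> S2) (z w : C) (c : C * C) (r B : R).

(* The square of the chordal distance to [Some 0]: it is exchanged with
   [1 - height] by the inversion and is Lipschitz with respect to the spherical
   derivative, which yields charts on discs of a fixed radius. *)
Definition height (q : S2) : R :=
  if q is Some w then cabs w ^+ 2 / (1 + cabs w ^+ 2) else 1.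

Lemma height_inversion q : height (inversion q) = 1 - height q.
Proof.
case: q => [w|] /=; last by rewrite cabs0 expr0n mul0r subrr.
have p0 : 1 + cabs w ^+ 2 != 0 by rewrite gt_eqF // ltr_pwDl // sqr_ge0.
case: eqP => [->|/eqP w0] /=; first by rewrite cabs0 expr0n /= mul0r subr0.
have c0 : cabs w != 0 by rewrite cabs_eq0.
by rewrite cabsV; field; rewrite ?c0 ?p0 // addrC p0.
Qed.

(** Only the denominator at the base point [w] survives, as in [sph]: the factor [p + q] is absorbed
    by [2 * (1 + p ^ 2)], because [q <= p + 1]. *)
Lemma height_Some_lipschitz (v w : C) : cabs (v - w) <= 1 ->
  `|height (Some v) - height (Some w)| <= 2 * cabs (v - w) / (1 + cabs w ^+ 2).
Proof.
move=> vw /=; set p := cabs v; set q := cabs w.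
have p0 : 0 <= p := cabs_ge0 _. have q0 : 0 <= q := cabs_ge0 _.
have P : 0 < 1 + p ^+ 2 by rewrite ltr_pwDl // sqr_ge0.
have Q : 0 < 1 + q ^+ 2 by rewrite ltr_pwDl // sqr_ge0.
have -> : p ^+ 2 / (1 + p ^+ 2) - q ^+ 2 / (1 + q ^+ 2) =
  (p - q) * ((p + q) / (1 + p ^+ 2)) / (1 + q ^+ 2).
  by field; rewrite !gt_eqF.
have pq : `|p - q| <= cabs (v - w).
  rewrite ler_norml; have := cabs_lbB v w; have := cabs_lbB w v.
  rewrite (cabs_dist w) -/p -/q; lra.
rewrite normrM (@gtr0_norm _ (1 + q ^+ 2)^-1) ?invr_gt0 // normrM.
apply: ler_wpM2r; first by rewrite invr_ge0 ltW.
rewrite mulrC; apply: ler_pM => //.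
have X0 : 0 <= (p + q) / (1 + p ^+ 2) := divr_ge0 (addr_ge0 p0 q0) (ltW P).
rewrite (ger0_norm X0) ler_pdivrMr //.
have := sqr_ge0 (p - 1); rewrite sqrrB mulr1 expr1n.
have := sqr_ge0 p; have := le_trans pq vw; rewrite ler_norml; lra.
Qed.

Lemma height_near g z (e : R) : meromorphic g -> 0 < e ->
  exists2 r, 0 < r & forall w, cabs (w - z) < r ->
    `|height (g w) - height (g z)| <= 2 * (sph g z + e) * cabs (w - z).
Proof.
move=> mg e0; wlog gz : g mg / g z <> None.
  move=> H; have [E|] := pselect (g z = None); last exact: H.
  have [|r r0 Hr] := H (inversion \o g) (meromorphic_inversion mg).
    by rewrite /= E.
  exists r => // w /Hr; rewrite sph_inversion // /= !height_inversion.
  by rewrite (_ : _ - _ = height (g z) - height (g w)) ?(distrC (height (g z))) //; ring.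
have [r r0 hr] := meromorphic_finite mg gz.
have [gzE dz] := hr z ltac:(by rewrite subrr cabs0).
have D := derP dz; have [s s0 Hs] := D e e0.
have [t t0 Ht] := (cdiff_ccont dz) 1 ltr01.
exists (Num.min r (Num.min s t)); first by rewrite !lt_min r0 s0.
move=> w; rewrite !lt_min => /and3P[wr ws wt].
have [gwE _] := hr w wr; rewrite gwE gzE.
apply: le_trans (height_Some_lipschitz (ltW (Ht w wt))) _.
set Q := 1 + _; have Q0 : 0 < Q by rewrite ltr_pwDl // sqr_ge0.
rewrite /sph gzE -/Q ler_pdivrMr //.
have := Hs w ws; rewrite /=.
set d := der _ z; set x := fin (g w) - fin (g z); set y := cabs (w - z) => H.
have xd : cabs x <= e * y + cabs d * y.
  have -> : x = (x - d * (w - z)) + d * (w - z) by rewrite subrK.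
  by apply: le_trans (cabsD _ _) _; rewrite cabsM lerD.
have -> : 2 * (cabs d / Q + e) * y * Q = 2 * (cabs d * y) + 2 * (e * y) * Q.
  by field; rewrite gt_eqF.
have : e * y * 1 <= e * y * Q.
  by rewrite ler_wpM2l ?mulr_ge0 ?(ltW e0) ?cabs_ge0 // lerDl sqr_ge0.
lra.
Qed.

(** The constant [9] is [2 * (4 + 1 / 2)]: the infinitesimal estimate [height_near] is summed along
    the segment by bisection. *)
Lemma height_lipschitz g z r w : meromorphic g ->
  (forall w, cabs (w - z) < r -> sph g w <= 4) -> cabs (w - z) < r ->
  `|height (g w) - height (g z)| <= 9 * cabs (w - z).
Proof.
move=> mg sg wr; pose ga (t : R) := z + t%:C%C * (w - z).
have ga0 : ga 0 = z by rewrite /ga mul0r addr0.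
have ga1 : ga 1 = w by rewrite /ga mul1r subrKC.
have gaB s t : ga s - ga t = (s - t)%:C%C * (w - z) by rewrite /ga rmorphB; ring.
pose P (a b : R) := `|height (g (ga b)) - height (g (ga a))| <= 9 * cabs (w - z) * (b - a).
suff : P 0 1 by rewrite /P ga0 ga1 subr0 mulr1.
apply: (@bisection1 R P 0 1 ltr01).
  move=> a b ab; rewrite /P.
  have := ler_distD (height (g (ga ((a + b) / 2)))) (height (g (ga b))) (height (g (ga a))).
  lra.
move=> t t01.
have gtr : cabs (ga t - z) < r.
  rewrite -[z in cabs (_ - z)]ga0 gaB subr0 cabsM cabs_real; apply: le_lt_trans wr.
  by rewrite ler_piMl // ger0_norm; lra.
have e0 : 0 < 1 / 2 :> R by rewrite divr_gt0.
have [d d0 Hd] := height_near (ga t) mg e0.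
have D0 : 0 < cabs (w - z) + 1 by rewrite ltr_wpDl.
exists (d / (cabs (w - z) + 1)); first by rewrite divr_gt0.
move=> a b ab; rewrite ltr_pdivlMr // => bad /andP[at_ tb] _ _; rewrite /P.
have one s : `|s - t| <= b - a ->
    `|height (g (ga s)) - height (g (ga t))| <= 9 * (`|s - t| * cabs (w - z)).
  move=> st; have := Hd (ga s); rewrite gaB cabsM cabs_real => H.
  apply: le_trans (H _) _.
    apply: le_lt_trans bad; rewrite mulrDr mulr1.
    have : `|s - t| * cabs (w - z) <= (b - a) * cabs (w - z) by rewrite ler_wpM2r.
    lra.
  apply: ler_wpM2r; first by rewrite mulr_ge0.
  have := sg _ gtr; lra.
have := ler_distD (height (g (ga t))) (height (g (ga b))) (height (g (ga a))).
have := one b; have := one a; rewrite (distrC (height (g (ga t)))).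
rewrite (@ger0_norm _ (b - t)) ?subr_ge0 // (@ler0_norm _ (a - t)) ?subr_le0 //.
move=> h1 h2; have {}h1 := h1 ltac:(lra); have {}h2 := h2 ltac:(lra).
lra.
Qed.

(** Starting from height at most [1 / 2], the height stays below [1 / 2 + 9 / 40 < 4 / 5], that is,
    the modulus stays below [2]. A larger initial height is brought below [1 / 2] by the
    inversion. *)
Lemma bounded_chart g z : meromorphic g ->
  (forall w, cabs (w - z) < 1 / 40 -> sph g w <= 4) ->
  bounded_ball g z (1 / 40) \/ bounded_ball (inversion \o g) z (1 / 40).
Proof.
move=> mg sg.
suff main h : meromorphic h -> (forall w, cabs (w - z) < 1 / 40 -> sph h w <= 4) ->
    height (h z) <= 1 / 2 -> bounded_ball h z (1 / 40).
  have [le|gt] := leP (height (g z)) (1 / 2); [left|right]; apply: main => //.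
  - exact: meromorphic_inversion.
  - by move=> w wr; rewrite sph_inversion // sg.
  - by rewrite /= height_inversion; lra.
move=> mh sh hz.
have hw w : cabs (w - z) < 1 / 40 -> height (h w) <= 4 / 5.
  move=> wr; have := height_lipschitz mh sh wr; rewrite ler_norml; lra.
have fw w : cabs (w - z) < 1 / 40 -> h w <> None.
  by move=> /hw + E; rewrite E /=; lra.
split=> w wr.
  have [r r0 hr] := meromorphic_finite mh (fw w wr).
  by apply: hr; rewrite subrr cabs0.
have := hw w wr; have := fw w wr; case: (h w) => //= v _.
have P : 0 < 1 + cabs v ^+ 2 by rewrite ltr_pwDl // sqr_ge0.
rewrite ler_pdivrMr // => H; rewrite leNgt; apply/negP => v2.
have : 0 < (cabs v - 2) * (cabs v + 2) by rewrite mulr_gt0 //; have := cabs_ge0 v; lra.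
lra.
Qed.

Lemma sph_ge0 h z : 0 <= sph h z.
Proof.
rewrite /sph; case: (h z) => [w|]; last exact: cabs_ge0.
by rewrite divr_ge0 // addr_ge0 // sqr_ge0.
Qed.

Lemma sph_locally_bounded h z : meromorphic h ->
  exists2 r, 0 < r & exists B, forall w, cabs (w - z) < r -> sph h w <= B.
Proof.
move=> mh; wlog hz : h mh / h z <> None.
  move=> H; have [E|] := pselect (h z = None); last exact: H.
  have [|r r0 [B HB]] := H (inversion \o h) (meromorphic_inversion mh).
    by rewrite /= E.
  by exists r => //; exists B => w /HB; rewrite sph_inversion.
have [r r0 hr] := meromorphic_finite mh hz.
have hh : holo_ball (fin \o h) z r by move=> w /hr [].
have [s s0 Hs] := locally_bounded (cdiff_ccont (der_cdiff r0 hh)).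
exists (Num.min r s); first by rewrite lt_min r0.
eexists => w; rewrite lt_min => /andP[/hr [hw _] /Hs]; apply: le_trans.
rewrite /sph hw ler_pdivrMr ?ltr_pwDl ?sqr_ge0 //.
by rewrite ler_peMr // lerDl sqr_ge0.
Qed.

Lemma sph_bounded h : meromorphic h -> exists B, forall z, cabs z <= 1 -> sph h z <= B.
Proof.
move=> mh; pose P (a c l : R) := exists B, forall z, in_square a c l z -> sph h z <= B.
have [B HB] : P (-1) (-1) 2.
  apply: (@bisection2 R P) => //.
    move=> a c l l0 [B1 H1] [B2 H2] [B3 H3] [B4 H4].
    exists (Num.max (Num.max B1 B2) (Num.max B3 B4)) => -[x y].
    rewrite in_squareE => /andP[xa yc]; rewrite !le_max.
    have [x1|x1] := leP x (a + l / 2); have [y1|y1] := leP y (c + l / 2).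
    - by rewrite H1 // in_squareE; lra.
    - by rewrite H3 ?orbT // in_squareE; lra.
    - by rewrite H2 ?orbT // in_squareE; lra.
    - by rewrite H4 ?orbT // in_squareE; lra.
  move=> x y _ _; have [r r0 [B HB]] := sph_locally_bounded (x +i* y)%C mh.
  exists (r / 2); first by rewrite divr_gt0.
  move=> a c l l0 lr xa yc _ _ _ _; exists B => z zs; apply: HB.
  have := @in_square_dist R a c l z (x +i* y)%C zs; rewrite in_squareE xa yc => /(_ isT); lra.
exists B => -[x y] z1; apply: HB; rewrite in_squareE.
have := le_trans (Re_le_cabs _) z1; have := le_trans (Im_le_cabs _) z1.
rewrite /= !ler_norml; lra.
Qed.

(* Zalcman's rescaling: [z0] nearly maximizes [(1 - cabs z) * sph h z]. *)
Lemma rescaling h (S : R) : meromorphic h -> 0 < S -> S < sph h 0 ->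
  exists z0 (rho : R), [/\ 0 < rho, rho <= 2 / S, rho * sph h z0 = 1 &
    forall z, cabs (z - z0) <= rho * (S / 4) ->
      cabs z <= 1 /\ rho * sph h z <= 4].
Proof.
move=> mh S0 Sh; have [B HB] := sph_bounded mh.
pose v z := (1 - cabs z) * sph h z.
pose V := [set v z | z in [set z | cabs z <= 1]].
have z01 : cabs (0 : C) <= 1 by rewrite cabs0.
have V0 : V (v 0) by exists 0.
have v0 : v 0 = sph h 0 by rewrite /v cabs0 subr0 mul1r.
have ubV : has_ubound V.
  exists B => _ [z /= z1 <-]; apply: le_trans (HB z z1).
  by rewrite ler_piMl ?sph_ge0 // gerBl.
have supS : S < sup V by apply: lt_le_trans Sh _; rewrite -v0; apply: ub_le_sup.
(* Taking a point above half of the supremum avoids proving that it is attained, at the cost of one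
   factor [2] in the final bound [4]. *)
have [_ [z0 /= z1 <-] vz] : exists2 x, V x & sup V / 2 < x.
  have hV : has_sup V by split; [exists (v 0)|].
  have sV : 0 < sup V / 2 by lra.
  have [x Vx Hx] := sup_adherent sV hV.
  by exists x => //; lra.
have vS : S / 2 < v z0 by lra.
have vle z : cabs z <= 1 -> v z <= 2 * v z0.
  by move=> zz; have : v z <= sup V; [apply: ub_le_sup => //; exists z|lra].
have d0 : 0 < 1 - cabs z0.
  rewrite lt_def subr_ge0 z1 andbT; apply/eqP => d0; move: vS; rewrite /v d0 mul0r; lra.
have s0 : 0 < sph h z0.
  rewrite lt_def sph_ge0 andbT; apply/eqP => s0; move: vS; rewrite /v s0 mulr0; lra.
exists z0, (sph h z0)^-1; split.
- by rewrite invr_gt0.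
- have : S / 2 < sph h z0.
    apply: lt_le_trans vS _; rewrite /v ler_piMl ?(ltW s0) // gerBl //.
  move=> H; have -> : 2 / S = (S / 2)^-1 by field; rewrite gt_eqF.
  by rewrite lef_pV2 ?posrE // ?divr_gt0 // ltW.
- by rewrite mulVf // gt_eqF.
(* As [v z0 > S / 2], the radius is at most half of [1 - cabs z0]; on this disc the factor
   [1 - cabs z] loses at most a second factor [2]. *)
move=> z zz; have hd : cabs (z - z0) <= (1 - cabs z0) / 2.
  apply: le_trans zz _; rewrite mulrC ler_pdivrMr //.
  by move: vS; rewrite /v; lra.
have zn : cabs z <= cabs (z - z0) + cabs z0.
  by have := cabsD (z - z0) z0; rewrite subrK.
have zle : cabs z <= 1 by lra.
split => //; rewrite mulrC ler_pdivrMr //.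
have := vle z zle; rewrite /v => H.
have : (1 - cabs z0) / 2 * sph h z <= (1 - cabs z) * sph h z.
  by apply: ler_wpM2r; [exact: sph_ge0|lra].
move=> H2; rewrite -(ler_pM2l d0); lra.
Qed.

End Rescaling.

(** * Limits along an ultrafilter *)

Section Ultralimit.
Context {R : realType}.
Local Notation C := R[i].
Local Notation S2 := (P1 R).
Context (U : set_system nat) {UF : UltraFilter U}.
Implicit Types (x y : nat -> C) (l k : C) (h : nat -> C -> S2) (z w : C) (c : C * C) (r B e : R).

Definition ulim x l := forall e, 0 < e -> U [set n | cabs (x n - l) < e].

Lemma ulimD x y l k : ulim x l -> ulim y k -> ulim (fun n => x n + y n) (l + k).
Proof.
move=> xl yk e e0; have e2 : 0 < e / 2 by rewrite divr_gt0.
apply: filterS (filterI (xl _ e2) (yk _ e2)) => n [/= h1 h2].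
have -> : x n + y n - (l + k) = (x n - l) + (y n - k) by ring.
by have := cabsD (x n - l) (y n - k); lra.
Qed.

Lemma ulimZ x l a : ulim x l -> ulim (fun n => a * x n) (a * l).
Proof.
move=> xl e e0; have a0 : 0 < cabs a + 1 by rewrite ltr_wpDl.
apply: filterS (xl _ (divr_gt0 e0 a0)) => n /= h.
rewrite -mulrBr cabsM; rewrite ltr_pdivlMr // mulrC in h.
by apply: le_lt_trans h; rewrite ler_wpM2r // lerDl.
Qed.

Lemma ulim_cst a : ulim (fun=> a) a.
Proof. by move=> e e0; apply: filterS filterT => n _ /=; rewrite subrr cabs0. Qed.

Lemma ulim_le x l B : ulim x l -> U [set n | cabs (x n) <= B] -> cabs l <= B.
Proof.
move=> xl xB; apply/ler_addgt0Pl => e e0.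
have [n [/= h1 h2]] := filter_ex (filterI (xl e e0) xB).
by have := cabs_near (x n) l; have := cabsBd l (x n) 0; rewrite !subr0 (cabs_dist l (x n)); lra.
Qed.

Lemma ulim_ge x l B : ulim x l -> U [set n | B <= cabs (x n)] -> B <= cabs l.
Proof.
move=> xl xB; apply/ler_addgt0Pl => e e0.
have [n [/= h1 h2]] := filter_ex (filterI (xl e e0) xB).
by have := cabsD (x n - l) l; rewrite subrK; lra.
Qed.

Lemma ulim_unique x l k : ulim x l -> ulim x k -> l = k.
Proof.
move=> xl xk; apply/eqP; rewrite -subr_eq0 -cabs_eq0 eq_le cabs_ge0 andbT.
apply: (@ulim_le (fun n => x n + -1 * x n)).
  by have := ulimD xl (ulimZ (-1) xk); rewrite mulN1r.
by apply: filterS filterT => n _ /=; rewrite mulN1r subrr cabs0.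
Qed.

Lemma ulim_eq x y l : U [set n | x n = y n] -> ulim x l -> ulim y l.
Proof. by move=> xy xl e e0; apply: filterS (filterI xy (xl e e0)) => n [/= <-]. Qed.

Lemma ulimV x l (b : R) : 0 < b -> ulim x l -> U [set n | b <= cabs (x n)] ->
  ulim (fun n => (x n)^-1) l^-1.
Proof.
move=> b0 xl xb e e0; have lb := ulim_ge xl xb.
have l0 : l != 0 by rewrite -cabs_gt0; lra.
have d0 : 0 < e * b * b by rewrite !mulr_gt0.
apply: filterS (filterI (xl _ d0) xb) => n [/= h1 h2].
have x0 : x n != 0 by rewrite -cabs_gt0; lra.
have -> : (x n)^-1 - l^-1 = - (x n - l) / (x n * l) by field; rewrite x0 l0.
rewrite cabsM cabsN cabsV ltr_pdivrMr ?cabs_gt0 ?mulf_neq0 //.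
apply: lt_le_trans h1 _; rewrite -mulrA cabsM ler_wpM2l ?(ltW e0) //.
by apply: ler_pM => //; exact: ltW.
Qed.

(** The limit is the supremum of the [t] lying below [x n] for almost all [n]; the ultrafilter
    decides each comparison. *)
Lemma real_ulim_exists (x : nat -> R) B : U [set n | `|x n| <= B] ->
  exists l : R, forall e, 0 < e -> U [set n | `|x n - l| < e].
Proof.
move=> xB; pose V := [set t : R | U [set n | t <= x n]].
have VB t : V t -> t <= B.
  move=> Vt; have [n [/= h1 h2]] := filter_ex (filterI Vt xB).
  by have := ler_norm (x n); lra.
have V0 : V (- B).
  by apply: filterS xB => n /=; rewrite ler_norml => /andP[].
have hV : has_sup V by split; [exists (- B)|exists B => t /VB].
exists (sup V) => e e0.
have [t Vt te] := sup_adherent e0 hV.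
have [Hu|Hu] := in_ultra_setVsetC [set n | sup V + e <= x n] UF.
  by have : sup V + e <= sup V; [apply: ub_le_sup => //; exists B => s /VB|lra].
apply: filterS (filterI Hu Vt) => n [/= /negP]; rewrite -ltNge ltr_norml; lra.
Qed.

Lemma ulim_exists x B : U [set n | cabs (x n) <= B] -> exists l, ulim x l.
Proof.
move=> xB.
have [a Ha] : exists l : R, forall e, 0 < e -> U [set n | `|complex.Re (x n) - l| < e].
  apply: (@real_ulim_exists _ B); apply: filterS xB => n /=.
  exact: le_trans (Re_le_cabs _).
have [b Hb] : exists l : R, forall e, 0 < e -> U [set n | `|complex.Im (x n) - l| < e].
  apply: (@real_ulim_exists _ B); apply: filterS xB => n /=.
  exact: le_trans (Im_le_cabs _).
exists (a +i* b)%C => e e0; have e2 : 0 < e / 2 by rewrite divr_gt0.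
apply: filterS (filterI (Ha _ e2) (Hb _ e2)) => n [/= h1 h2].
apply: le_lt_trans (cabs_le_ReIm _) _; rewrite sub_Re sub_Im /=; lra.
Qed.

Definition ulim_of x : C := xget 0 [set l | ulim x l].

Lemma ulim_ofE x l : ulim x l -> ulim_of x = l.
Proof.
move=> xl; rewrite /ulim_of; case: xgetP => [k _ xk|/(_ l)//].
exact: ulim_unique xk xl.
Qed.

Definition finite2 (q : S2) : Prop := q = Some (fin q) /\ cabs (fin q) <= 2.

(** The value is meaningful when one of the two charts is bounded by [2] for almost all [n]. *)
Definition sphere_ulim (q : nat -> S2) : S2 :=
  if `[< U [set n | finite2 (q n)] >] then Some (ulim_of (fin \o q))
  else inversion (Some (ulim_of (fin \o (inversion \o q)))).

Lemma sphere_ulim_finite (q : nat -> S2) : U [set n | finite2 (q n)] ->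
  exists2 l, ulim (fin \o q) l & sphere_ulim q = Some l.
Proof.
move=> Uq; have [l Hl] : exists l, ulim (fin \o q) l.
  by apply: (@ulim_exists _ 2); apply: filterS Uq => n [].
by exists l => //; rewrite /sphere_ulim; case: asboolP => // _; rewrite (ulim_ofE Hl).
Qed.

(** If both charts are bounded, [sphere_ulim] uses the other one; the coordinates then have modulus
    at least [1 / 2], so taking inverses commutes with the limit. *)
Lemma sphere_ulim_infinite (q : nat -> S2) : U [set n | finite2 (inversion (q n))] ->
  exists2 l, ulim (fin \o (inversion \o q)) l & inversion (sphere_ulim q) = Some l.
Proof.
move=> Uq; have [l Hl] : exists l, ulim (fin \o (inversion \o q)) l.
  by apply: (@ulim_exists _ 2); apply: filterS Uq => n [].
exists l => //; rewrite /sphere_ulim; case: asboolP => [Uf|_]; last first.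
  by rewrite inversionK (ulim_ofE Hl).
have half : U [set n | 1 / 2 <= cabs (fin (inversion (q n)))].
  apply: filterS (filterI Uf Uq) => n [/= [h1 +] [h2 _]]; move: h1 h2.
  case: (q n) => //= v _; case: eqP => //= /eqP v0 _ v2; rewrite cabsV.
  by rewrite ler_pdivrMr // -ler_pdivrMl ?invr_gt0 ?cabs_gt0 // invrK mulr1.
have lV : ulim (fin \o q) l^-1.
  apply: ulim_eq (ulimV _ Hl half); last by rewrite divr_gt0.
  apply: filterS (filterI Uf Uq) => n [/= [h1 _] [h2 _]]; move: h1 h2.
  by case: (q n) => //= v _; case: eqP => //= _ _; rewrite invrK.
have lh := ulim_ge Hl half.
have l0 : l != 0 by rewrite -cabs_gt0; lra.
by rewrite (ulim_ofE lV) /= invr_eq0 (negbTE l0) invrK.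
Qed.

Lemma bounded_ball_finite2 (g : C -> S2) z r w : bounded_ball g z r -> cabs (w - z) < r ->
  finite2 (g w).
Proof. by case=> gf g2 wr; split; [exact: (gf w wr).1|exact: g2]. Qed.

Lemma ulim_bounded_ball h (k : C -> S2) z r : 0 < r ->
  U [set n | bounded_ball (h n) z r] ->
  (forall w, cabs (w - z) < r -> exists2 l, ulim (fun n => fin (h n w)) l & k w = Some l) ->
  bounded_ball k z (r / 8) /\ ulim (fun n => der (fin \o h n) z) (der (fin \o k) z).
Proof.
move=> r0 Uh hk.
have kl w : cabs (w - z) < r -> ulim (fun n => fin (h n w)) (fin (k w)) /\ k w = Some (fin (k w)).
  by move=> /hk [l Hl ->].
have dk w : cabs (w - z) < r / 8 -> exists2 D, ulim (fun n => der (fin \o h n) w) D &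
    cderiv (fin \o k) w D.
  move=> wr; have [D HD] : exists D, ulim (fun n => der (fin \o h n) w) D.
    apply: (@ulim_exists _ (16 / r * 2)); apply: filterS Uh => n [/= hf h2].
    by apply: cauchy_estimate r0 _ h2 wr => v /hf [].
  exists D => // e e0; pose K := (16 / r) ^+ 2 * 2.
  have K0 : 0 <= K by rewrite mulr_ge0 // sqr_ge0.
  have K1 : 0 < K + 1 by lra.
  exists (Num.min (r / 8 - cabs (w - z)) (e / (K + 1))).
    by rewrite lt_min subr_gt0 wr divr_gt0.
  move=> v; rewrite lt_min => /andP[vr]; rewrite ltr_pdivlMr // => ve.
  have vr8 : cabs (v - z) < r / 8 by have := cabsBd v w z; lra.
  have [lv _] := kl v ltac:(lra); have [lw _] := kl w ltac:(lra).
  have : cabs (fin (k v) + -1 * fin (k w) + - (v - w) * D) <= K * cabs (v - w) ^+ 2.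
    apply: ulim_le (ulimD (ulimD lv (ulimZ (-1) lw)) (ulimZ (- (v - w)) HD)) _.
    apply: filterS Uh => n [/= hf h2].
    have hh : holo_ball (fin \o h n) z r by move=> u /hf [].
    have := taylor_bound r0 hh h2 wr vr8; rewrite /=; congr (is_true (cabs _ <= _)); ring.
  have -> : fin (k v) + -1 * fin (k w) + - (v - w) * D = fin (k v) - fin (k w) - D * (v - w) by ring.
  move=> /le_trans; apply; rewrite expr2 mulrA ler_wpM2r //.
  have : 0 <= cabs (v - w) by [].
  lra.
split; last first.
  have [D HD kD] := dk z ltac:(by rewrite subrr cabs0 divr_gt0).
  by rewrite (der_unique kD).
split=> w wr.
  have [D _ kD] := dk w wr; have [_ kw] := kl w ltac:(lra).
  by split=> //; exists D.
have [lw _] := kl w ltac:(lra).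
by apply: ulim_le lw _; apply: filterS Uh => n [/= _ h2]; apply: h2; lra.
Qed.

(** A quantitative Hurwitz theorem: if the derivative [D] of the limit were nonzero at [z],
    [zero_near] would give, for some [n], a nearby point where [h n] takes the value with derivative
    at least [cabs D / 4], against the smallness of its spherical derivative. *)
Lemma ulim_ramified h (k : C -> S2) z r c : 0 < r -> (c.1 != 0) || (c.2 != 0) ->
  U [set n | bounded_ball (h n) z r] ->
  (forall w, cabs (w - z) < r -> exists2 l, ulim (fun n => fin (h n w)) l & k w = Some l) ->
  (forall e, 0 < e -> U [set n | forall w, cabs (w - z) < 1 -> vanish c (h n w) -> sph (h n) w <= e]) ->
  vanish c (k z) -> sph k z = 0.
Proof.
move=> r0 c0 Uh hk Ur kz; have [_ Hd] := ulim_bounded_ball r0 Uh hk.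
have [l Hl kzl] := hk z ltac:(by rewrite subrr cabs0).
set D := der (fin \o k) z in Hd.
suff D0 : D = 0 by rewrite /sph kzl -/D D0 cabs0 mul0r.
move: kz; rewrite kzl /vanish /= => /eqP cl.
(* [k z] is finite, so the form is not the one vanishing only at infinity. *)
have b0 : c.2 != 0.
  apply/eqP => b0; move: c0 cl; rewrite /linear_form b0 mul0r addr0 eqxx orbF.
  by move=> /eqP + ?.
apply/eqP; rewrite -cabs_eq0; apply/negPn/negP => Dn.
have {}Dn : 0 < cabs D by rewrite lt_def Dn cabs_ge0.
have bp : 0 < cabs c.2 by rewrite cabs_gt0.
pose K := (16 / r) ^+ 2 * 2.
have K0 : 0 < K by rewrite mulr_gt0 // exprn_gt0 // divr_gt0.
(* Over a distance [2 * s] the derivative varies by at most [4 * K * s <= cabs D / 4]; the other two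
   bounds keep the zero where the Taylor bound and the hypothesis on [sph] hold. *)
pose s := Num.min (cabs D / (16 * K)) (Num.min (r / 32) (1 / 4)).
have s0 : 0 < s by rewrite !lt_min !divr_gt0 // mulr_gt0.
have := lexx s; rewrite {2}/s !le_min => /and3P[sD sr s1].
have {}sD : 16 * (K * s) <= cabs D.
  have K16 : 0 < 16 * K by lra.
  by move: sD; rewrite ler_pdivlMr // mulrCA (mulrC s).
have Hl' := ulimZ c.2 Hl.
have f0 : U [set n | cabs (linear_form c (fin (h n z))) < s * (cabs c.2 * cabs D) / 16].
  have := ulimD (ulim_cst c.1) Hl'; rewrite -/(linear_form c l) cl => H.
  have e0 : 0 < s * (cabs c.2 * cabs D) / 16 by rewrite divr_gt0 // !mulr_gt0.
  by apply: filterS (H _ e0) => n /=; rewrite subr0.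
have f1 : U [set n | cabs D / 2 < cabs (der (fin \o h n) z)].
  have e0 : 0 < cabs D / 2 by rewrite divr_gt0.
  apply: filterS (Hd _ e0) => n /=; have := cabs_near (der (fin \o h n) z) D; lra.
(* Since [1 + 2 ^ 2 = 5], a spherical derivative at most [cabs D / 40] means a derivative at most
   [cabs D / 8]. *)
have e0 : 0 < cabs D / 40 by rewrite divr_gt0.
have [n [/= [[hb Hr] H0] H1]] := filter_ex (filterI (filterI (filterI Uh (Ur _ e0)) f0) f1).
have [hf h2] := hb.
set u := fin \o h n in H1.
have hu : holo_ball u z r by move=> v /hf [].
have zr : cabs (z - z) < r by rewrite subrr cabs0.
have z8 : cabs (z - z) < r / 8 by rewrite subrr cabs0 divr_gt0.
have fd w : cabs (w - z) < r -> cderiv (fun w => linear_form c (u w)) w (c.2 * der u w).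
  move=> wr; have := cderivD (cderiv_cst c.1 w) (cderivM (cderiv_cst c.2 w) (derP (hu w wr))).
  by rewrite add0r mul0r add0r.
have sK : 0 <= K * s by rewrite mulr_ge0 ?ltW.
have [|||||| w wz fw] := @zero_near R (fun w => linear_form c (u w)) z (r / 8)
   (cabs c.2 * K) (c.2 * der u z) s s0.
- lra.
- rewrite cabsM; have : cabs c.2 * (4 * (K * s)) <= cabs c.2 * cabs (der u z).
    by rewrite ler_wpM2l //; lra.
  lra.
- by rewrite mulr_ge0 ?cabs_ge0 // ltW.
- rewrite cabsM; have : s * (cabs c.2 * (cabs D / 2)) <= s * (cabs c.2 * cabs (der u z)).
    by rewrite ler_wpM2l ?(ltW s0) // ler_wpM2l // ltW.
  move: H0; rewrite /u /=; have : 0 < s * (cabs c.2 * cabs D) by rewrite !mulr_gt0.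
  lra.
- by move=> w wr; eexists; apply: fd; lra.
- move=> w wr; have := taylor_bound r0 hu h2 z8 wr; rewrite -/K => T.
  have -> : linear_form c (u w) - linear_form c (u z) - c.2 * der u z * (w - z) =
    c.2 * (u w - u z - der u z * (w - z)) by rewrite /linear_form; ring.
  by rewrite cabsM -mulrA ler_wpM2l.
have w8 : cabs (w - z) < r / 8 by lra.
have wr : cabs (w - z) < r by lra.
have [hw _] := hf w wr.
have := Hr w ltac:(lra); have -> : vanish c (h n w).
  by rewrite /vanish hw /=; apply/eqP.
move=> /(_ isT); rewrite /sph hw -/u /= ler_pdivrMr ?ltr_pwDl ?sqr_ge0 // => H.
have u2 : cabs (fin (h n w)) ^+ 2 <= 4.
  have := h2 w wr => u2; have -> : 4 = 2 ^+ 2 :> R by ring.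
  by rewrite lerXn2r ?nnegrE.
have L := der_lipschitz r0 hu h2 z8 w8; rewrite -/K in L.
have : cabs D / 40 * (1 + cabs (fin (h n w)) ^+ 2) <= cabs D / 40 * 5.
  by rewrite ler_wpM2l ?(ltW e0) //; lra.
have : K * cabs (w - z) <= K * (2 * s) by rewrite ler_wpM2l // ltW.
have := cabs_near (der u w) (der u z).
lra.
Qed.

End Ultralimit.

(** * The local estimate *)

Section LocalTheorem.
Context {R : realType}.
Local Notation C := R[i].
Local Notation S2 := (P1 R).
Implicit Types (g h : C -> S2) (z w : C) (c : C * C) (r B e : R).

Lemma cderiv_affine_comp (f : C -> C) (a b : C) t d : cderiv f (a + b * t) d ->
  cderiv (fun s => f (a + b * s)) t (d * b).
Proof. exact: cderiv_comp (cderiv_affine a b t). Qed.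

Lemma finite_ball_affine_comp h (a b : C) t r : b != 0 -> finite_ball h (a + b * t) r ->
  finite_ball (fun s => h (a + b * s)) t (r / cabs b).
Proof.
move=> b0 hr s; rewrite ltr_pdivlMr ?cabs_gt0 // => st.
have [hE [d fd]] := hr (a + b * s) ltac:(rewrite opprD addrACA subrr add0r -mulrBr cabsM mulrC //).
by split=> //; exists (d * b); exact: (cderiv_affine_comp (f := fin \o h)).
Qed.

Lemma meromorphic_affine_comp h (a b : C) : b != 0 -> meromorphic h ->
  meromorphic (fun s => h (a + b * s)).
Proof.
move=> b0 mh t; have p r : 0 < r -> 0 < r / cabs b by move=> r0; rewrite divr_gt0 // cabs_gt0.
case: (mh (a + b * t)) => -[r r0 hr]; [left|right]; exists (r / cabs b); try exact: p.
  exact: finite_ball_affine_comp.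
exact: (@finite_ball_affine_comp (inversion \o h)).
Qed.

Lemma sph_affine_comp h (a b : C) t : b != 0 -> meromorphic h ->
  sph (fun s => h (a + b * s)) t = cabs b * sph h (a + b * t).
Proof.
move=> b0 mh.
have cz z r : 0 < r -> cabs (z - z) < r by rewrite subrr cabs0.
rewrite /sph; case E : (h (a + b * t)) => [w|].
  have [r r0 hr] := meromorphic_finite mh (ltac:(by rewrite E) : h (a + b * t) <> None).
  have D := derP (hr _ (cz _ _ r0)).2.
  rewrite (der_unique (cderiv_affine_comp D)) cabsM mulrAC.
  by rewrite mulrC.
have mi := meromorphic_inversion mh.
have [r r0 hr] := meromorphic_finite mi (ltac:(by rewrite /= E) : (inversion \o h) (a + b * t) <> None).
have D := derP (hr _ (cz _ _ r0)).2.
by rewrite (der_unique (cderiv_affine_comp D)) cabsM mulrC.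
Qed.

Definition exceptional (c1 c2 c3 c4 c5 : C * C) (q : S2) :=
  [|| vanish c1 q, vanish c2 q, vanish c3 q, vanish c4 q | vanish c5 q].

(** Rescaling by [rho <= 2 / n.+1] turns the bound [M] into one tending to [0], while the
    normalisation [sph g 0 = 1] survives in the limit and contradicts [five_ramified_values]. *)
Theorem local_five_point_bound c1 c2 c3 c4 c5 (M : R) :
  pairwise4 c1 c2 c3 c4 -> pairwise4 c1 c2 c3 c5 -> nondeg c4 c5 ->
  exists K : R, forall h, meromorphic h ->
    (forall z, cabs z <= 1 -> exceptional c1 c2 c3 c4 c5 (h z) -> sph h z <= M) ->
    sph h 0 <= K.
Proof.
move=> p4 p5 n45; apply: contrapT => /forallNP noK.
have hP (n : nat) : exists h, [/\ meromorphic h,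
    forall z, cabs z <= 1 -> exceptional c1 c2 c3 c4 c5 (h z) -> sph h z <= M &
    n.+1%:R < sph h 0].
  have /existsNP [h] := noK n.+1%:R; move=> /not_implyP [mh] /not_implyP [hM] /negP.
  by rewrite -ltNge => hn; exists h.
have gP (n : nat) : exists g : C -> S2, [/\ meromorphic g, sph g 0 = 1,
    forall t, cabs t <= n.+1%:R / 4 -> sph g t <= 4 &
    forall t, cabs t <= n.+1%:R / 4 -> exceptional c1 c2 c3 c4 c5 (g t) ->
      sph g t <= 2 * `|M| / n.+1%:R].
  have [h [mh hM hn]] := hP n.
  have [z0 [rho [r0 rS r1 H]]] := rescaling mh (ltr0Sn R n) hn.
  have b0 : rho%:C%C != 0 :> C by rewrite -cabs_eq0 cabs_real normr_eq0 gt_eqF.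
  have cb : cabs rho%:C%C = rho by rewrite cabs_real gtr0_norm.
  have near t : cabs t <= n.+1%:R / 4 -> cabs (z0 + rho%:C%C * t - z0) <= rho * (n.+1%:R / 4).
    by move=> t1; rewrite addrAC subrr add0r cabsM cb ler_wpM2l // ltW.
  exists (fun t => h (z0 + rho%:C%C * t)); split.
  - exact: meromorphic_affine_comp.
  - by rewrite sph_affine_comp // cb mulr0 addr0.
  - by move=> t /near /H [_]; rewrite sph_affine_comp // cb.
  - move=> t /near /H [z1 _] et; rewrite sph_affine_comp // cb.
    have sM := le_trans (hM _ z1 et) (ler_norm M).
    have -> : 2 * `|M| / n.+1%:R = 2 / n.+1%:R * `|M| by rewrite mulrAC.
    by apply: ler_pM => //; [exact: ltW|exact: sph_ge0].
have [g Hg] := choice gP.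
have [U [UF Uoo]] := @ultraFilterLemma nat \oo _.
have Uge (x : R) : U [set n | x <= n.+1%:R].
  apply: Uoo; near=> n; rewrite /=.
  have : (Num.bound `|x| <= n)%N by near: n; exact: nbhs_infty_ge.
  rewrite -(ler_nat R) => H; have := archi_boundP (normr_ge0 x).
  have := ler_norm x; rewrite -natr1; lra.
pose gl z := sphere_ulim U (fun n => g n z).
have Uball z : U [set n | bounded_ball (g n) z (1 / 40)] \/
    U [set n | bounded_ball (inversion \o g n) z (1 / 40)].
  have Ub : U [set n | bounded_ball (g n) z (1 / 40) \/ bounded_ball (inversion \o g n) z (1 / 40)].
    apply: filterS (Uge (4 * (cabs z + 1))) => n /= zn.
    have [mg _ g4 _] := Hg n; apply: bounded_chart => // w wz; apply: g4.
    by have := cabsD (w - z) z; rewrite subrK; lra.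
  (* At each [z] the ultrafilter selects one of the two charts for almost all [n]. *)
  have [?|UN] := in_ultra_setVsetC [set n | bounded_ball (g n) z (1 / 40)] UF; first by left.
  by right; apply: filterS (filterI Ub UN) => n [] /= [].
have Ufin z w r : cabs (w - z) < r -> U [set n | bounded_ball (g n) z r] ->
    exists2 l, ulim U (fun n => fin (g n w)) l & gl w = Some l.
  move=> wz Ub; apply: sphere_ulim_finite; apply: filterS Ub => n /= b.
  exact: bounded_ball_finite2 b wz.
have Uinf z w r : cabs (w - z) < r -> U [set n | bounded_ball (inversion \o g n) z r] ->
    exists2 l, ulim U (fun n => fin ((inversion \o g n) w)) l & (inversion \o gl) w = Some l.
  move=> wz Ub; apply: sphere_ulim_infinite; apply: filterS Ub => n /= b.
  exact: (bounded_ball_finite2 b wz).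
have r0 : 0 < 1 / 40 :> R by rewrite divr_gt0.
have r8 : 0 < 1 / 40 / 8 :> R by rewrite !divr_gt0.
have ug : uniform_charts gl (1 / 40 / 8).
  move=> z; case: (Uball z) => Ub; [left|right].
    by have [] := ulim_bounded_ball r0 Ub (fun w wz => Ufin z w _ wz Ub).
  by have [] := ulim_bounded_ball r0 Ub (fun w wz => Uinf z w _ wz Ub).
have mg := uniform_charts_meromorphic r8 ug.
have Uram c z e : (forall q, vanish c q -> exceptional c1 c2 c3 c4 c5 q) -> 0 < e ->
    U [set n | forall w, cabs (w - z) < 1 -> vanish c (g n w) -> sph (g n) w <= e].
  move=> cE e0; apply: filterS (filterI (Uge (4 * (cabs z + 1))) (Uge (2 * `|M| / e))) => n.
  move=> [/= zn Mn] w wz cw; have [_ _ _ gM] := Hg n.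
  apply: le_trans (gM w _ (cE _ cw)) _; first by have := cabsD (w - z) z; rewrite subrK; lra.
  by move: Mn; rewrite !ler_pdivrMr // [e * _]mulrC.
have ram c : (c.1 != 0) || (c.2 != 0) ->
    (forall q, vanish c q -> exceptional c1 c2 c3 c4 c5 q) -> ramified gl c.
  move=> c0 cE z; case: (Uball z) => Ub.
    by apply: ulim_ramified r0 c0 Ub (fun w wz => Ufin z w _ wz Ub) (fun e => Uram c z e cE).
  rewrite -vanish_inversion -sph_inversion //.
  apply: (@ulim_ramified R U UF (fun n => inversion \o g n) (inversion \o gl) z (1 / 40) (swapc c) r0) => //.
  - by rewrite /= orbC.
  - by move=> w wz; exact: Uinf wz Ub.
  - move=> e e0; apply: filterS (Uram c z e cE e0) => n /= H w wz.
    by have [mgn _ _ _] := Hg n; rewrite vanish_inversion sph_inversion //; exact: H.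
have [[n12 n13 n14] [n23 n24 n34]] := p4; have [[_ _ n15] [_ n25 n35]] := p5.
have ex q : [/\ vanish c1 q -> exceptional c1 c2 c3 c4 c5 q,
   vanish c2 q -> exceptional c1 c2 c3 c4 c5 q,
   vanish c3 q -> exceptional c1 c2 c3 c4 c5 q,
   vanish c4 q -> exceptional c1 c2 c3 c4 c5 q &
   vanish c5 q -> exceptional c1 c2 c3 c4 c5 q].
  by split; rewrite /exceptional => ->; rewrite ?orbT.
have := five_ramified_values r8 ug p4 p5 n45
  (ram c1 (nondeg_neq0 n12) (fun q => let: And5 H _ _ _ _ := ex q in H))
  (ram c2 (nondeg_neq0 n23) (fun q => let: And5 _ H _ _ _ := ex q in H))
  (ram c3 (nondeg_neq0 n34) (fun q => let: And5 _ _ H _ _ := ex q in H))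
  (ram c4 (nondeg_neq0 n45) (fun q => let: And5 _ _ _ H _ := ex q in H))
  (ram c5 (nondeg_neq0 (nondegC n45)) (fun q => let: And5 _ _ _ _ H := ex q in H)) 0.
(* In a finite chart [sph = 1] forces the derivative to have modulus at least [1], a closed
   condition that passes to the limit. *)
have one k (h : nat -> C -> S2) : U [set n | bounded_ball (h n) 0 (1 / 40)] ->
    (forall n, sph (h n) 0 = 1) ->
    ulim U (fun n => der (fin \o h n) 0) (der (fin \o k) 0) -> bounded_ball k 0 (1 / 40 / 8) ->
    sph k 0 <> 0.
  move=> Ub s1 Hd [kf _]; have [kE _] := kf 0 ltac:(by rewrite subrr cabs0).
  have D1 : 1 <= cabs (der (fin \o k) 0).
    apply: ulim_ge Hd _; apply: filterS Ub => n [/= hf _].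
    have [hE _] := hf 0 ltac:(by rewrite subrr cabs0).
    have := s1 n; rewrite /sph hE; set v := cabs (fin _); set d := cabs _ => vd.
    have P : 0 < 1 + v ^+ 2 by rewrite ltr_pwDl // sqr_ge0.
    have -> : d = 1 + v ^+ 2 by apply: (divIf (lt0r_neq0 P)); rewrite vd divff // lt0r_neq0.
    by rewrite lerDl sqr_ge0.
  by move=> /(sph_finite_eq0 kE) d0; move: D1; rewrite d0 cabs0 ler10.
case: (Uball 0) => Ub.
  have [b d] := ulim_bounded_ball r0 Ub (fun w wz => Ufin 0 w _ wz Ub).
  by apply: (one gl g Ub _ d b) => n; have [] := Hg n.
have [b d] := ulim_bounded_ball r0 Ub (fun w wz => Uinf 0 w _ wz Ub).
rewrite -sph_inversion //.
apply: (one (inversion \o gl) (fun n => inversion \o g n) Ub _ d b) => n.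
by have [mgn g1 _ _] := Hg n; rewrite sph_inversion.
Unshelve. all: by end_near. Qed.

End LocalTheorem.

(** * Restriction to complex lines *)

Section Lines.
Context {R : realType} {m : nat}.
Local Notation C := R[i].
Local Notation V := 'rV[R[i]^o]_m.

Lemma complex_gt0 (e : C) : 0 < e -> e = (complex.Re e)%:C%C /\ 0 < complex.Re e.
Proof. by case: e => a b; rewrite ltcE /= => /andP[/eqP -> ?]. Qed.

Lemma nbhs_cabs (z : R[i]^o) (P : set R[i]^o) : nbhs z P ->
  exists2 r : R, 0 < r & forall w, cabs (w - z) < r -> P w.
Proof.
move=> /nbhs_ballP [e /= e0 H]; have [eE r0] := complex_gt0 e0.
exists (complex.Re e) => // w wr; apply: H; rewrite /ball /= eE norm_cabs ltcR.
by rewrite cabs_dist.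
Qed.

Lemma line_continuous (z v : V) : continuous (fun s : R[i]^o => z + s *: v).
Proof.
move=> s; apply: differentiable_continuous.
apply: differentiableD; first exact: differentiable_cst.
by have [] : is_diff s ( *:%R ^~ v : R[i]^o -> V) ( *:%R ^~ v) by exact: is_diff_scalel.
Qed.

Lemma near_line (z v : V) (t : R[i]^o) (P : set V) : (\forall w \near (z + t *: v), P w) ->
  exists2 r : R, 0 < r & forall s, cabs (s - t) < r -> P (z + s *: v).
Proof. by move=> /(@line_continuous z v t)/nbhs_cabs. Qed.

Lemma cderiv_line (F : V -> R[i]^o) (z v : V) (t : R[i]^o) :
  differentiable F (z + t *: v) ->
  cderiv (fun s => F (z + s *: v)) t ('d F (z + t *: v) v).
Proof.
move=> dF e e0; have D := diff_derivable (v := v) dF.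
rewrite -deriveE //; set w := z + t *: v in D *.
have : h^-1 *: (F (h *: v + w) - F w) @[h --> (0 : R[i]^o)^'] --> 'D_v F w by exact: D.
move=> /cvgrPdist_le /(_ e%:C%C); rewrite ltcR => /(_ e0) /nbhs_cabs [r r0 Hr].
exists r => // s st; have [->|sn] := eqVneq s t; first by rewrite !subrr mulr0 subrr cabs0 mulr0.
have st0 : s - t != 0 by rewrite subr_eq0.
have := Hr (s - t); rewrite subr0 => /(_ st st0) /=.
have -> : (s - t) *: v + w = z + s *: v.
  by rewrite /w scalerBl addrCA subrK.
rewrite norm_cabs lecR => H; rewrite -(ler_pM2r (_ : 0 < cabs (s - t))) in H; last by rewrite cabs_gt0.
rewrite -cabsM in H; apply: le_trans H; rewrite -cabsN le_eqVlt; apply/orP; left; apply/eqP; congr cabs.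
by rewrite /GRing.scale /=; field.
Qed.

Lemma chart_Some (w : C) : chart (Some w : P1 R) = fin.
Proof. by apply/funext; case. Qed.

Lemma chart_None : chart (None : P1 R) = fin \o (@inversion R).
Proof. by apply/funext => -[w|] //=; case: eqP => [->|//]; rewrite invr0. Qed.

Lemma near_finite (w : C) : \forall q \near (Some w : P1 R), q = Some (fin q).
Proof. exact: (@filterE _ (nbhs (w : R[i]^o)) _ _ (fun v => erefl (Some v))). Qed.

Lemma near_infinite : \forall q \near (None : P1 R), inversion q = Some (fin (inversion q)).
Proof.
(* A neighbourhood of infinity is the complement of a closed compact set, and [Some 0] is the only
   point with infinite inversion. *)
exists [set (0 : R[i]^o)].
  by split; [exact: compact_set1|apply: compact_closed; [exact: norm_hausdorff|exact: compact_set1]].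
move=> q [[v /= v0 <-]|-> //] /=; case: eqP => // v1; exfalso; exact: v0.
Qed.

Lemma finite_ball_line (G : V -> P1 R) (z v : V) (t : R[i]^o) :
  (\forall w \near (z + t *: v), G w = Some (fin (G w))) ->
  (\forall w \near (z + t *: v), differentiable (fin \o G : V -> R[i]^o) w) ->
  exists2 r : R, 0 < r & finite_ball (fun s => G (z + s *: v)) t r.
Proof.
move=> /near_line [r r0 Hr] /near_line [s s0 Hs].
exists (Num.min r s); first by rewrite lt_min r0.
move=> u; rewrite lt_min => /andP[/Hr Gu /Hs du]; split=> //.
by eexists; exact: (cderiv_line du).
Qed.

(** The factor [rho] serves to parametrise a disc of radius [rho] on the line by the unit disc. *)
Lemma holomorphic_line (f : V -> P1 R) (z v : V) : holomorphic f ->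
  meromorphic (fun s => f (z + s *: v)) /\
  forall t (rho : R) xi, v = rho%:C%C *: xi -> 0 <= rho ->
    sph (fun s => f (z + s *: v)) t =
    rho * tangent_length (f (z + t *: v)) (dP1 f (z + t *: v) xi).
Proof.
move=> [cf df]; split=> [t|t rho xi vE rho0].
  have := df (z + t *: v); have := cf (z + t *: v).
  case E : (f (z + t *: v)) => [w|] cft dft; [left|right].
    apply: finite_ball_line; last by move: dft; rewrite chart_Some.
    have H : nbhs (f (z + t *: v)) [set q | q = Some (fin q)].
      by rewrite E; exact: near_finite.
    exact: (cft _ H).
  apply: (@finite_ball_line (@inversion R \o f)); last by move: dft; rewrite chart_None.
  have H : nbhs (f (z + t *: v)) [set q | inversion q = Some (fin (inversion q))].
    by rewrite E; exact: near_infinite.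
  exact: (cft _ H).
have dft := nbhs_singleton (df (z + t *: v)).
have K (F : V -> R[i]^o) : differentiable F (z + t *: v) ->
    cabs (der (fun s => F (z + s *: v)) t) = rho * complex.Re `|'d F (z + t *: v) xi|.
  move=> dF; rewrite (der_unique (cderiv_line dF)).
  have L u : 'd F u v = rho%:C%C * 'd F u xi by rewrite vE; exact: (linearZ_LR ('d F u)).
  by rewrite L cabsM cabs_real ger0_norm // cabsE.
rewrite /sph /dP1; case E : (f (z + t *: v)) dft => [w|] dft.
  by rewrite tangent_length_Some mulrA -(K (chart (Some w) \o f)) // chart_Some -cabsE.
by rewrite tangent_length_None -(K (chart None \o f)) // chart_None.
Qed.

Lemma enorm_sqr (z : V) : enorm z ^+ 2 = \sum_j cabs (z 0 j) ^+ 2.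
Proof.
have E : dotmx z z = (\sum_j cabs (z 0 j) ^+ 2)%:C%C.
  rewrite dotmx_sum rmorph_sum; apply: eq_bigr => j _.
  by rewrite -normCK norm_cabs rmorphXn.
by rewrite /enorm E /= sqr_sqrtr // sumr_ge0 // => j _; rewrite sqr_ge0.
Qed.

Lemma enorm_ge0 (z : V) : 0 <= enorm z. Proof. exact: sqrtr_ge0. Qed.

Lemma enorm_unit_le (z xi : V) (t : C) : enorm xi = 1 ->
  enorm (z + t *: xi) <= enorm z + cabs t.
Proof.
move=> x1; pose A := enorm z; have A0 : 0 <= A := enorm_ge0 z.
pose a j := cabs (z 0 j); pose b j := cabs (xi 0 j).
have a0 j : 0 <= a j := cabs_ge0 _.
have b0 j : 0 <= b j := cabs_ge0 _.
have sa : \sum_j a j ^+ 2 = A ^+ 2 by rewrite enorm_sqr.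
have sb : \sum_j b j ^+ 2 = 1 by rewrite -(expr1n _ 2) -x1 enorm_sqr.
have cs : \sum_j a j * b j <= A.
  (* Cauchy-Schwarz from the squares of [a j - (A + e) * b j]; the [e] keeps the factor to be
     cancelled positive when [z = 0]. *)
  apply/ler_addgt0Pl => e e0; have Ae : 0 < A + e by lra.
  have : \sum_j (2 * (A + e)) * (a j * b j) <= \sum_j (a j ^+ 2 + (A + e) ^+ 2 * b j ^+ 2).
    apply: ler_sum => j _; have := sqr_ge0 (a j - (A + e) * b j).
    by rewrite sqrrB exprMn; lra.
  rewrite -mulr_sumr big_split /= -mulr_sumr sa sb mulr1 => H.
  have AA : A ^+ 2 <= (A + e) ^+ 2 by rewrite lerXn2r ?nnegrE //; lra.
  rewrite -(ler_pM2l (_ : 0 < 2 * (A + e))); last lra.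
  apply: le_trans H _; rewrite (addrC e) -mulrA -expr2; lra.
rewrite -(ler_pXn2r (n := 2)) ?nnegrE ?enorm_ge0 ?addr_ge0 ?enorm_ge0 //.
rewrite enorm_sqr.
have : \sum_j cabs ((z + t *: xi) 0 j) ^+ 2 <= \sum_j (a j + cabs t * b j) ^+ 2.
  apply: ler_sum => j _; rewrite lerXn2r ?nnegrE ?addr_ge0 ?mulr_ge0 //.
  by rewrite !mxE; apply: le_trans (cabsD _ _) _; rewrite cabsM.
move=> /le_trans; apply.
have -> : \sum_j (a j + cabs t * b j) ^+ 2 = A ^+ 2 + 2 * cabs t * (\sum_j a j * b j) + cabs t ^+ 2.
  have T : cabs t ^+ 2 = \sum_j cabs t ^+ 2 * b j ^+ 2 by rewrite -mulr_sumr sb mulr1.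
  rewrite -sa T mulr_sumr -!big_split /=.
  by apply: eq_bigr => j _; ring.
have : cabs t * (\sum_j a j * b j) <= cabs t * A by rewrite ler_wpM2l.
rewrite -/A sqrrD; lra.
Qed.

Lemma enorm_unit_dist (z xi : V) (t : C) : enorm xi = 1 ->
  `|enorm (z + t *: xi) - enorm z| <= cabs t.
Proof.
move=> x1; have := enorm_unit_le z t x1; have := enorm_unit_le (z + t *: xi) (- t) x1.
rewrite scaleNr addrK cabsN ler_norml.
by move: (enorm z) (enorm (z + t *: xi)) (cabs t) => a b d; lra.
Qed.

End Lines.

(** * Lipschitz bound for weights, and points of the sphere as zeros of linear forms *)

Section Weights.
Context {R : realType}.

(** The slopes are bounded for [r > 0], whence the positivity of [a] and [b]; [c <= 1] gives the
    Lipschitz constant [1]. *)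
Lemma admissible_lipschitz (phi : R -> R) (a b : R) : admissible_weight phi ->
  0 < a -> 0 < b -> `|phi a - phi b| <= `|a - b|.
Proof.
move=> [_ [c /andP[c0 c1] Hc] _].
wlog ab : a b / a < b.
  move=> H a0 b0; case: (ltgtP a b) => [ab|ab|->]; [exact: H| |by rewrite !subrr].
  by rewrite distrC (distrC a); exact: H.
move=> a0 _; have ab0 : a - b != 0 by rewrite subr_eq0 lt_eqF.
have : (`|(phi a - phi b) / (a - b)|%:E <= c%:E)%E.
  apply: le_trans (Hc a a0); apply: ereal_sup_ubound => /=.
  by exists (a, b) => //=; rewrite lexx.
rewrite lee_fin normrM normfV ler_pdivrMr ?normr_gt0 // => /le_trans; apply.
by rewrite ler_piMl.
Qed.

Definition point_form (q : P1 R) : R[i] * R[i] :=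
  if q is Some a then (- a, 1) else (1, 0).

Lemma vanish_point_form (p q : P1 R) : vanish (point_form p) q = (q == p).
Proof.
rewrite /vanish; case: p => [a|]; case: q => [w|] /=; rewrite /linear_form /=.
- by rewrite mul1r addrC subr_eq0.
- by rewrite mulr0 addr0 oner_eq0.
- by rewrite mul0r addr0 oner_eq0.
- by rewrite mulr0 addr0 !eqxx.
Qed.

Lemma nondeg_point_form (p q : P1 R) : p != q -> nondeg (point_form p) (point_form q).
Proof.
rewrite /nondeg; case: p => [a|]; case: q => [b|] //= pq.
- rewrite mulr1 mul1r opprK addrC subr_eq0; apply: contraNneq pq => -> //.
- by rewrite mulr0 sub0r mulr1 oppr_eq0 oner_eq0.
- by rewrite mulr1 mul0r subr0 oner_eq0.
Qed.

End Weights.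

(** * From the local estimate on complex lines to the weighted bound *)

Local Open Scope card_scope.

Theorem theorem3p1 (R : realType) (m : nat) (phi : R -> R)
    (f : 'rV[R[i]^o]_m -> P1 R) :
  (1 <= m)%N ->
  admissible_weight phi ->
  holomorphic f ->
  (exists2 A : set (P1 R), A #= `I_5 &
     (ereal_sup (weighted_length phi f @` (f @^-1` A `*` @unit_sphere R m))
        < +oo)%E) ->
  yosida phi f.
Proof.
move=> _ aphi hf [A A5 Asup]; split=> //.
have [phi0 _ _] := aphi.
have [a [aA ainj asurj]] := card_set_bijP (card_esym A5).
have [M HM] : exists M : R, forall z xi, A (f z) -> enorm xi = 1 ->
    phi (enorm z) * tangent_length (f z) (dP1 f z xi) <= M.
  have [M HM] : exists M : R, (ereal_sup (weighted_length phi f @`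
     (f @^-1` A `*` @unit_sphere R m)) <= M%:E)%E.
    move: Asup; case: ereal_sup => [r| |] // _; first by exists r.
    (* The supremum is [-oo] when it is taken over the empty set, for instance if [f] omits [A]. *)
    by exists 0; rewrite leNye.
  exists M => z xi Az x1; rewrite -lee_fin; apply: le_trans HM.
  by apply: ereal_sup_ubound; exists (z, xi).
have nd i j : (i < 5)%N -> (j < 5)%N -> i != j ->
    nondeg (point_form (a i)) (point_form (a j)).
  move=> i5 j5 ij; apply: nondeg_point_form; apply: contra_neq ij => E.
  by apply: ainj => //; rewrite inE.
have p4 k : (3 <= k < 5)%N -> pairwise4 (point_form (a 0%N)) (point_form (a 1%N))
    (point_form (a 2%N)) (point_form (a k)).
  by case/andP=> k3 k5; split; split; apply: nd => //; apply: contraTneq k3 => <-.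
have [K HK] := local_five_point_bound M (p4 3%N isT) (p4 4%N isT) (nd 3%N 4%N isT isT isT).
(* For [N >= phi 1 + 2], the inequality [phi N <= phi 1 + N - 1] gives [phi N / 2 < N]: the disc of
   radius [phi (enorm z) / 2] around [z] avoids the origin, where [admissible_lipschitz] says
   nothing. *)
pose r0 := phi 1 + 2.
have phi1 : 0 < phi 1 by apply: phi0.
suff main z xi : r0 <= enorm z -> enorm xi = 1 ->
    phi (enorm z) * tangent_length (f z) (dP1 f z xi) <= 2 * K.
  apply: (@le_lt_trans _ _ (2 * K)%:E); last exact: ltry.
  rewrite limf_esupE; apply: le_trans (ereal_inf_lbound _) _.
    by exists ([set z | r0 <= enorm z] `*` @unit_sphere R m) => //; exists r0.
  by apply: ge_ereal_sup => _ [[z xi] [/= z0 x1] <-]; rewrite lee_fin main.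
have num1 (p N q : R) : 0 < p -> p + 2 <= N -> `|q - p| <= `|N - 1| -> q / 2 < N.
  by move=> p0 pN; rewrite (@ger0_norm _ (N - 1)) ?ler_norml; lra.
have num2 (N W q : R) : q / 2 < N -> `|W - N| <= q / 2 -> 0 < W.
  by rewrite ler_norml; lra.
have num3 (q q' d : R) : `|q' - q| <= d -> d <= q / 2 -> q / 2 <= q'.
  by rewrite ler_norml; lra.
have num4 (q t : R) : q / 2 * t <= K -> q * t <= 2 * K by lra.
move=> zr x1; have z0 : 0 < enorm z by apply: lt_le_trans zr; rewrite /r0; lra.
(* On the disc of radius [rho] the weight is still at least [rho], so the restriction to the line,
   parametrised on the unit disc, has spherical derivative at most [M] at the five values; halving
   the weight accounts for the [2] in [2 * K]. *)
pose rho := phi (enorm z) / 2.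
have pz : 0 < phi (enorm z) by apply: phi0; exact: ltW.
have rho0 : 0 < rho by rewrite divr_gt0.
have rhoz : rho < enorm z by apply: num1 phi1 zr _; exact: admissible_lipschitz.
pose v := rho%:C%C *: xi : 'rV[R[i]^o]_m.
have [mh sh] := holomorphic_line z v hf.
have := HK _ mh; rewrite (sh 0 rho xi erefl (ltW rho0)) scale0r addr0 => H.
apply: num4; apply: H => t t1 ex; rewrite (sh t rho xi erefl (ltW rho0)).
set w := z + t *: v in ex *.
have Aw : A (f w).
  have E i : (i < 5)%N -> vanish (point_form (a i)) (f w) -> A (f w).
    by move=> i5; rewrite vanish_point_form => /eqP ->; apply: aA.
  by case/or4P: ex => [||| /orP[]]; [exact: (E 0%N)|exact: (E 1%N)|exact: (E 2%N)|exact: (E 3%N)|exact: (E 4%N)].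
have wz : `|enorm w - enorm z| <= rho.
  have -> : w = z + (t * rho%:C%C) *: xi by rewrite /w /v scalerA.
  apply: le_trans (enorm_unit_dist _ _ x1) _; rewrite cabsM cabs_real gtr0_norm //.
  by rewrite ler_piMl // ltW.
have w0 : 0 < enorm w := num2 _ _ _ rhoz wz.
have rw : rho <= phi (enorm w) := num3 _ _ _ (admissible_lipschitz aphi w0 z0) wz.
apply: le_trans (HM w xi Aw x1).
apply: ler_wpM2r rw; rewrite /tangent_length; exact: sqrtr_ge0.
Qed.
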